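(* Let $(X_t,\ t\ge0)$ be the bivariate stationary Ornstein-Uhlenbeck process with parameter $\theta=(\alpha,\beta)'\in\Theta$, let $h>0$, $r(x,\theta)=e^{-hQ(\theta)}x$, and let $\widehat\theta_T$ be the maximum likelihood estimator of $\theta$ based on $(X_t,\ 0\le t\le T)$. Then the plug-in estimator $r(\cdot,\widehat\theta_T)$ is an asymptotically efficient estimator of the regression function $r(\cdot,\theta)$ with respect to $\mu_\theta=\mathcal N\big(0,\tfrac12Q(\theta)^{-1}\big)$, i.e. for all $\theta\in\Theta$, $$\lim_{T\to\infty}T\int_{\mathbb R^2}\mathrm E_\theta\Big[\big(r(x,\widehat\theta_T)-r(x,\theta)\big)\big(r(x,\widehat\theta_T)-r(x,\theta)\big)'\Big]d\mu_\theta(x)=\int_{\mathbb R^2}(\mathrm J_\theta r(x,\theta))\,I(\theta)^{-1}(\mathrm J_\theta r(x,\theta))'\,d\mu_\theta(x)=h^2e^{-2hQ(\theta)},$$ where $I(\theta)=Q(\theta)^{-1}$.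
   Context: $Q(\theta)=\begin{pmatrix}\alpha&\beta\\ \beta&\alpha\end{pmatrix}$ for $\theta=(\alpha,\beta)'$, and $\Theta=\{\theta\in\mathbb R^2: Q(\theta)\text{ is positive definite}\}$. Under $\mathrm P_\theta$, $(X_t,\ t\ge0)$ is the stationary solution in $\mathbb R^2$ of $dX_t=-Q(\theta)X_t\,dt+dW_t$, with $W$ a standard bivariate Wiener process; thus $X_T\sim\mathcal N(0,\frac12Q(\theta)^{-1})=\mu_\theta$ for all $T$. The likelihood of the path $X_{(T)}=(X_t,\ 0\le t\le T)$ is, up to a factor not depending on $\theta$, $$2\sqrt{\det Q(\theta)}\,\exp\Big\{\alpha T-\tfrac12\big(X_0'Q(\theta)X_0+X_T'Q(\theta)X_T\big)-\tfrac12\int_0^T\|Q(\theta)X_t\|^2dt\Big\},$$ and $\widehat\theta_T$ is its maximizer over $\Theta$. $\mathrm J_\theta r(x,\theta)$ is the Jacobian matrix of $\theta\mapsto r(x,\theta)$; $'$ denotes transpose. $I(\theta)$ is the asymptotic Fisher information matrix of the model. Here $r(x,\theta)=\mathrm E_\theta(X_{T+h}\mid X_T=x)$. *)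

(* Defs.v *)
From HB Require Import structures.
From mathcomp Require Import all_boot all_order all_algebra.
From mathcomp Require Import all_classical all_reals all_analysis.
From mathcomp Require Import measurable_realfun ring.

Set Implicit Arguments.
Unset Strict Implicit.
Unset Printing Implicit Defensive.

Import Order.TTheory GRing.Theory Num.Theory.
Import numFieldNormedType.Exports.

Local Open Scope classical_set_scope.
Local Open Scope ring_scope.

(* Points of the plane are column vectors; its Borel sigma-algebra is the
   product one on R * R, reached through [coords] and [col2]. *)
Definition coords {R : realType} (v : 'cV[R]_2) : R * R := (v 0 0, v 1 0).

Definition col2 {R : realType} (z : R * R) : 'cV[R]_2 :=
  \col_i (if i == 0 then z.1 else z.2).

Definition quadform {R : realType} (A : 'M[R]_2) (v : 'cV[R]_2) : R :=
  (v^T *m A *m v) 0 0.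

Definition sqnorm {R : realType} (v : 'cV[R]_2) : R := (v^T *m v) 0 0.

Definition posdefmx {R : realType} (A : 'M[R]_2) : Prop :=
  A^T = A /\ forall v, v != 0 -> 0 < quadform A v.

Definition expmx {R : realType} (A : 'M[R]_2) : 'M[R]_2 :=
  limn (series (fun k => (k`!%:R)^-1 *: A ^+ k)).

Definition mxintegral {d} {T : measurableType d} {R : realType} {m n : nat}
    (mu : {measure set T -> \bar R}) (D : set T) (F : T -> 'M[R]_(m, n)) :
    'M[R]_(m, n) :=
  \matrix_(i, j) \int[mu]_(x in D) F x i j.

(* Column j is the partial derivative along the j-th coordinate. The library's
   ['J f p] uses row vectors, hence the transposed convention. *)
Definition jacobianmx {R : realType} (f : 'cV[R]_2 -> 'cV[R]_2)
    (p : 'cV[R]_2) : 'M[R]_2 :=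
  \matrix_(i, j) ('D_(delta_mx j 0) f p) i 0.

Definition gradient {R : realType} (f : 'cV[R]_2 -> R) (p : 'cV[R]_2) :
    'cV[R]_2 :=
  \col_i 'D_(delta_mx i 0) f p.

Section centered_gaussian.
Context {R : realType}.

Definition gaussian_pdf (S : 'M[R]_2) (z : R * R) : R :=
  (2 * pi * Num.sqrt (\det S))^-1 * expR (- 2^-1 * quadform (invmx S) (col2 z)).

(* N(0, S); meaningful when S is positive definite. *)
Definition gaussian (S : 'M[R]_2) (A : set (R * R)) : \bar R :=
  (\int[lebesgue_measure \x lebesgue_measure]_(z in A) (gaussian_pdf S z)%:E)%E.

Lemma gaussian_pdf_ge0 S z : 0 <= gaussian_pdf S z.
Proof.
rewrite /gaussian_pdf mulr_ge0 ?expR_ge0// invr_ge0 !mulr_ge0//.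
exact: pi_ge0.
Qed.

Lemma measurable_gaussian_pdf S : measurable_fun setT (gaussian_pdf S).
Proof.
have E : gaussian_pdf S = fun z => (2 * pi * Num.sqrt (\det S))^-1 *
    expR (- 2^-1 *
      (invmx S 0 0 * (z.1 * z.1) + (invmx S 0 1 + invmx S 1 0) * (z.1 * z.2) +
       invmx S 1 1 * (z.2 * z.2))).
  apply/funext => z; rewrite /gaussian_pdf; congr (_ * expR (_ * _)).
  rewrite /quadform /col2 !(mxE, big_ord_recl, big_ord0) /=.
  have -> : lift ord0 ord0 = 1 :> 'I_2 by apply/val_inj.
  have -> : ord0 = 0 :> 'I_2 by apply/val_inj.
  by ring.
rewrite E.
have m1 : measurable_fun setT (fst : R * R -> R) by exact: measurable_fst.
have m2 : measurable_fun setT (snd : R * R -> R) by exact: measurable_snd.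
apply: measurable_funM => //; apply: measurableT_comp => //.
apply: measurable_funM => //.
by repeat apply: measurable_funD; apply: measurable_funM => //;
  apply: measurable_funM.
Qed.

Let gaussian0 S : gaussian S set0 = 0%E.
Proof. by rewrite /gaussian integral_set0. Qed.

Let gaussian_ge0 S A : (0 <= gaussian S A)%E.
Proof.
by apply: integral_ge0 => z _; rewrite lee_fin gaussian_pdf_ge0.
Qed.

Let gaussian_sigma_additive S : semi_sigma_additive (gaussian S).
Proof.
move=> F mF tF mUF; rewrite /gaussian ge0_integral_bigcup//=; last 2 first.
- apply: measurable_funTS; apply/measurable_EFinP.
  exact: measurable_gaussian_pdf.
- by move=> z _; rewrite lee_fin gaussian_pdf_ge0.
apply: is_cvg_ereal_nneg_natsum_cond => n _ _.
by apply: integral_ge0 => z _; rewrite lee_fin gaussian_pdf_ge0.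
Qed.

HB.instance Definition _ S := isMeasure.Build _ _ R (gaussian S)
  (gaussian0 S) (gaussian_ge0 S) (@gaussian_sigma_additive S).

End centered_gaussian.

Section processes.
Context {d} {Omega : measurableType d} {R : realType}.
Implicit Types (P : probability Omega R) (W X : R -> Omega -> 'cV[R]_2).

Definition hits (V : Omega -> 'cV[R]_2) (B : set (R * R)) : set Omega :=
  [set w | B (coords (V w))].

Definition has_law P (V : Omega -> 'cV[R]_2) (mu : set (R * R) -> \bar R) :
    Prop :=
  forall B, measurable B -> P (hits V B) = mu B.

Definition continuous_process X : Prop :=
  (forall t, 0 <= t -> measurable_fun setT (fun w => coords (X t w))) /\
  (forall w, {within `[0, +oo[, continuous (fun t => X t w)}).

Definition increment W (s t : R) (w : Omega) : 'cV[R]_2 := W t w - W s w.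

Definition independent_increments P W : Prop :=
  forall (t : nat -> R) (n : nat) (B : nat -> set (R * R)),
    0 <= t 0%N -> {homo t : i j / (i <= j)%N >-> i <= j} ->
    (forall i, measurable (B i)) ->
    P (\bigcap_(i < n) hits (increment W (t i) (t i.+1)) (B i)) =
    (\prod_(i < n) P (hits (increment W (t i) (t i.+1)) (B i)))%E.

Definition standard_wiener P W : Prop :=
  [/\ continuous_process W,
      {ae P, forall w, W 0 w = 0},
      independent_increments P W &
      forall s t, 0 <= s -> s < t ->
        has_law P (increment W s t) (gaussian ((t - s)%:M))].

Definition independent_of_process P (V : Omega -> 'cV[R]_2) W : Prop :=
  forall (t : nat -> R) (n : nat) (A : set (R * R)) (B : nat -> set (R * R)),
    (forall i, 0 <= t i) -> measurable A -> (forall i, measurable (B i)) ->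
    P (hits V A `&` \bigcap_(i < n) hits (W (t i)) (B i)) =
    (P (hits V A) * P (\bigcap_(i < n) hits (W (t i)) (B i)))%E.

Definition strictly_stationary P X : Prop :=
  forall (s : R) (t : nat -> R) (n : nat) (B : nat -> set (R * R)),
    0 <= s -> (forall i, 0 <= t i) -> (forall i, measurable (B i)) ->
    P (\bigcap_(i < n) hits (X (t i + s)) (B i)) =
    P (\bigcap_(i < n) hits (X (t i)) (B i)).

(* x |-> g x is a version of E(X_{T+h} | X_T = x) for every T >= 0. *)
Definition regression_function P X (h : R) (g : 'cV[R]_2 -> 'cV[R]_2) : Prop :=
  measurable_fun setT (fun z => coords (g (col2 z))) /\
  forall T, 0 <= T ->
    (forall i, P.-integrable setT (fun w => (g (X T w) i 0)%:E)) /\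
    (forall B, measurable B ->
      mxintegral P (hits (X T) B) (X (T + h)) =
      mxintegral P (hits (X T) B) (fun w => g (X T w))).

End processes.

Section ornstein_uhlenbeck.
Context {d} {Omega : measurableType d} {R : realType}.
Implicit Types (theta : 'cV[R]_2) (X : R -> Omega -> 'cV[R]_2).

Definition Q theta : 'M[R]_2 :=
  \matrix_(i, j) (if i == j then theta 0 0 else theta 1 0).

Definition Theta : set 'cV[R]_2 := [set theta | posdefmx (Q theta)].

Definition mu_ theta := gaussian (2^-1 *: invmx (Q theta)).

(* As the noise is additive, the equation dX = - Q X dt + dW is read pathwise
   in integrated form. *)
Definition OU_solution (P : probability Omega R) theta X
    (W : R -> Omega -> 'cV[R]_2) : Prop :=
  {ae P, forall w, forall t, 0 <= t ->
    X t w = X 0 w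
      - mxintegral lebesgue_measure `[0, t] (fun s => Q theta *m X s w)
      + W t w}.

(* [X 0] independent of [W] plus stationarity force the marginal law N(0, Q^-1/2)
   of the last clause, and that law for [X 0] forces stationarity. *)
Definition stationary_OU (P : probability Omega R) theta X : Prop :=
  exists W : R -> Omega -> 'cV[R]_2,
    [/\ standard_wiener P W,
        independent_of_process P (X 0) W,
        OU_solution P theta X W,
        strictly_stationary P X &
        forall t, 0 <= t -> has_law P (X t) (mu_ theta)].

(* With respect to a dominating measure free of theta. *)
Definition likelihood (T : R) (x : R -> 'cV[R]_2) theta : R :=
  2 * Num.sqrt (\det (Q theta)) *
  expR (theta 0 0 * T
        - 2^-1 * (quadform (Q theta) (x 0) + quadform (Q theta) (x T))
        - 2^-1 * \int[lebesgue_measure]_(t in `[0, T]) sqnorm (Q theta *m x t)).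

(* Almost surely only: on a null set of paths the likelihood may have no
   maximizer. *)
Definition maximum_likelihood_estimator (P : 'cV[R]_2 -> probability Omega R)
    X (thetahat : R -> Omega -> 'cV[R]_2) : Prop :=
  forall T, 0 < T ->
    measurable_fun setT (fun w => coords (thetahat T w)) /\
    forall theta, Theta theta -> {ae P theta, forall w,
      Theta (thetahat T w) /\
      forall eta, Theta eta ->
        likelihood T (X ^~ w) eta <= likelihood T (X ^~ w) (thetahat T w)}.

Definition score (T : R) (x : R -> 'cV[R]_2) theta : 'cV[R]_2 :=
  gradient (fun eta => ln (likelihood T x eta)) theta.

(* P is meant to be the law under theta. *)
Definition fisher_information (P : probability Omega R) X theta (T : R) :
    'M[R]_2 :=
  mxintegral P setT
    (fun w => score T (X ^~ w) theta *m (score T (X ^~ w) theta)^T).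

Definition asymptotic_information (P : probability Omega R) X theta : 'M[R]_2 :=
  lim (T^-1 *: fisher_information P X theta T @[T --> +oo]).

Definition r (h : R) (x theta : 'cV[R]_2) : 'cV[R]_2 :=
  expmx (- h *: Q theta) *m x.

End ornstein_uhlenbeck.

(* Main.v *)
Require Import Defs.
From HB Require Import structures.
From mathcomp Require Import all_boot all_order all_algebra.
From mathcomp Require Import all_classical all_reals all_analysis.
From mathcomp Require Import measurable_realfun ring lra.
Set Implicit Arguments.
Unset Strict Implicit.
Unset Printing Implicit Defensive.
Import Order.TTheory GRing.Theory Num.Theory.
Import numFieldNormedType.Exports.
Local Open Scope classical_set_scope.
Local Open Scope ring_scope.

(** The matrices Q(theta) all share the orthonormal eigenvectors (1, 1) / sqrt 2 and (1, -1) / sqrt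
    2, with eigenvalues alpha + beta and alpha - beta ([lam]). In these coordinates ([pr]) the
    process splits into two scalar Ornstein-Uhlenbeck processes y, of rate a, driven by uncorrelated
    Wiener processes B, and the likelihood is a product of one factor per eigenvalue
    ([likelihoodE]). With S the integral of y^2 over [0, T] and M = (T - y_0^2 - y_T^2) / 2, the
    estimate c of the eigenvalue a solves 1/(2c) + M - c S = 0 ([mle_eigenvalue_root]).

    The score in a is s = 1/(2a) + M - a S = 1/(2a) - y_0^2 - N, where N = (y_T^2 - y_0^2 - T) / 2 +
    a S is, by Ito's formula, the stochastic integral of y against B. Everything rests on E N^2 = T
    / (2a), E N^4 = O(T^2) and the orthogonality of the two N. These are obtained without stochastic
    calculus: N is the almost sure limit of a discrete martingale built on the Euler scheme
    ([euler_martE], [euler_mart_cvg]), whose moments follow by recursion on the steps ([martP_var],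
    [martP_cross], [martP_pow4]) and pass to the limit by [second_moment_cvg].

    The estimator is treated by a delta method with a pathwise remainder ([mle_exp_approx]):
    exp(-hc) - exp(-ha) equals -2ah exp(-ha) s / T up to a constant times (|s| + y_0^2 + y_T^2 +
    1)^2 / T^2. As the fourth moment of the bracket is O(T^2), T times the mean square of this error
    tends to (2ah exp(-ha))^2 / (2a) = 2a h^2 exp(-2ha) ([perr_sqr_cvg]); the pathwise bound is what
    gives convergence of the risk and not only of laws. Under mu_theta the two coordinates are
    orthogonal with variances 1/(2a), so the mixed terms vanish and each eigenprojection receives
    h^2 exp(-2ha), which is h^2 exp(-2hQ) ([plug_in_risk_cvg]).

    The Fisher information divided by T is the normalised covariance of the scores; its limit has
    the same eigenvectors and the eigenvalues 1/a, hence is Q^-1 ([fisher_information_cvg]). The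
    efficiency bound is then the algebra of J Q J' ([efficiency_bound]). The regression function
    comes from the conditional mean of the Euler scheme and from stationarity ([regression_OU]). *)

(** * Random variables with finite moments of every order *)

Section finite_moments.
Context {d} {T : measurableType d} {R : realType}.
Variable P : probability T R.
Implicit Types f g : T -> R.

(** Even powers keep the integrands nonnegative. The class is an algebra, so the integrability of
    every polynomial expression met below is a matter of syntax. *)
Definition finmom f := measurable_fun setT f /\
  forall n, (\int[P]_w (f w ^+ (2 * n))%:E < +oo)%E.

Lemma prob_integrable_le f g : measurable_fun setT f ->
  P.-integrable setT (EFin \o g) -> (forall w, `|f w| <= g w) ->
  P.-integrable setT (EFin \o f).
Proof.
move=> mf ig fg; apply: (le_integrable measurableT _ _ ig).
  exact/measurable_EFinP.
move=> w _ /=; rewrite lee_fin (le_trans (fg w))//; exact: ler_norm.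
Qed.

Lemma prob_integrable_cst (c : R) : P.-integrable setT (EFin \o (fun=> c)).
Proof. exact: (@finite_measure_integrable_cst _ _ _ P). Qed.

Lemma prob_integrableD f g : P.-integrable setT (EFin \o f) ->
  P.-integrable setT (EFin \o g) ->
  P.-integrable setT (EFin \o (fun w => f w + g w)).
Proof. by move=> iF ig; have := integrableD measurableT iF ig. Qed.

Lemma prob_integrableZ c f : P.-integrable setT (EFin \o f) ->
  P.-integrable setT (EFin \o (fun w => c * f w)).
Proof. by move=> iF; have := integrableZl measurableT c iF. Qed.

Lemma exprn_double_ge0 (x : R) n : 0 <= x ^+ (2 * n).
Proof. by rewrite exprM; apply: exprn_ge0; exact: sqr_ge0. Qed.

Lemma finmom_even f n : finmom f ->
  P.-integrable setT (EFin \o (fun w => f w ^+ (2 * n))).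
Proof.
move=> [mf ff]; apply/integrableP; split.
  by apply/measurable_EFinP; exact: measurable_funX.
under eq_integral.
  move=> w _ /=; rewrite ger0_norm ?exprn_double_ge0//.
  over.
exact: ff.
Qed.

Lemma finmom_integrable f : finmom f -> P.-integrable setT (EFin \o f).
Proof.
move=> Ff; have := finmom_even 1 Ff; case: Ff => mf _ i2.
apply: (prob_integrable_le mf (prob_integrableD (prob_integrable_cst 1) i2)) => w.
rewrite ler_norml muln1; apply/andP; split; nra.
Qed.

Lemma finmom_bounded_by f (g : nat -> T -> R) : measurable_fun setT f ->
  (forall n, P.-integrable setT (EFin \o g n)) ->
  (forall n w, f w ^+ (2 * n) <= g n w) -> finmom f.
Proof.
move=> mf ig fg; split => // n.
have : P.-integrable setT (EFin \o (fun w => f w ^+ (2 * n))).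
  apply: (prob_integrable_le _ (ig n)); first exact: measurable_funX.
  by move=> w; rewrite ger0_norm ?exprn_double_ge0.
move/integrableP => -[_]; congr (_ < _)%E; apply: eq_integral => w _ /=.
by rewrite ger0_norm ?exprn_double_ge0.
Qed.

Lemma finmom_cst c : finmom (fun=> c).
Proof.
apply: (@finmom_bounded_by _ (fun n _ => c ^+ (2 * n))) => // n.
exact: prob_integrable_cst.
Qed.

(** If |x| is the smaller of the two, |x + y| is at most 2 |y|. *)
Lemma exprD_even_le (x y : R) n :
  (x + y) ^+ (2 * n) <= 2 ^+ (2 * n) * (x ^+ (2 * n) + y ^+ (2 * n)).
Proof.
wlog xy : x y / `|x| <= `|y|.
  move=> H; have [xy|/ltW yx] := leP `|x| `|y|; first exact: H.
  by rewrite addrC [in leRHS]addrC; exact: H.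
have E z : z ^+ (2 * n) = `|z| ^+ (2 * n) :> R.
  by rewrite !exprM real_normK// num_real.
apply: (@le_trans _ _ (2 ^+ (2 * n) * y ^+ (2 * n))).
  rewrite -exprMn E (E (2 * y)) lerXn2r ?nnegrE// normrM (ger0_norm (ler0n _ 2)).
  by apply: (le_trans (ler_normD _ _)); lra.
by rewrite ler_wpM2l ?exprn_double_ge0// lerDr exprn_double_ge0.
Qed.

Lemma finmomD f g : finmom f -> finmom g -> finmom (fun w => f w + g w).
Proof.
move=> Ff Fg.
apply: (@finmom_bounded_by _
  (fun n w => 2 ^+ (2 * n) * (f w ^+ (2 * n) + g w ^+ (2 * n)))).
- by apply: measurable_funD; [case: Ff|case: Fg].
- by move=> n; apply: prob_integrableZ; apply: prob_integrableD; exact: finmom_even.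
- by move=> n w; exact: exprD_even_le.
Qed.

(** The 2n-th power of the product is dominated by the sum of the 4n-th powers, since uv is at most
    u^2 + v^2. *)
Lemma finmomM f g : finmom f -> finmom g -> finmom (fun w => f w * g w).
Proof.
move=> Ff Fg.
apply: (@finmom_bounded_by _
  (fun n w => (f w ^+ (2 * (2 * n)) + g w ^+ (2 * (2 * n))))).
- by apply: measurable_funM; [case: Ff|case: Fg].
- by move=> n; apply: prob_integrableD; exact: finmom_even.
- move=> n w; rewrite exprMn !(mulnC 2 (2 * n)) !(exprM _ (2 * n)).
  nra.
Qed.

Lemma finmomZ c f : finmom f -> finmom (fun w => c * f w).
Proof. by move=> Ff; apply: finmomM => //; exact: finmom_cst. Qed.

Lemma finmomN f : finmom f -> finmom (fun w => - f w).
Proof.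
move=> Ff; rewrite (_ : (fun w => - f w) = (fun w => -1 * f w)); first exact: finmomZ.
by apply/funext => w; rewrite mulN1r.
Qed.

Lemma finmomB f g : finmom f -> finmom g -> finmom (fun w => f w - g w).
Proof. by move=> Ff Fg; apply: finmomD => //; exact: finmomN. Qed.

Lemma finmomX n f : finmom f -> finmom (fun w => f w ^+ n).
Proof.
move=> Ff; elim: n => [|n IH].
  by under eq_fun do rewrite expr0; exact: finmom_cst.
by under eq_fun do rewrite exprS; exact: finmomM.
Qed.

Lemma finmom_indic A : measurable A -> finmom (\1_A).
Proof.
move=> mA; apply: (@finmom_bounded_by _ (fun _ _ => 1)).
- exact: measurable_indic.
- move=> n; exact: prob_integrable_cst.
- move=> n w; rewrite indicE; case: (_ \in _).
    by rewrite mulr1n expr1n.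
  by rewrite mulr0n expr0n; case: eqP => _; rewrite ?mulr1n ?mulr0n ?ler01.
Qed.

Lemma EE_D f g : finmom f -> finmom g ->
  \int[P]_w (f w + g w) = \int[P]_w f w + \int[P]_w g w.
Proof. by move=> Ff Fg; apply: RintegralD => //; exact: finmom_integrable. Qed.

Lemma EE_B f g : finmom f -> finmom g ->
  \int[P]_w (f w - g w) = \int[P]_w f w - \int[P]_w g w.
Proof. by move=> Ff Fg; apply: RintegralB => //; exact: finmom_integrable. Qed.

Lemma EE_Z c f : finmom f -> \int[P]_w (c * f w) = c * \int[P]_w f w.
Proof. by move=> Ff; apply: RintegralZl => //; exact: finmom_integrable. Qed.

Lemma EE_cst c : \int[P]_w c = c.
Proof.
rewrite Rintegral_cst//= [X in fine X](_ : _ = 1%E) ?mulr1//.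
exact: probability_setT.
Qed.

Lemma EE_le f g : finmom f -> finmom g -> (forall w, f w <= g w) ->
  \int[P]_w f w <= \int[P]_w g w.
Proof.
by move=> Ff Fg fg; apply: le_Rintegral => //; exact: finmom_integrable.
Qed.

Lemma EE_ge0 f : (forall w, 0 <= f w) -> 0 <= \int[P]_w f w.
Proof. by move=> f0; apply: Rintegral_ge0. Qed.

End finite_moments.

(** * Convergence of expectations under bounded second moments *)

(* The function e x^2 + x + 1 / (4 e) is nonnegative, so that Fatou's lemma
   applies to its composition with +- g_n; letting e vanish replaces a uniform
   integrability argument. *)
Section second_moment_convergence.
Context {d} {T : measurableType d} {R : realType}.
Variables (P : probability T R) (K : R).

(** Fatou's lemma bounds by the lower limit of the integrals, so a bound holding for arbitrarily
    large indices suffices. This is the form met when convergence is refuted by contradiction. *)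
Lemma fatou_frequently (v_ : nat -> T -> R) (v : T -> R) (c : R) :
  (forall n, measurable_fun setT (v_ n)) -> (forall n w, 0 <= v_ n w) ->
  measurable_fun setT v ->
  {ae P, forall w, v_ n w @[n --> \oo] --> v w} ->
  (forall N, exists2 n, (N <= n)%N & (\int[P]_w (v_ n w)%:E <= c%:E)%E) ->
  (\int[P]_w (v w)%:E <= c%:E)%E.
Proof.
move=> mv_ v_0 mv v_v vc.
have mE n : measurable_fun setT (fun w => (v_ n w)%:E).
  by apply/measurable_EFinP; exact: mv_.
(* Almost everywhere the limit coincides with the lower limit, to which Fatou's lemma applies on the
   whole space. *)
have -> : (\int[P]_w (v w)%:E =
   \int[P]_w (limn_einf (fun n => (v_ n w)%:E)))%E.
  apply: ae_eq_integral => //.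
  - exact/measurable_EFinP.
  - apply: (@eq_measurable_fun _ _ _ _ _
      (fun w => - limn_esup (fun n => - (v_ n w)%:E))%E).
      by move=> w _; rewrite (_ : (fun n => - (v_ n w)%:E)%E =
        -%E \o (fun n => (v_ n w)%:E))// limn_esupN oppeK.
    apply: measurableT_comp => //; apply: measurable_fun_limn_esup => n.
    by apply: measurableT_comp.
  - apply: filterS v_v => w vw _.
    have H : (v_ n w)%:E @[n --> \oo] --> (v w)%:E.
      by apply: cvg_EFin; [exact: nearW|exact: vw].
    by have [-> _] := cvg_limn_einf_sup H.
apply: (le_trans (fatou P measurableT mE _)) => [n w _|].
  by rewrite lee_fin.
rewrite limn_einf_lim; apply: lime_le; first exact: is_cvg_einfs.
apply: nearW => N; have [n Nn nc] := vc N.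
by apply: le_trans nc; apply: ereal_inf_lbound; exists n.
Qed.

Lemma EE_finE (f : T -> R) : P.-integrable setT (EFin \o f) ->
  (\int[P]_w (f w)%:E = (\int[P]_w f w)%:E)%E.
Proof. by move=> iF; rewrite /Rintegral fineK//; exact: integrable_fin_num. Qed.

Variables (g_ : nat -> T -> R) (g : T -> R).
Hypothesis fg_ : forall n, finmom P (g_ n).
Hypothesis mg : measurable_fun setT g.
Hypothesis g_K : \forall n \near \oo, \int[P]_w (g_ n w ^+ 2) <= K.
Hypothesis g_g : {ae P, forall w, g_ n w @[n --> \oo] --> g w}.

Lemma second_moment_le : (\int[P]_w (g w ^+ 2)%:E <= K%:E)%E.
Proof.
apply: (@fatou_frequently (fun n w => g_ n w ^+ 2)).
- by move=> n; apply: measurable_funX; case: (fg_ n).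
- by move=> n w; exact: sqr_ge0.
- exact: measurable_funX.
- by apply: filterS g_g => w gw; exact: (cvg_comp _ _ gw (@exprn_continuous _ 2 _)).
- move=> N; have [N0 _ N0K] := g_K.
  exists (maxn N N0); first exact: leq_maxl.
  rewrite EE_finE ?lee_fin; first by apply: N0K => /=; exact: leq_maxr.
  by apply: finmom_integrable; exact: finmomX.
Qed.

Lemma second_moment_integrable_sqr : P.-integrable setT (EFin \o (fun w => g w ^+ 2)).
Proof.
apply/integrableP; split.
  by apply/measurable_EFinP; exact: measurable_funX.
apply: (le_lt_trans _ (ltry K)); apply: le_trans second_moment_le.
by under eq_integral do rewrite /= ger0_norm ?sqr_ge0//.
Qed.

Lemma second_moment_integrable : P.-integrable setT (EFin \o g).
Proof.
apply: (prob_integrable_le mg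
  (prob_integrableD (prob_integrable_cst P 1) second_moment_integrable_sqr)) => w.
rewrite ler_norml; apply/andP; split; nra.
Qed.

Lemma second_moment_lower (e : R) : 0 < e ->
  \forall n \near \oo, \int[P]_w g w - e <= \int[P]_w g_ n w.
Proof.
move=> e0; apply: contrapT => nH.
have freq N : exists2 n, (N <= n)%N & \int[P]_w g_ n w < \int[P]_w g w - e.
  apply: contrapT => H; apply: nH; exists N => // n Nn.
  by rewrite leNgt; apply/negP => ?; apply: H; exists n.
have K0 : 0 <= K.
  by rewrite -lee_fin; apply: le_trans second_moment_le; apply: integral_ge0 => w _;
    rewrite lee_fin sqr_ge0.
(* Chosen so that t * K < e: Fatou's lemma for p along the bad indices yields t E g^2 <= t K - e,
   whose right side is negative. *)
pose t := e / (2 * (K + 1)).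
have t0 : 0 < t by rewrite divr_gt0// mulr_gt0//; lra.
pose p x : R := t * x ^+ 2 + x + (4 * t)^-1.
have p0 x : 0 <= p x.
  have -> : p x = t * (x + (2 * t)^-1) ^+ 2 by rewrite /p; field; lra.
  by rewrite mulr_ge0 ?sqr_ge0// ltW.
pose c := t * K + (\int[P]_w g w - e) + (4 * t)^-1.
have intp (f : T -> R) : P.-integrable setT (EFin \o f) ->
    P.-integrable setT (EFin \o (fun w => f w ^+ 2)) ->
    P.-integrable setT (EFin \o (p \o f)) /\
    \int[P]_w p (f w) = t * \int[P]_w (f w ^+ 2) + \int[P]_w f w + (4 * t)^-1.
  move=> iF if2.
  have i1 := prob_integrableZ t if2; have i2 := prob_integrableD i1 iF.
  have i3 := prob_integrable_cst P (4 * t)^-1.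
  split; first exact: (prob_integrableD i2 i3).
  rewrite /p (RintegralD measurableT i2 i3) (RintegralD measurableT i1 iF).
  by rewrite RintegralZl// EE_cst.
have : (\int[P]_w (p (g w))%:E <= c%:E)%E.
  apply: (@fatou_frequently (fun n w => p (g_ n w))) => //.
  - move=> n; have [mgn _] := fg_ n; apply: measurable_funD => //.
    by apply: measurable_funD => //; apply: measurable_funM => //; exact: measurable_funX.
  - apply: measurable_funD => //.
    by apply: measurable_funD => //; apply: measurable_funM => //; exact: measurable_funX.
  - apply: filterS g_g => w gw.
    apply: cvgD; last exact: cvg_cst.
    apply: cvgD => //; apply: cvgMl_tmp.
    exact: (cvg_comp _ _ gw (@exprn_continuous _ 2 _)).
  - move=> N; have [N0 _ N0K] := g_K.
    have [n Nn gn] := freq (maxn N N0).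
    exists n; first by rewrite (leq_trans _ Nn)// leq_maxl.
    have [i1 e1] := intp (g_ n) (finmom_integrable (fg_ n))
       (finmom_integrable (finmomX 2 (fg_ n))).
    rewrite EE_finE// e1 lee_fin /c lerD2r lerD//; last exact: ltW.
    rewrite ler_pM2l//; apply: N0K => /=; apply: leq_trans Nn; exact: leq_maxr.
have [i1 e1] := intp g second_moment_integrable second_moment_integrable_sqr.
rewrite EE_finE// e1 lee_fin /c => H.
have g20 : 0 <= \int[P]_w (g w ^+ 2) by apply: EE_ge0 => w; exact: sqr_ge0.
have : t * K < e.
  rewrite /t mulrAC ltr_pdivrMr ?mulr_gt0//; [nra|lra].
nra.
Qed.

End second_moment_convergence.

(** The lower bound is applied to the sequence and to its opposite. No dominating function is asked
    for, which is what the limits of Euler schemes require. *)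
Lemma second_moment_cvg {d} {T : measurableType d} {R : realType}
    (P : probability T R) (K : R) (g_ : nat -> T -> R) (g : T -> R) :
  (forall n, finmom P (g_ n)) -> measurable_fun setT g ->
  (\forall n \near \oo, \int[P]_w (g_ n w ^+ 2) <= K) ->
  {ae P, forall w, g_ n w @[n --> \oo] --> g w} ->
  \int[P]_w g_ n w @[n --> \oo] --> \int[P]_w g w.
Proof.
move=> fg_ mg gK gg; apply/cvgrPdist_le => e e0.
have L := second_moment_lower fg_ mg gK gg e0.
have fN n := finmomN (fg_ n).
have mN : measurable_fun setT (fun w => - g w) by exact: measurableT_comp.
have U : \forall n \near \oo, \int[P]_w (- g w) - e <= \int[P]_w (- g_ n w).
  apply: (second_moment_lower (K := K) fN mN _ _ e0).
    apply: filterS gK => n; rewrite [X in _ -> X <= _](_ : _ =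
      \int[P]_w (g_ n w ^+ 2))//.
    by apply: eq_Rintegral => w _; rewrite sqrrN.
  by apply: filterS gg => w; exact: cvgN.
have iN (f : T -> R) : P.-integrable setT (EFin \o f) ->
    \int[P]_w (- f w) = - \int[P]_w f w.
  by move=> iF; under eq_Rintegral do rewrite -mulN1r; rewrite RintegralZl// mulN1r.
have ig := second_moment_integrable fg_ mg gK gg.
near=> n.
have Ln : \int[P]_w g w - e <= \int[P]_w g_ n w by near: n.
have : \int[P]_w (- g w) - e <= \int[P]_w (- g_ n w) by near: n.
rewrite !iN//; last exact: finmom_integrable.
by move=> Un; rewrite ler_norml; apply/andP; split; lra.
Unshelve. all: by end_near. Qed.

(** * Independence: from generating events to products of expectations *)

Section independence.
Context {d} {T : measurableType d} {R : realType}.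
Variable P : probability T R.

(** Dynkin's argument: the events independent of C form a lambda-system, and G is a pi-system. *)
Lemma indep_g_sigma (G : set (set T)) (C : set T) : setI_closed G ->
  G `<=` measurable -> measurable C ->
  (forall A, G A -> P (A `&` C) = (P A * P C)%E) ->
  forall A, <<s G >> A -> measurable A /\ P (A `&` C) = (P A * P C)%E.
Proof.
move=> GI Gm mC GC.
pose H := [set A | measurable A /\ P (A `&` C) = (P A * P C)%E].
suff: <<s G >> `<=` H by move=> GH A /GH.
have fC : P C = (fine (P C))%:E by rewrite fineK// fin_num_measure.
apply: lambda_system_subset; [by []| | |by []]; last first.
  by move=> A GA; split; [exact: Gm|exact: GC].
apply/dynkin_lambda_system; split.
- by split => //; rewrite setTI probability_setT mul1e.
- move=> A [mA AC]; split; first exact: measurableC.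
  have -> : ~` A `&` C = C `\` (A `&` C).
    by apply/seteqP; split => x /=; [move=> [nA ?]; split => // -[]|move=> [? n]; split => // ?; exact: n].
  have -> : P (C `\` (A `&` C)) = (P C - P (A `&` C))%E.
    rewrite measureD//; [|exact: measurableI|by rewrite ltey_eq fin_num_measure].
    by rewrite (_ : C `&` (A `&` C) = A `&` C)//; apply/seteqP; split => x /=; tauto.
  rewrite AC probability_setC// fC.
  have -> : P A = (fine (P A))%:E by rewrite fineK// fin_num_measure.
  by rewrite muleBl//= ?mul1e.
- move=> F tF HF; have mF n : measurable (F n) by case: (HF n).
  split; first exact: bigcup_measurable.
  rewrite setI_bigcupl !measure_semi_bigcup//.
  + rewrite fC muleC -nneseriesZl; last by move=> *; exact: measure_ge0.
    apply: eq_eseriesr => n _.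
    have E : P (F n `&` C) = ((fine (P C))%:E * P (F n))%E.
      by have [_ ->] := HF n; rewrite [in LHS]fC muleC.
    exact: E.
  + exact: bigcup_measurable.
  + by move=> n; exact: measurableI.
  + exact: trivIset_setIr.
  + by apply: bigcup_measurable => n _; exact: measurableI.
Qed.

(** Independence says that the joint law is the product of the laws; Fubini's theorem does the
    rest. *)
Lemma indep_integral d1 d2 (T1 : measurableType d1) (T2 : measurableType d2)
    (X : {mfun T >-> T1}) (Y : {mfun T >-> T2}) (f : T1 -> R) (g : T2 -> R) :
  (forall A B, measurable A -> measurable B ->
     P (X @^-1` A `&` Y @^-1` B) = (P (X @^-1` A) * P (Y @^-1` B))%E) ->
  measurable_fun setT f -> measurable_fun setT g ->
  finmom P (f \o X) -> finmom P (g \o Y) ->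
  \int[P]_w (f (X w) * g (Y w)) = \int[P]_w f (X w) * \int[P]_w g (Y w).
Proof.
move=> XY mf mg fX gY.
have mZ : measurable_fun setT (fun w => (X w, Y w)).
  by apply: measurable_fun_pair.
pose Z : {mfun T >-> (T1 * T2)%type} :=
  HB.pack (fun w => (X w, Y w)) (isMeasurableFun.Build _ _ _ _ _ mZ).
pose D1 := distribution P X; pose D2 := distribution P Y.
have DE A : measurable A -> (D1 \x D2)%E A = distribution P Z A.
  by move=> mA; apply: product_measure_unique.
have mfg : measurable_fun setT (fun z : T1 * T2 => (f z.1 * g z.2)%:E).
  apply/measurable_EFinP; apply: measurable_funM.
    exact: measurableT_comp.
  exact: measurableT_comp.
have iXY : P.-integrable setT (EFin \o (fun w => f (X w) * g (Y w))).
  by apply: finmom_integrable; exact: finmomM.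
have E1 : (\int[P]_w (f (X w) * g (Y w))%:E =
           \int[D1 \x D2]_z (f z.1 * g z.2)%:E)%E.
  rewrite -(integral_distribution (X := Z) mfg)//.
  by apply: eq_measure_integral => A mA _; first [exact: DE | exact/esym/DE].
have iD : (D1 \x D2)%E.-integrable setT (fun z => (f z.1 * g z.2)%:E).
  apply/integrableP; split => //.
  have -> : (\int[D1 \x D2]_z `|(f z.1 * g z.2)%:E| =
             \int[distribution P Z]_z `|(f z.1 * g z.2)%:E|)%E.
    by apply: eq_measure_integral => A mA _; first [exact: DE | exact/esym/DE].
  rewrite ge0_integral_distribution//; last exact: measurableT_comp.
  by case/integrableP : iXY.
have ig : P.-integrable setT (EFin \o (g \o Y)) by exact: finmom_integrable.
have iF : P.-integrable setT (EFin \o (f \o X)) by exact: finmom_integrable.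
have iD2 : D2.-integrable setT (EFin \o g).
  by apply: integrable_pushforward => //; exact/measurable_EFinP.
have iD1 : D1.-integrable setT (EFin \o f).
  by apply: integrable_pushforward => //; exact/measurable_EFinP.
have E2 : (\int[D2]_y (g y)%:E = (\int[P]_w g (Y w))%:E)%E.
  by rewrite integral_distribution ?EE_finE//; exact/measurable_EFinP.
have E3 : (\int[D1]_y (f y)%:E = (\int[P]_w f (X w))%:E)%E.
  by rewrite integral_distribution ?EE_finE//; exact/measurable_EFinP.
rewrite {1}/Rintegral E1 -integral12_prod_meas1//.
have -> : (\int[D1]_x fubini_F D2 (fun z => (f z.1 * g z.2)%:E) x =
    \int[D1]_x ((\int[P]_w g (Y w))%:E * (f x)%:E))%E.
  apply: eq_integral => x _; rewrite /fubini_F /= -E2 muleC -(integralZl measurableT iD2).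
  by apply: eq_integral.
by rewrite (integralZl measurableT iD1) E3 /= mulrC.
Qed.

(** A variable measurable for a sub-sigma-algebra is seen as a function of the identity map into the
    same carrier with the coarser structure, which reduces the claim to independent random
    variables. *)
Lemma indep_g_sigma_integral (G : set (set T)) d2 (U : measurableType d2)
    (V : T -> U) (f : T -> R) (g : U -> R) : setI_closed G ->
  G `<=` measurable -> measurable_fun setT V ->
  (forall A B, G A -> measurable B ->
     P (A `&` V @^-1` B) = (P A * P (V @^-1` B))%E) ->
  measurable_fun setT (f : g_sigma_algebraType G -> R) ->
  measurable_fun setT g ->
  finmom P f -> finmom P (g \o V) ->
  \int[P]_w (f w * g (V w)) = \int[P]_w f w * \int[P]_w g (V w).
Proof.
move=> GI Gm mV GV mf mg Ff Fg.
have sGm : <<s G >> `<=` measurable.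
  apply: smallest_sub => //; exact: sigma_algebra_measurable.
have mid : measurable_fun setT (id : T -> g_sigma_algebraType G).
  by move=> _ A /sGm mA; rewrite setTI preimage_id.
pose X : {mfun T >-> g_sigma_algebraType G} :=
  HB.pack (id : T -> g_sigma_algebraType G) (isMeasurableFun.Build _ _ _ _ _ mid).
pose Y : {mfun T >-> U} := HB.pack V (isMeasurableFun.Build _ _ _ _ _ mV).
apply: (@indep_integral _ _ _ _ X Y f g) => //= A B mA mB.
rewrite preimage_id.
have mVB : measurable (V @^-1` B) by have := mV measurableT B mB; rewrite setTI.
by have [_ ->] := indep_g_sigma GI Gm mVB (fun A GA => GV A B GA mB) mA.
Qed.

End independence.

(** * Integration against a density and the Gaussian integral on the line *)

Import HBNNSimple.

(* The map phi only serves to change the measurable structure of the carrier: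
   [R] and [measurableTypeR R] have the same Borel sets but distinct displays. *)
Lemma ge0_integral_density {d d'} {T : measurableType d} {T' : measurableType d'}
    {R : realType} (mu : {measure set T -> \bar R})
    (nu : {measure set T' -> \bar R}) (phi : T -> T') (g : T -> R)
    (f : T' -> \bar R) :
  measurable_fun setT phi -> measurable_fun setT g -> (forall x, 0 <= g x) ->
  (forall A, measurable A -> nu A = \int[mu]_(x in phi @^-1` A) (g x)%:E)%E ->
  measurable_fun setT f -> (forall x, (0 <= f x)%E) ->
  (\int[nu]_x f x = \int[mu]_x (f (phi x) * (g x)%:E))%E.
Proof.
move=> mphi mg g0 nuE mf f0.
have mgE : measurable_fun setT (EFin \o g) by exact/measurable_EFinP.
pose h := nnsfun_approx measurableT mf.
have hE n x : (h n x)%:E = (\sum_(y \in range (h n))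
    (y * \1_(h n @^-1` [set y]) x)%:E)%E.
  by rewrite fimfunE -fsumEFin.
have -> : (\int[nu]_x f x = lim (\int[nu]_x (EFin \o h n) x @[n --> \oo]))%E.
  under eq_integral => x _.
    have -> : f x = (lim ((EFin \o h n) x @[n --> \oo]))%E.
      by apply/esym/cvg_lim => //; exact: cvg_nnsfun_approx.
    over.
  apply: monotone_convergence => //.
  - by move=> n; apply/measurable_EFinP.
  - by move=> n x _ /=; rewrite lee_fin.
  - by move=> x _ a b ab; rewrite lee_fin; exact/lefP/nd_nnsfun_approx.
have mhphi n : measurable_fun setT (EFin \o h n \o phi).
  by apply: measurableT_comp => //; apply/measurable_EFinP.
have -> : (\int[mu]_x (f (phi x) * (g x)%:E) =
    lim (\int[mu]_x ((EFin \o h n) (phi x) * (g x)%:E) @[n --> \oo]))%E.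
  under eq_integral => x _.
    have -> : (f (phi x) * (g x)%:E =
        lim ((EFin \o h n) (phi x) * (g x)%:E @[n --> \oo]))%E.
      by apply/esym/cvg_lim => //; apply: cvgeZr => //; exact: cvg_nnsfun_approx.
    over.
  apply: monotone_convergence => //.
  - by move=> n; apply/emeasurable_funM => //; exact: mhphi.
  - by move=> n x _ /=; rewrite mule_ge0 ?lee_fin.
  - move=> x _ a b ab/=; rewrite lee_wpmul2r ?lee_fin//.
    exact/lefP/nd_nnsfun_approx.
congr (lim (_ @ \oo)); apply/funext => n.
have mh r : measurable_fun setT (fun x => (r * \1_(h n @^-1` [set r]) x)%:E).
  by apply/measurable_EFinP; exact: measurable_funM.
have mhp r : measurable_fun setT (fun x => (r * \1_(h n @^-1` [set r]) (phi x))%:E).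
  exact: (measurableT_comp (mh r) mphi).
under eq_integral do rewrite /= hE.
rewrite ge0_integral_fsum//; last by move=> m y Ey; exact: nnfun_muleindic_ge0.
under [RHS]eq_integral.
  move=> x _; rewrite /= hE ge0_mule_fsuml; last by move=> y; exact: nnfun_muleindic_ge0.
  over.
rewrite ge0_integral_fsum//; last 2 first.
  - by move=> y; apply: emeasurable_funM => //; exact: mhp.
  - by move=> m y Ey; rewrite mule_ge0 ?lee_fin// -lee_fin nnfun_muleindic_ge0.
apply: eq_fsbigr => r rhn.
under [LHS]eq_integral do rewrite EFinM.
rewrite integralZl_indic_nnsfun//.
under [RHS]eq_integral do rewrite EFinM -muleA.
rewrite ge0_integralZl//.
- congr (_ * _)%E; rewrite integral_indic// setIT nuE//.
  rewrite integral_mkcond; apply: eq_integral => x _.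
  by rewrite muleC epatch_indic.
- apply: emeasurable_funM => //; apply/measurable_EFinP.
  have mi : measurable_fun setT (\1_(h n @^-1` [set r]) : T' -> R) by [].
  exact: (measurableT_comp mi mphi).
- by move=> t Et; rewrite mule_ge0 ?lee_fin.
- by move: rhn; rewrite inE => -[t _ <-]; rewrite lee_fin.
Qed.

Lemma integral_gauss_shift {R : realType} (k m : R) : 0 < k ->
  (\int[lebesgue_measure]_x (expR (- (2 * k)^-1 * (x - m) ^+ 2))%:E =
   (Num.sqrt (2 * pi * k))%:E)%E.
Proof.
move=> k0; have s0 : Num.sqrt k != 0 :> R by rewrite gt_eqF// sqrtr_gt0.
have p0 : 0 < Num.sqrt (2 * pi * k) by rewrite sqrtr_gt0 !mulr_gt0// pi_gt0.
have E x : expR (- (2 * k)^-1 * (x - m) ^+ 2) =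
           Num.sqrt (2 * pi * k) * normal_pdf m (Num.sqrt k) x.
  rewrite normal_pdfE// /normal_peak /normal_fun sqr_sqrtr ?ltW//.
  have -> : k * pi *+ 2 = 2 * pi * k by rewrite -mulr_natl; ring.
  rewrite [RHS]mulrA divff ?mul1r ?gt_eqF//; congr expR.
  by rewrite -mulr_natr; field; rewrite gt_eqF.
under eq_integral do rewrite E EFinM.
rewrite integralZl//; last exact: integrable_normal_pdf.
by rewrite integral_normal_pdf mule1.
Qed.

(** * Two by two matrices *)

Section two_by_two.
Context {R : comUnitRingType}.

Lemma ord2P (P : 'I_2 -> Prop) : P 0 -> P 1 -> forall i, P i.
Proof.
move=> P0 P1 [[|[|//]] i2].
  by rewrite (_ : Ordinal i2 = 0)//; exact: val_inj.
by rewrite (_ : Ordinal i2 = 1)//; exact: val_inj.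
Qed.

Lemma sum2E (V : nmodType) (F : 'I_2 -> V) : \sum_(i < 2) F i = F 0 + F 1.
Proof.
rewrite !big_ord_recl big_ord0 addr0; congr (F _ + F _); exact: val_inj.
Qed.

Lemma mx2P n (A B : 'M[R]_(2, n)) :
  (forall j, A 0 j = B 0 j) -> (forall j, A 1 j = B 1 j) -> A = B.
Proof. by move=> A0 A1; apply/matrixP => i j; elim/ord2P: i. Qed.

Lemma det2E (S : 'M[R]_2) : \det S = S 0 0 * S 1 1 - S 0 1 * S 1 0.
Proof.
rewrite (expand_det_row _ 0) sum2E /cofactor !det_mx11 !mxE /=.
have L0 : lift 0 0 = 1 :> 'I_2 by exact: val_inj.
have L1 : lift 1 0 = 0 :> 'I_2 by exact: val_inj.
by rewrite L0 L1 /= expr0 mul1r expr1 mulN1r mulrN.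
Qed.

Definition adj2 (S : 'M[R]_2) : 'M[R]_2 := \matrix_(i, j)
    (if i == j then (if i == 0 then S 1 1 else S 0 0) else - S i j).

Lemma invmx2E (S : 'M[R]_2) : \det S \is a GRing.unit ->
  invmx S = (\det S)^-1 *: adj2 S.
Proof.
move=> uS; have uS' : S \in unitmx by rewrite unitmxE.
rewrite -[RHS]mul1mx -(mulVmx uS') -mulmxA -[LHS]mulmx1; congr (_ *m _).
have D := det2E S.
rewrite -scalemxAr -[LHS]scale1r -[X in X *: _](mulVr uS) -scalerA; congr (_ *: _).
apply: mx2P => j; elim/ord2P: j; rewrite !mxE sum2E !mxE /= ?D; ring.
Qed.

End two_by_two.

(** * Moment generating function of the bivariate Gaussian law *)

Section gaussian_mgf.
Context {R : realType}.
Variable S : 'M[R]_2.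
Hypotheses (S_sym : S 1 0 = S 0 1) (S_pos : 0 < S 1 1) (S_det : 0 < \det S).

Lemma gaussian_pdfE (z : R * R) : gaussian_pdf S z =
  (2 * pi * Num.sqrt (\det S))^-1 * expR (- (2 * \det S)^-1 *
    (S 1 1 * z.1 ^+ 2 - 2 * S 0 1 * z.1 * z.2 + S 0 0 * z.2 ^+ 2)).
Proof.
rewrite /gaussian_pdf; congr (_ * expR _).
rewrite /quadform !(mxE, sum2E) /=.
rewrite invmx2E ?unitfE ?gt_eqF// !mxE /= S_sym.
by field; rewrite gt_eqF.
Qed.

(** Tonelli's theorem and the square completed twice, first in the first coordinate, then in the
    second. *)
Lemma gaussian_mgf_ereal (l1 l2 : R) :
  (\int[gaussian S]_z (expR (l1 * z.1 + l2 * z.2))%:E =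
   (expR (2^-1 * (S 0 0 * l1 ^+ 2 + 2 * S 0 1 * l1 * l2 + S 1 1 * l2 ^+ 2)))%:E)%E.
Proof.
set c := expR (2^-1 * _).
have m1 : measurable_fun setT (fst : R * R -> R) by exact: measurable_fst.
have m2 : measurable_fun setT (snd : R * R -> R) by exact: measurable_snd.
have mf : measurable_fun setT (fun z : R * R => expR (l1 * z.1 + l2 * z.2)).
  apply: measurableT_comp => //; apply: measurable_funD; exact: measurable_funM.
have mp := @measurable_gaussian_pdf _ S.
transitivity (\int[lebesgue_measure \x lebesgue_measure]_z
    ((expR (l1 * z.1 + l2 * z.2))%:E * (gaussian_pdf S z)%:E))%E.
  apply: (@ge0_integral_density _ _ (measurableTypeR R * measurableTypeR R)%type
    (R * R)%type R (lebesgue_measure \x lebesgue_measure)%E (gaussian S) id) => //.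
  - exact: gaussian_pdf_ge0.
  - exact/measurable_EFinP.
have D0 : \det S != 0 by rewrite gt_eqF.
have r0 : S 1 1 != 0 by rewrite gt_eqF.
have DE := det2E S; rewrite S_sym in DE.
have pi0 := @pi_gt0 R.
rewrite fubini_tonelli2/=; last 2 first.
- by apply/measurable_EFinP; exact: measurable_funM.
- by move=> z; rewrite mule_ge0// lee_fin ?expR_ge0 ?gaussian_pdf_ge0.
pose s1 := Num.sqrt (2 * pi * (\det S / S 1 1)).
pose s2 := Num.sqrt (2 * pi * S 1 1).
(* The exponentially tilted law is Gaussian with mean S l; [m'] is the mean of its second
   coordinate. *)
pose m' := S 1 1 * l2 + S 0 1 * l1.
pose K := (2 * pi * Num.sqrt (\det S))^-1 * s1 * c.
have K0 : 0 <= K by rewrite !mulr_ge0 ?invr_ge0 ?mulr_ge0 ?sqrtr_ge0 ?expR_ge0// ltW.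
transitivity (\int[lebesgue_measure]_y
    (K%:E * (expR (- (2 * S 1 1)^-1 * (y - m') ^+ 2))%:E))%E.
  apply: eq_integral => y _; rewrite /fubini_G /=.
  (* Conditional mean of the first coordinate given y under the tilted law; the conditional variance
     is \det S / S 1 1. *)
  pose m := (\det S * l1 + S 0 1 * y) / S 1 1.
  pose K' := (2 * pi * Num.sqrt (\det S))^-1 * c * expR (- (2 * S 1 1)^-1 * (y - m') ^+ 2).
  have K'0 : 0 <= K' by rewrite !mulr_ge0 ?invr_ge0 ?mulr_ge0 ?sqrtr_ge0 ?expR_ge0// ltW.
  under eq_integral.
    move=> x _.
    rewrite -EFinM gaussian_pdfE /= (_ : expR (l1 * x + l2 * y) * _ = K' *
      expR (- (2 * (\det S / S 1 1))^-1 * (x - m) ^+ 2)); last first.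
      rewrite mulrCA /K' -!mulrA; congr (_ * _); rewrite /c -!expRD; congr expR.
      have -> : S 0 0 = (\det S + S 0 1 ^+ 2) / S 1 1 by rewrite DE; field.
      by rewrite /m /m'; field; rewrite ?D0 ?r0.
    rewrite EFinM.
    over.
  rewrite ge0_integralZl_EFin//.
  rewrite integral_gauss_shift ?divr_gt0// -!EFinM; congr (_%:E).
    by rewrite /K' /K /s1; ring.
  by apply/measurable_EFinP; apply: measurableT_comp => //;
    apply: measurable_funM => //; apply: measurable_funX; exact: measurable_funB.
rewrite ge0_integralZl_EFin//; last first.
  by apply/measurable_EFinP; apply: measurableT_comp => //;
    apply: measurable_funM => //; apply: measurable_funX; exact: measurable_funB.
rewrite integral_gauss_shift// -EFinM; congr (_%:E).
have E : s1 * s2 = 2 * pi * Num.sqrt (\det S).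
  rewrite /s1 /s2 -sqrtrM; last by rewrite ltW// !mulr_gt0// invr_gt0.
  rewrite (_ : 2 * pi * (\det S / S 1 1) * _ = (2 * pi) ^+ 2 * \det S); last by field.
  by rewrite sqrtrM ?sqr_ge0// sqrtr_sqr ger0_norm// mulr_ge0// ltW.
transitivity ((2 * pi * Num.sqrt (\det S))^-1 * (s1 * s2) * c).
  by rewrite /K /s2; ring.
rewrite E mulVf ?mul1r//.
by rewrite gt_eqF// !mulr_gt0// sqrtr_gt0.
Qed.

End gaussian_mgf.

(** * Elementary bounds on the exponential *)

Section exponential_bounds.
Context {R : realType}.
Implicit Types x u c : R.

Lemma expR_sub1_bounds u : u <= expR u - 1 <= u * expR u.
Proof.
apply/andP; split; first by have := expR_ge1Dx u; lra.
have := expR_ge1Dx (- u); rewrite expRN => h.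
have e0 := expR_gt0 u.
have : (1 - u) * expR u <= (expR u)^-1 * expR u by rewrite ler_pM2r.
by rewrite mulVf ?gt_eqF//; lra.
Qed.

Lemma normr_le_expR x : `|x| <= expR `|x|.
Proof. by have := expR_ge1Dx `|x|; lra. Qed.

Lemma expR_norm_le x : expR `|x| <= expR x + expR (- x).
Proof.
have := expR_ge0 x; have := expR_ge0 (- x).
by case: (ger0P x) => x0; lra.
Qed.

Lemma expR_sub1_norm u : `|expR u - 1| <= `|u| * expR `|u|.
Proof.
have /andP[h1 h2] := expR_sub1_bounds u.
have [u0|u0] := leP 0 u.
  by rewrite (ger0_norm u0) ger0_norm; lra.
have : expR u < 1 by rewrite expR_lt1.
have : 1 <= expR (- u) by have := expR_ge1Dx (- u); lra.
by move=> h3 h4; rewrite (ltr0_norm u0) ltr0_norm; nra.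
Qed.

Lemma expR_quotient_norm u x : 0 < u -> u <= 1 ->
  `|(expR (u * x) - 1) / u| <= expR (2 * `|x|).
Proof.
move=> u0 u1; rewrite normrM normfV (gtr0_norm u0) ler_pdivrMr//.
apply: (le_trans (expR_sub1_norm _)); rewrite normrM (gtr0_norm u0).
rewrite -mulrA mulrC ler_pM2r// mulr_natl mulr2n expRD ler_pM ?expR_ge0//.
  exact: normr_le_expR.
by rewrite ler_expR ler_piMl.
Qed.

Lemma exprn_le_expR x n : x ^+ (2 * n) <= (2 * n)`!%:R * (expR x + expR (- x)).
Proof.
case: n => [|n].
  rewrite muln0 fact0 mul1r expr0.
  by have := expR_ge1Dx x; have := expR_ge1Dx (- x); lra.
have E : x ^+ (2 * n.+1) = `|x| ^+ (2 * n.+1).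
  by rewrite !exprM real_normK// num_real.
rewrite E (_ : 2 * n.+1 = (2 * n.+1).-1.+1)%N; last by rewrite prednK.
have := @expR_ge1Dxn _ `|x| (2 * n.+1).-1 (normr_ge0 x).
set f := _.-1.+1`!; have f0 : 0 < f%:R :> R by rewrite ltr0n fact_gt0.
move=> h.
have : `|x| ^+ (2 * n.+1).-1.+1 / f%:R <= expR x + expR (- x).
  by apply: le_trans (expR_norm_le x); lra.
by rewrite ler_pdivrMr// mulrC.
Qed.

Lemma expR_sub1_cvg c (a_ : nat -> R) : (forall n, 0 < a_ n) ->
  a_ n @[n --> \oo] --> 0 ->
  (expR (c * a_ n) - 1) / a_ n @[n --> \oo] --> c.
Proof.
move=> a0 ac.
apply: (@squeeze_cvgr _ _ _ _ (fun=> c) (fun n => c * expR (c * a_ n))).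
- apply: nearW => n; have /andP[h1 h2] := expR_sub1_bounds (c * a_ n).
  rewrite ler_pdivlMr// ler_pdivrMr//; apply/andP; split => //.
  by rewrite -mulrA (mulrC (expR _)) mulrA.
- exact: cvg_cst.
- rewrite -[X in _ --> X]mulr1; apply: cvgMl_tmp.
  rewrite -expR0 -(mulr0 c).
  by apply: continuous_cvg; [exact: continuous_expR|exact: cvgMl_tmp].
Qed.

End exponential_bounds.

(** * Moments of centred normal variables *)

Section gaussian_moments.
Context {d} {T : measurableType d} {R : realType}.
Variables (P : probability T R).

(** The law N(0, v) is encoded by its moment generating function, from which all the moments below
    are drawn without any density. *)
Definition centered_normal (v : R) (xi : T -> R) := measurable_fun setT xi /\
  forall l, (\int[P]_w (expR (l * xi w))%:E = (expR (l ^+ 2 * v / 2))%:E)%E.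

Variables (v : R) (xi : T -> R).
Hypothesis xiP : centered_normal v xi.

Lemma finmom_expR l : finmom P (fun w => expR (l * xi w)).
Proof.
have [mxi E] := xiP; split.
  by apply: measurableT_comp => //; exact: measurable_funM.
move=> n; under eq_integral do rewrite -expRM_natl mulrA.
by rewrite E ltry.
Qed.

Lemma EE_expR l : \int[P]_w expR (l * xi w) = expR (l ^+ 2 * v / 2).
Proof. by rewrite /Rintegral; have [_ ->] := xiP. Qed.

Lemma finmom_normal : finmom P xi.
Proof.
have [mxi _] := xiP.
have F1 := finmom_expR 1; have F2 := finmom_expR (-1).
apply: (finmom_bounded_by (g := fun n w =>
  (2 * n)`!%:R * (expR (1 * xi w) + expR (-1 * xi w)))) => // [n|n w].
  exact: (prob_integrableZ _ (prob_integrableD (finmom_integrable F1) (finmom_integrable F2))).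
by rewrite mul1r mulN1r; exact: exprn_le_expR.
Qed.

(** After rescaling by s = v^(-1/2) the even power is bounded by exponentials, and E exp(s xi) = E
    exp(-s xi) = exp(1/2); undoing the rescaling gives the factor v^n. *)
Lemma normal_even_moment_le n : 0 < v ->
  \int[P]_w (xi w ^+ (2 * n)) <= (2 * n)`!%:R * (2 * expR 2^-1) * v ^+ n.
Proof.
move=> v0; pose s := (Num.sqrt v)^-1.
have s2 : s ^+ 2 * v = 1.
  by rewrite /s exprVn sqr_sqrtr ?ltW// mulVf// gt_eqF.
have F1 := finmom_expR s; have F2 := finmom_expR (- s).
pose C := (2 * n)`!%:R : R; rewrite -/C.
apply: (@le_trans _ _ (\int[P]_w ((C * v ^+ n) *
    (expR (s * xi w) + expR (- s * xi w))))).
  apply: EE_le.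
  - by apply: finmomX; exact: finmom_normal.
  - exact: (finmomZ _ (finmomD F1 F2)).
  - move=> w.
    have -> : xi w ^+ (2 * n) = v ^+ n * (s * xi w) ^+ (2 * n).
      by rewrite exprMn mulrA !exprM -exprMn mulrC (mulrC v) s2 expr1n mulr1.
    rewrite mulNr [leRHS](_ : _ = v ^+ n * (C *
      (expR (s * xi w) + expR (- (s * xi w))))) ; last by ring.
    by rewrite ler_wpM2l ?exprn_le_expR// exprn_ge0// ltW.
rewrite (EE_Z _ (finmomD F1 F2)) (EE_D F1 F2) !EE_expR sqrrN s2 mul1r.
by rewrite le_eqVlt; apply/orP; left; apply/eqP; ring.
Qed.

(** Integrating 1 + a x <= exp(a x) bounds the mean by (exp(a^2 v / 2) - 1) / a, which vanishes with
    a. *)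
Lemma normal_mean_le0 : \int[P]_w xi w <= 0.
Proof.
pose a_ n : R := n.+1%:R^-1.
have a0 n : 0 < a_ n by rewrite invr_gt0 ltr0n.
have ac : a_ n @[n --> \oo] --> (0 : R) by exact: cvg_harmonic.
have H n : \int[P]_w xi w <= a_ n * ((expR (v / 2 * (a_ n) ^+ 2) - 1) / (a_ n) ^+ 2).
  have -> : v / 2 * a_ n ^+ 2 = a_ n ^+ 2 * v / 2 by ring.
  rewrite -EE_expR.
  have : \int[P]_w (1 + a_ n * xi w) <= \int[P]_w expR (a_ n * xi w).
    apply: EE_le; [|exact: finmom_expR|by move=> w; exact: expR_ge1Dx].
    by apply: finmomD; [exact: finmom_cst|apply: finmomZ; exact: finmom_normal].
  rewrite EE_D; [|exact: finmom_cst|by apply: finmomZ; exact: finmom_normal].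
  rewrite EE_cst EE_Z; last exact: finmom_normal.
  move=> h; rewrite mulrCA [leRHS](_ : _ = (\int[P]_w expR (a_ n * xi w) - 1) / a_ n).
    by rewrite ler_pdivlMr//; lra.
  by field; rewrite gt_eqF.
have L : a_ n * ((expR (v / 2 * (a_ n) ^+ 2) - 1) / (a_ n) ^+ 2) @[n --> \oo] -->
    0 * (v / 2).
  apply: cvgM => //; apply: (@expR_sub1_cvg _ _ (fun n => a_ n ^+ 2)).
    by move=> n; rewrite exprn_gt0.
  by have := cvg_comp _ _ ac (@exprn_continuous R 2 0); rewrite expr0n.
rewrite mul0r in L.
have <- := cvg_lim (@Rhausdorff R) L.
by apply: limr_ge; [apply/cvg_ex; eexists; exact: L|exact: nearW].
Qed.

(** The second difference quotient of the moment generating function at 0 has limit v, and it is the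
    expectation of a sequence tending to xi^2. *)
Lemma normal_variance : \int[P]_w (xi w ^+ 2) = v.
Proof.
have [mxi _] := xiP.
pose a_ n : R := n.+1%:R^-1.
have a0 n : 0 < a_ n by rewrite invr_gt0 ltr0n.
have a1 n : a_ n <= 1 by rewrite invf_le1// ?ltr0n// ler1n.
have ac : a_ n @[n --> \oo] --> (0 : R) by exact: cvg_harmonic.
(* The quantity exp(ax) + exp(-ax) - 2 is the square of exp(ax/2) - exp(-ax/2); subtracting 1 from
   both exponentials brings in the quotients controlled by [expR_quotient_norm]. *)
pose h_ n w := (expR (a_ n * (xi w / 2)) - 1) / a_ n
               - (expR (a_ n * (- (xi w / 2))) - 1) / a_ n.
pose g_ n w := h_ n w ^+ 2.
have gE n w : g_ n w = a_ n ^- 2 * (expR (a_ n * xi w) + expR (- a_ n * xi w) - 2).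
  rewrite /g_ /h_.
  have -> : expR (a_ n * xi w) = expR (a_ n * (xi w / 2)) ^+ 2.
    by rewrite -expRM_natl; congr expR; field.
  have -> : expR (- a_ n * xi w) = expR (a_ n * (- (xi w / 2))) ^+ 2.
    by rewrite -expRM_natl; congr expR; field.
  have : expR (a_ n * (xi w / 2)) * expR (a_ n * (- (xi w / 2))) = 1.
    by rewrite -expRD (_ : _ + _ = 0) ?expR0//; ring.
  set A := expR _; set B := expR _ => AB.
  transitivity (a_ n ^- 2 * (A ^+ 2 + B ^+ 2 - 2 * (A * B))); last by rewrite AB mulr1.
  by field; rewrite gt_eqF.
have Fg n : finmom P (g_ n).
  rewrite (_ : g_ n = fun w => a_ n ^- 2 * (expR (a_ n * xi w) + expR (- a_ n * xi w) - 2));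
    last by apply/funext => w; exact: gE.
  apply: finmomZ; apply: finmomB; last exact: finmom_cst.
  by apply: finmomD; exact: finmom_expR.
pose G w := 16 * (expR (4 * xi w) + expR (- 4 * xi w)).
have FG : finmom P G by apply: finmomZ; apply: finmomD; exact: finmom_expR.
have gG n w : g_ n w ^+ 2 <= G w.
  have hb : `|h_ n w| <= 2 * expR `|xi w|.
    apply: (le_trans (ler_normB _ _)).
    have := expR_quotient_norm (xi w / 2) (a0 n) (a1 n).
    have := expR_quotient_norm (- (xi w / 2)) (a0 n) (a1 n).
    rewrite normrN (_ : `|xi w / 2| = `|xi w| / 2); last by rewrite normrM (@ger0_norm _ 2^-1).
    by rewrite (_ : 2 * (`|xi w| / 2) = `|xi w|); [lra|field].
  rewrite /g_ -exprM -[leLHS]ger0_norm ?exprn_double_ge0// normrX.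
  apply: (@le_trans _ _ ((2 * expR `|xi w|) ^+ 4)).
    by rewrite lerXn2r ?nnegrE// mulr_ge0// expR_ge0.
  rewrite exprMn -expRM_natl /G (_ : 2 ^+ 4 = 16); last by ring.
  rewrite ler_wpM2l//; have := expR_norm_le (4 * xi w).
  by rewrite normrM ger0_norm// mulNr.
have mono : \forall n \near \oo, \int[P]_w (g_ n w ^+ 2) <= \int[P]_w G w.
  by apply: nearW => n; apply: EE_le => //; exact: finmomX.
have cv : {ae P, forall w, g_ n w @[n --> \oo] --> xi w ^+ 2}.
  apply: aeW => w.
  have -> : xi w ^+ 2 = (xi w / 2 - (- (xi w / 2))) ^+ 2 by field.
  have H c : (expR (a_ n * c) - 1) / a_ n @[n --> \oo] --> c.
    rewrite (_ : (fun n => _) = fun n => (expR (c * a_ n) - 1) / a_ n).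
      exact: expR_sub1_cvg.
    by apply/funext => n; rewrite (mulrC c).
  have hcv : h_ n w @[n --> \oo] --> xi w / 2 - (- (xi w / 2)).
    exact: (cvgB (H _) (H _)).
  exact: (cvg_comp _ _ hcv (@exprn_continuous R 2 _)).
have L := second_moment_cvg Fg (measurable_funX 2 mxi) mono cv.
have Eg n : \int[P]_w g_ n w = 2 * ((expR (v / 2 * (a_ n) ^+ 2) - 1) / (a_ n) ^+ 2).
  under eq_Rintegral do rewrite gE.
  have F1 := finmom_expR (a_ n); have F2 := finmom_expR (- a_ n).
  have F3 := finmomD F1 F2; have F4 := finmom_cst P 2.
  rewrite (EE_Z _ (finmomB F3 F4)) (EE_B F3 F4) (EE_D F1 F2) EE_cst !EE_expR sqrrN.
  rewrite (_ : v / 2 * a_ n ^+ 2 = a_ n ^+ 2 * v / 2); last by ring.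
  by field; rewrite gt_eqF.
have L2 : \int[P]_w g_ n w @[n --> \oo] --> 2 * (v / 2).
  under eq_fun do rewrite Eg; apply: cvgMl_tmp.
  apply: (@expR_sub1_cvg _ _ (fun n => a_ n ^+ 2)).
    by move=> n; rewrite exprn_gt0.
  by have := cvg_comp _ _ ac (@exprn_continuous R 2 0); rewrite expr0n.
rewrite -(cvg_unique _ L2 L)//.
by field.
Qed.

End gaussian_moments.

Lemma normal_mean {d} {T : measurableType d} {R : realType}
    (P : probability T R) (v : R) (xi : T -> R) :
  centered_normal P v xi -> \int[P]_w xi w = 0.
Proof.
move=> xiP; apply/eqP; rewrite eq_le (normal_mean_le0 xiP)/= -oppr_le0.
have F := finmom_normal xiP.
have -> : - (\int[P]_w xi w) = \int[P]_w (-1 * xi w) by rewrite EE_Z// mulN1r.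
apply: (normal_mean_le0 (v := v)); split; first by case: (finmomZ (-1) F).
move=> l; under eq_integral do rewrite mulrA mulrN1.
by have [_ ->] := xiP; rewrite sqrrN.
Qed.

(** * Linear forms of a Gaussian vector *)

Section gaussian_law.
Context {d} {T : measurableType d} {R : realType}.
Variables (P : probability T R) (V : T -> 'cV[R]_2).
Hypothesis mV : measurable_fun setT (fun w => coords (V w)).

Lemma law_ge0_integral (mu : {measure set (R * R) -> \bar R}) (f : R * R -> \bar R) :
  has_law P V mu -> measurable_fun setT f -> (forall z, (0 <= f z)%E) ->
  (\int[P]_w f (coords (V w)) = \int[mu]_z f z)%E.
Proof.
move=> PV mf f0.
pose X : {mfun T >-> (R * R)%type} :=
  HB.pack (fun w => coords (V w)) (isMeasurableFun.Build _ _ _ _ _ mV).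
rewrite -(@ge0_integral_distribution _ _ _ _ _ P X)//.
by apply: eq_measure_integral => A mA _; exact: PV.
Qed.

Lemma law_Rintegral (mu : {measure set (R * R) -> \bar R}) (f : R * R -> R) :
  has_law P V mu -> measurable_fun setT f ->
  P.-integrable setT (EFin \o (fun w => f (coords (V w)))) ->
  \int[mu]_z f z = \int[P]_w f (coords (V w)).
Proof.
move=> PV mf iF.
pose X : {mfun T >-> (R * R)%type} :=
  HB.pack (fun w => coords (V w)) (isMeasurableFun.Build _ _ _ _ _ mV).
rewrite /Rintegral; congr fine.
rewrite -(@integral_distribution _ _ _ _ _ P X (EFin \o f))//; last exact/measurable_EFinP.
by apply: eq_measure_integral => A mA _; exact/esym/PV.
Qed.

Lemma gaussian_law_normal (S : 'M[R]_2) (c0 c1 : R) :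
  S 1 0 = S 0 1 -> 0 < S 1 1 -> 0 < \det S -> has_law P V (gaussian S) ->
  centered_normal P (S 0 0 * c0 ^+ 2 + 2 * S 0 1 * c0 * c1 + S 1 1 * c1 ^+ 2)
    (fun w => c0 * V w 0 0 + c1 * V w 1 0).
Proof.
move=> Ss Sp Sd PV.
have m1 : measurable_fun setT (fst : R * R -> R) by exact: measurable_fst.
have m2 : measurable_fun setT (snd : R * R -> R) by exact: measurable_snd.
split.
  have m : measurable_fun setT (fun z : R * R => c0 * z.1 + c1 * z.2).
    by apply: measurable_funD; exact: measurable_funM.
  exact: (measurableT_comp m mV).
move=> l.
have m : measurable_fun setT (fun z : R * R => expR (l * c0 * z.1 + l * c1 * z.2)).
  by apply: measurableT_comp => //; apply: measurable_funD; exact: measurable_funM.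
transitivity (\int[gaussian S]_z (expR (l * c0 * z.1 + l * c1 * z.2))%:E)%E.
  rewrite -(law_ge0_integral (f := fun z => (expR (l * c0 * z.1 + l * c1 * z.2))%:E) PV).
  - by apply: eq_integral => w _; rewrite /coords /= mulrDr !mulrA.
  - exact/measurable_EFinP.
  - by move=> z; rewrite lee_fin expR_ge0.
by rewrite gaussian_mgf_ereal//; congr ((expR _)%:E); field.
Qed.

End gaussian_law.

(** * Continuous functions on a compact interval *)

Section compact_interval.
Context {R : realType}.
Notation mu := (@lebesgue_measure R).
Variables (T : R) (f : R -> R).
Hypotheses (T0 : 0 <= T) (cf : {within `[0, T], continuous f}).

(** The Heine-Cantor theorem, drawn from the near-covering form of compactness. *)
Lemma unif_continuous_itv (e : R) : 0 < e ->
  \forall dlt \near 0^'+, forall s t : R, s \in `[0, T] -> t \in `[0, T] ->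
    `|s - t| < dlt -> `|f s - f t| <= e.
Proof.
move=> e0; have /subspace_continuousP cf' := cf.
have : compact (`[0, T]%classic : set R) by exact: segment_compact.
move/compact_near_coveringP.
move/(_ R (0^'+) (fun dlt (s : R) => s \in `[0, T] -> forall t : R, t \in `[0, T] ->
    `|s - t| < dlt -> `|f s - f t| <= e) _) => H.
have {}H := H _.
suff S : forall x, `[0, T]%classic x -> \forall x' \near x & i \near 0^'+,
    x' \in `[0, T] -> forall t : R, t \in `[0, T] -> `|x' - t| < i -> `|f x' - f t| <= e.
  by have := H S; apply: filterS => dlt K s t sT tT; exact: K.
move=> x xT.
have e2 : 0 < e / 2 by rewrite divr_gt0.
have /cvgrPdist_le/(_ _ e2) := cf' x xT.
rewrite near_withinE => /nbhs_ballP[eta /= eta0 Hb].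
have et2 : 0 < eta / 2 by rewrite divr_gt0.
exists (ball x (eta / 2), [set dlt | dlt < eta / 2]) => /=.
  split; first exact: nbhsx_ballx.
  exact: nbhs_right_lt.
move=> [x' dlt] /= [xx' dl] x'T t tT st.
have h1 : `|f x - f x'| <= e / 2.
  apply: Hb => //; apply: le_ball xx'; lra.
have h2 : `|f x - f t| <= e / 2.
  apply: Hb => //; rewrite /ball /=; move: xx'; rewrite /ball /= => xx'.
  rewrite (_ : x - t = (x - x') + (x' - t)); last by ring.
  by apply: (le_lt_trans (ler_normD _ _)); lra.
rewrite (_ : f x' - f t = (f x - f t) - (f x - f x')); last by ring.
by apply: (le_trans (ler_normB _ _)); lra.
Qed.

Lemma integrable_itv (a b : R) : 0 <= a -> b <= T ->
  mu.-integrable `[a, b] (EFin \o f).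
Proof.
move=> a0 bT; apply: continuous_compact_integrable; first exact: segment_compact.
apply: continuous_subspaceW cf.
by move=> x /=; rewrite !in_itv /= => /andP[h1 h2]; apply/andP; split; lra.
Qed.

Lemma Rintegral_itv_add (a b c : R) : 0 <= a -> a <= b -> b <= c -> c <= T ->
  \int[mu]_(x in `[a, c]) f x =
  \int[mu]_(x in `[a, b]) f x + \int[mu]_(x in `[b, c]) f x.
Proof.
move=> a0 ab bc cT; have i1 := integrable_itv a0 cT.
have := @Rintegral_itvB R f (BLeft a) (BRight c) b i1.
rewrite !bnd_simp => /(_ ab bc) E.
rewrite -(@Rintegral_itv_obnd_cbnd R b (BRight c) f) -?E; first by rewrite addrC subrK.
apply: integrableS i1 => //.
by apply: subset_itvr; rewrite bnd_simp.
Qed.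

Lemma Rintegral_itv_approx (a b c e : R) : 0 <= a -> a <= b -> b <= T ->
  (forall x : R, x \in `[a, b] -> `|f x - c| <= e) ->
  `|\int[mu]_(x in `[a, b]) f x - (b - a) * c| <= (b - a) * e.
Proof.
move=> a0 ab bT h.
have i1 := integrable_itv a0 bT.
have ic k : mu.-integrable `[a, b] (EFin \o (fun=> k)).
  apply: continuous_compact_integrable; first exact: segment_compact.
  by apply: continuous_subspaceT => x; exact: cvg_cst.
have len : fine (mu `[a, b]) = b - a.
  by rewrite lebesgue_measure_itv/= lte_fin; case: ltP => //= ba; lra.
have Ek k : \int[mu]_(x in `[a, b]) (fun=> k) x = (b - a) * k.
  rewrite -[LHS]/(\int[mu]_(x in `[a, b]) k) Rintegral_cst//= mulrC; congr (_ * _).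
  exact: len.
have U : \int[mu]_(x in `[a, b]) f x <= (b - a) * (c + e).
  rewrite -Ek; apply: le_Rintegral => // x xab.
  by have := h x xab; rewrite ler_norml => /andP[]; lra.
have L : (b - a) * (c - e) <= \int[mu]_(x in `[a, b]) f x.
  rewrite -Ek; apply: le_Rintegral => // x xab.
  by have := h x xab; rewrite ler_norml => /andP[]; lra.
by rewrite ler_norml lerBlDl lerBrDl -mulrDr -mulrBr L U.
Qed.

Lemma bounded_itv : exists2 K, 0 < K & forall x : R, x \in `[0, T] -> `|f x| <= K.
Proof.
have [c cT cmax] := EVT_max T0 cf; have [d dT dmin] := EVT_min T0 cf.
exists (`|f c| + `|f d| + 1); first by rewrite ltr_pwDr// addr_ge0.
move=> x xT; have := cmax x xT; have := dmin x xT.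
have := ler_norm (f c); have := ler_norm (- f d); rewrite normrN => h1 h2 h3 h4.
have := normr_ge0 (f c); have := normr_ge0 (f d) => h5 h6.
by rewrite ler_norml; apply/andP; split; lra.
Qed.

End compact_interval.

(** * Pathwise convergence of the Euler scheme and of its martingale *)

Section euler.
Context {R : realType}.
Notation mu := (@lebesgue_measure R).

(** The explicit Euler scheme of dy = - a y dt + dB, with p = 1 - a dt and [xi] the increments of
    B. *)
Fixpoint euler (p y0 : R) (xi : nat -> R) (k : nat) : R :=
  if k is k'.+1 then p * euler p y0 xi k' + xi k' else y0.

(** The increment is half the square of the next Euler value minus its conditional mean, that is, a
    discrete form of y dB. *)
Fixpoint euler_mart (p y0 dt : R) (xi : nat -> R) (k : nat) : R :=
  if k is k'.+1 then euler_mart p y0 dt xi k' +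
    (p * euler p y0 xi k' * xi k' + 2^-1 * (xi k' ^+ 2 - dt)) else 0.

(** A discrete Ito formula: the squares telescope and leave the Riemann sum of the squared
    scheme. *)
Lemma euler_martE (a y0 dt : R) xi k :
  euler_mart (1 - a * dt) y0 dt xi k =
  2^-1 * (euler (1 - a * dt) y0 xi k ^+ 2 - y0 ^+ 2 - k%:R * dt) +
  (a - 2^-1 * a ^+ 2 * dt) * \sum_(i < k) (dt * euler (1 - a * dt) y0 xi i ^+ 2).
Proof.
elim: k => [|k IH]; first by rewrite big_ord0 /=; ring.
rewrite big_ord_recr /= IH -natr1.
move: (euler _ _ _ _) (\sum_(i < k) _) => Y S.
by field.
Qed.

Variables (a T : R) (y B : R -> R).
Hypotheses (a0 : 0 < a) (T0 : 0 < T) (cy : {within `[0, T], continuous y}).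
Hypothesis yE : forall t : R, 0 <= t <= T ->
  y t = y 0 - a * \int[mu]_(s in `[0, t]) y s + B t.

(** The n-th grid has n + 1 steps, so that its mesh makes sense for every n. *)
Definition grid n (k : nat) : R := k%:R * (T / n.+1%:R).
Definition grid_incr n k := B (grid n k.+1) - B (grid n k).

Lemma grid_step n k : grid n k.+1 - grid n k = T / n.+1%:R.
Proof. by rewrite /grid -natr1; ring. Qed.

Lemma grid_step_gt0 n : 0 < T / n.+1%:R.
Proof. by rewrite divr_gt0// ltr0n. Qed.

Lemma grid_ge0 n k : 0 <= grid n k.
Proof. by rewrite mulr_ge0// ltW// grid_step_gt0. Qed.

Lemma grid_le n k l : (k <= l)%N -> grid n k <= grid n l.
Proof. by move=> kl; rewrite ler_pM2r ?grid_step_gt0// ler_nat. Qed.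

Lemma grid_last n : grid n n.+1 = T.
Proof. by rewrite /grid mulrCA divff ?mulr1// pnatr_eq0. Qed.

Lemma grid_le_last n k : (k <= n.+1)%N -> grid n k <= T.
Proof. by move=> kn; rewrite -(grid_last n) grid_le. Qed.

Lemma grid_fine (f : R -> R) (e : R) : {within `[0, T], continuous f} -> 0 < e ->
  \forall n \near \oo, forall k (s : R), (k <= n)%N ->
    s \in `[grid n k, grid n k.+1] -> `|f s - f (grid n k)| <= e.
Proof.
move=> cf e0; have := unif_continuous_itv cf e0.
move=> [dl /= dl0 H].
have T1 n : 0 < n.+1%:R :> R by rewrite ltr0n.
have cv : T / n.+1%:R @[n --> \oo] --> 0 * T.
  by under eq_fun do rewrite mulrC; apply: cvgMr_tmp; exact: cvg_harmonic.
rewrite mul0r in cv.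
have dl2 : 0 < dl / 2 by rewrite divr_gt0.
have /cvgrPdist_lt/(_ _ dl2) := cv.
apply: filterS => n; rewrite sub0r normrN gtr0_norm ?grid_step_gt0// => hn k s kn.
rewrite in_itv /= => /andP[s1 s2].
have g1 := grid_ge0 n k; have g2 : grid n k.+1 <= T by exact: grid_le_last.
have gs := grid_step n k.
apply: (H (dl / 2)).
- by rewrite /ball /= sub0r normrN gtr0_norm//; lra.
- exact: dl2.
- by rewrite in_itv /=; apply/andP; split; lra.
- by rewrite in_itv /=; apply/andP; split; lra.
- rewrite ger0_norm ?subr_ge0//; apply: le_lt_trans hn.
  by rewrite -gs lerD2r.
Qed.

Lemma Rintegral_grid (f : R -> R) n k : {within `[0, T], continuous f} ->
  (k <= n.+1)%N ->
  \int[mu]_(s in `[0, grid n k]) f s =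
  \sum_(i < k) \int[mu]_(s in `[grid n i, grid n i.+1]) f s.
Proof.
move=> cf; elim: k => [|k IH] kn.
  by rewrite big_ord0 /grid mul0r set_itv1 Rintegral_set1.
rewrite big_ord_recr /= -IH; last exact: ltnW.
apply: (Rintegral_itv_add (T := T)) => //.
- exact: grid_ge0.
- by rewrite grid_le.
- exact: grid_le_last.
Qed.

Lemma Rintegral_sum_approx (f : R -> R) n (c_ : nat -> R) (e : R) :
  {within `[0, T], continuous f} ->
  (forall k (s : R), (k <= n)%N -> s \in `[grid n k, grid n k.+1] -> `|f s - c_ k| <= e) ->
  `|\int[mu]_(s in `[0, T]) f s - \sum_(i < n.+1) (T / n.+1%:R * c_ i)| <= T * e.
Proof.
move=> cf h.
rewrite -{1}(grid_last n) Rintegral_grid// -sumrB.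
apply: (le_trans (ler_norm_sum _ _ _)).
apply: (@le_trans _ _ (\sum_(i < n.+1) (T / n.+1%:R * e))); last first.
  by rewrite sumr_const card_ord -[leLHS]mulr_natl mulrA mulrCA divff ?pnatr_eq0// mulr1.
apply: ler_sum => i _; rewrite -(grid_step n i).
have ilt := ltn_ord i.
apply: (Rintegral_itv_approx (T := T)) => //.
- exact: grid_ge0.
- by rewrite grid_le.
- exact: grid_le_last.
- by move=> x; apply: h; rewrite -ltnS.
Qed.

Lemma riemann_sum_cvg (f : R -> R) : {within `[0, T], continuous f} ->
  \sum_(i < n.+1) (T / n.+1%:R * f (grid n i)) @[n --> \oo] -->
  \int[mu]_(s in `[0, T]) f s.
Proof.
move=> cf; apply/cvgrPdist_le => e e0.
have eT : 0 < e / T by rewrite divr_gt0.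
apply: filterS (grid_fine cf eT) => n H.
have := Rintegral_sum_approx (c_ := fun k => f (grid n k)) cf H.
by rewrite mulrCA divff ?mulr1// gt_eqF.
Qed.

Notation Y n := (euler (1 - a * (T / n.+1%:R)) (y 0) (grid_incr n)).

(** With d the mesh, the new error is (1 - a d) times the old one plus a times the local integration
    error, which is at most d e. This is a convex combination, so the bound e is preserved and no
    Gronwall factor appears. *)
Lemma euler_error n (e : R) k : a * (T / n.+1%:R) <= 1 -> 0 <= e ->
  (forall k (s : R), (k <= n)%N -> s \in `[grid n k, grid n k.+1] ->
     `|y s - y (grid n k)| <= e) ->
  (k <= n.+1)%N -> `|Y n k - y (grid n k)| <= e.
Proof.
move=> adt e0 h; elim: k => [|k IH] kn.
  by rewrite /grid mul0r /= subrr normr0.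
have g1 := grid_ge0 n k; have g2 := grid_le n (leqnSn k).
have g3 := grid_le_last kn.
have E : y (grid n k.+1) = y (grid n k)
    - a * \int[mu]_(s in `[grid n k, grid n k.+1]) y s + grid_incr n k.
  rewrite (yE (t := grid n k.+1)); last by rewrite grid_ge0.
  rewrite (yE (t := grid n k)); last by rewrite grid_ge0 grid_le_last// ltnW.
  rewrite (Rintegral_itv_add (T := T) cy (lexx 0) g1 g2 g3) /grid_incr; ring.
have dt0 := grid_step_gt0 n.
have := Rintegral_itv_approx cy g1 g2 g3 (fun x => h k x kn).
rewrite grid_step /= => hI.
have {}IH := IH (ltnW kn).
rewrite /= E.
set I := \int[mu]_(s in _) _ in hI *; set d := T / _ in adt dt0 hI *.
rewrite (_ : _ - _ = (1 - a * d) * (Y n k - y (grid n k)) +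
  a * (I - d * y (grid n k))); last by ring.
apply: (le_trans (ler_normD _ _)); rewrite !normrM (gtr0_norm a0) ger0_norm; last lra.
have : a * `|I - d * y (grid n k)| <= a * (d * e) by rewrite ler_pM2l.
have : (1 - a * d) * `|Y n k - y (grid n k)| <= (1 - a * d) * e.
  by rewrite ler_wpM2l//; lra.
by rewrite -/d; lra.
Qed.

Lemma euler_step_small : \forall n \near \oo, a * (T / n.+1%:R) <= 1.
Proof.
have cv : a * (T / n.+1%:R) @[n --> \oo] --> a * (T * 0).
  by apply: cvgMl_tmp; apply: cvgMl_tmp; exact: cvg_harmonic.
rewrite !mulr0 in cv.
have /cvgrPdist_lt/(_ _ ltr01) := cv.
by apply: filterS => n; rewrite sub0r normrN => /ltW; apply: le_trans; exact: ler_norm.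
Qed.

Lemma euler_cvg : Y n n.+1 @[n --> \oo] --> y T.
Proof.
apply/cvgrPdist_le => e e0.
near=> n.
have adt : a * (T / n.+1%:R) <= 1 by near: n; exact: euler_step_small.
have h : forall k (s : R), (k <= n)%N -> s \in `[grid n k, grid n k.+1] ->
     `|y s - y (grid n k)| <= e by near: n; exact: grid_fine.
have := euler_error adt (ltW e0) h (leqnn n.+1).
by rewrite grid_last distrC.
Unshelve. all: by end_near. Qed.

Lemma euler_sqr_cvg : \sum_(i < n.+1) (T / n.+1%:R * Y n i ^+ 2) @[n --> \oo] -->
  \int[mu]_(s in `[0, T]) (y s ^+ 2).
Proof.
have [K K0 Kb] := bounded_itv (ltW T0) cy.
have cy2 : {within `[0, T], continuous (fun s => y s ^+ 2)}.
  apply/subspace_continuousP => x xT; have /subspace_continuousP cy' := cy.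
  exact: (cvg_comp _ _ (cy' x xT) (@exprn_continuous R 2 (y x))).
apply/cvgrPdist_le => e e0.
(* The scheme is within 2 e' of y, hence the squares differ by at most 2 e' (2 e' + 2 K), which is
   below e' (4 K + 4) as e' <= 1. *)
pose e' := Num.min 1 (e / (T * (4 * K + 4))).
have c0 : 0 < T * (4 * K + 4) by rewrite mulr_gt0//; lra.
have e'0 : 0 < e' by rewrite lt_min ltr01 divr_gt0.
have e'1 : e' <= 1 by rewrite ge_min lexx.
have e'e : e' * (T * (4 * K + 4)) <= e by rewrite -ler_pdivlMr// ge_min lexx orbT.
near=> n.
have adt : a * (T / n.+1%:R) <= 1 by near: n; exact: euler_step_small.
have h : forall k (s : R), (k <= n)%N -> s \in `[grid n k, grid n k.+1] ->
     `|y s - y (grid n k)| <= e' by near: n; exact: grid_fine.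
apply: (le_trans (Rintegral_sum_approx (c_ := fun i => Y n i ^+ 2)
  (e := e' * (4 * K + 4)) cy2 _)); last first.
  by rewrite mulrCA.
move=> k s kn sk.
have h1 := h k s kn sk.
have h2 := euler_error adt (ltW e'0) h (leqW kn).
have h3 : `|y s| <= K.
  apply: Kb; move: sk; rewrite !in_itv /= => /andP[s1 s2].
  have := grid_ge0 n k; have := grid_le_last (n := n) (k := k.+1) kn.
  by move=> *; apply/andP; split; lra.
have h4 : `|Y n k - y s| <= 2 * e'.
  rewrite (_ : _ - _ = (Y n k - y (grid n k)) - (y s - y (grid n k))); last by ring.
  by apply: (le_trans (ler_normB _ _)); lra.
rewrite distrC subr_sqr normrM.
have h5 : `|Y n k + y s| <= 2 * e' + 2 * K.
  rewrite (_ : _ + _ = (Y n k - y s) + (y s + y s)); last by ring.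
  have := ler_normD (Y n k - y s) (y s + y s); have := ler_normD (y s) (y s); lra.
have := normr_ge0 (Y n k - y s); have := normr_ge0 (Y n k + y s); nra.
Unshelve. all: by end_near. Qed.

(** The limit is the Ito integral of y against B in the form given by Ito's formula; it is reached
    on each path that solves the integral equation. *)
Lemma euler_mart_cvg :
  euler_mart (1 - a * (T / n.+1%:R)) (y 0) (T / n.+1%:R) (grid_incr n) n.+1
   @[n --> \oo] -->
  2^-1 * (y T ^+ 2 - y 0 ^+ 2 - T) + a * \int[mu]_(s in `[0, T]) (y s ^+ 2).
Proof.
rewrite (_ : (fun n => _) = fun n =>
  2^-1 * (Y n n.+1 ^+ 2 - y 0 ^+ 2 - T) +
  (a - 2^-1 * a ^+ 2 * (T / n.+1%:R)) *
    \sum_(i < n.+1) (T / n.+1%:R * Y n i ^+ 2)); last first.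
  apply/funext => n; rewrite euler_martE; congr (_ * (_ - _) + _).
  exact: (grid_last n).
apply: cvgD.
  apply: cvgMl_tmp; apply: cvgB; last exact: cvg_cst.
  apply: cvgB; last exact: cvg_cst.
  exact: (cvg_comp _ _ euler_cvg (@exprn_continuous R 2 _)).
apply: cvgM; last exact: euler_sqr_cvg.
rewrite -[X in _ --> X]subr0; apply: cvgB; first exact: cvg_cst.
rewrite -[X in _ --> X](mulr0 (2^-1 * a ^+ 2)); apply: cvgMl_tmp.
rewrite -[X in _ --> X](mulr0 T); apply: cvgMl_tmp.
exact: cvg_harmonic.
Qed.

End euler.

(** * Pathwise expansion of the scalar maximum likelihood estimator *)

Section scalar_mle.
Context {R : realType}.
Implicit Types a h T S M c s u x : R.

Lemma expR_taylor1 x : `|expR x - 1 - x| <= x ^+ 2 * expR `|x|.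
Proof.
have /andP[h1 h2] := expR_sub1_bounds x.
rewrite ger0_norm; last by lra.
have h3 := expR_sub1_norm x.
apply: (@le_trans _ _ (x * (expR x - 1))); first by rewrite mulrBr mulr1; lra.
apply: (le_trans (ler_norm _)); rewrite normrM -real_normK ?num_real//.
by rewrite expr2 -mulrA ler_wpM2l.
Qed.

(** Subtracting the score equations at c and at a leaves the factor c - a: the linearisation is
    exact. *)
Lemma score_root_eq a T S M c : 0 < a -> 0 < c ->
  (2 * c)^-1 + M - c * S = 0 ->
  (c - a) * (S + (2 * a * c)^-1) = (2 * a)^-1 + M - a * S.
Proof.
move=> a0 c0 eq0; have -> : M = c * S - (2 * c)^-1 by lra.
by field; rewrite !gt_eqF.
Qed.

(** The first summand serves the paths on which v = |s| + u + 1 exceeds eta T, the second the other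
    ones. *)
Definition mle_const a h : R :=
  let k := 2 + a^-1 in let eta := (8 + 2 * k)^-1 in
  (eta^-1 ^+ 2 + 2 * a * h * eta^-1) +
  (h * (4 * a * (k + 2 / a)) + h ^+ 2 * (4 * a) ^+ 2 * expR (h * a)).

(** A delta method with a remainder valid on every path. If v = |s| + u + 1 is at most eta T, then S
    is at least half of its typical value T / (2a), so c - a is 2as/T up to O(v^2 / T^2) and a
    Taylor expansion applies. Otherwise T <= v / eta, and it is enough that both exponentials lie
    between 0 and 1. *)
Lemma mle_exp_approx a h T S M u c s : 0 < a -> 0 < h -> 0 < T -> 0 <= S ->
  0 <= u -> 0 < c -> M = (T - u) / 2 -> (2 * c)^-1 + M - c * S = 0 ->
  s = (2 * a)^-1 + M - a * S ->
  `|expR (- h * c) - expR (- h * a) + 2 * a * h * expR (- h * a) * s / T|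
  <= mle_const a h * (`|s| + u + 1) ^+ 2 / T ^+ 2.
Proof.
move=> a0 h0 T0 S0 u0 c0 ME eq0 sE.
set v := `|s| + u + 1.
(* The identity 2aS - T = 1/a - u - 2s bounds |2aS - T| by k v; [eta] is small enough for v <= eta T
   to give both k v <= T / 2 and 8 v <= T. *)
pose k := 2 + a^-1; pose eta := (8 + 2 * k)^-1.
have ai0 : 0 < a^-1 by rewrite invr_gt0.
have k0 : 2 < k by rewrite /k; lra.
have eta0 : 0 < eta by rewrite invr_gt0; lra.
have etaK : eta * (8 + 2 * k) = 1 by rewrite mulVf// gt_eqF//; lra.
have s0 : 0 <= `|s| by [].
have v1 : 1 <= v by rewrite /v; lra.
have v0 : 0 < v by lra.
have sv : `|s| <= v by rewrite /v; lra.
have ea1 : expR (- h * a) <= 1 by rewrite -expR0 ler_expR; nra.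
have ec1 : expR (- h * c) <= 1 by rewrite -expR0 ler_expR; nra.
have ea0 := expR_ge0 (- h * a); have ec0 := expR_ge0 (- h * c).
have T2 : 0 < T ^+ 2 by rewrite exprn_gt0.
rewrite ler_pdivlMr// /mle_const -/k -/eta.
pose A := eta^-1 ^+ 2 + 2 * a * h * eta^-1.
pose B := h * (4 * a * (k + 2 / a)) + h ^+ 2 * (4 * a) ^+ 2 * expR (h * a).
have eti0 : 0 < eta^-1 by rewrite invr_gt0.
have A0 : 0 <= A.
  by rewrite addr_ge0// ?sqr_ge0// ltW// !mulr_gt0.
have B0 : 0 <= B.
  have : 0 < k + 2 / a by rewrite addr_gt0 ?mulr_gt0//; lra.
  move=> ka; apply: addr_ge0; first by rewrite ltW// !mulr_gt0.
  by rewrite mulr_ge0 ?expR_ge0// mulr_ge0 ?sqr_ge0.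
have v2 : 0 <= v ^+ 2 by exact: sqr_ge0.
rewrite -/A -/B.
have [bad|good] := ltP (eta * T) v.
  apply: (@le_trans _ _ (A * v ^+ 2)); last by rewrite ler_wpM2r//; lra.
  have vT : T <= v * eta^-1 by rewrite ler_pdivlMr// mulrC ltW.
  have d1 : `|expR (- h * c) - expR (- h * a)| <= 1.
    by rewrite ler_norml; apply/andP; split; lra.
  have d2 : `|2 * a * h * expR (- h * a) * s / T| * T <= 2 * a * h * v.
    rewrite !normrM normfV (gtr0_norm T0) divfK ?gt_eqF//.
    rewrite (gtr0_norm a0) (gtr0_norm h0) (ger0_norm ea0) (@ger0_norm _ 2)//.
    have h1 : 0 <= 2 * a * h by rewrite ltW// !mulr_gt0.
    by apply: ler_pM => //; [exact: mulr_ge0|exact: ler_piMr].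
  apply: (@le_trans _ _ ((1 + `|2 * a * h * expR (- h * a) * s / T|) * T ^+ 2)).
    apply: ler_wpM2r; first exact: ltW.
    by apply: (le_trans (ler_normD _ _)); lra.
  rewrite mulrDl mul1r expr2 [in X in _ + X]mulrA.
  apply: (@le_trans _ _ ((v * eta^-1) * (v * eta^-1) + 2 * a * h * v * (v * eta^-1))).
    have Tge := ltW T0.
    apply: lerD; first exact: ler_pM.
    have h1 : 0 <= 2 * a * h * v by rewrite ltW// !mulr_gt0.
    by apply: ler_pM => //; rewrite mulr_ge0.
  by rewrite le_eqVlt; apply/orP; left; apply/eqP; rewrite /A; ring.
apply: (@le_trans _ _ (B * v ^+ 2)); last by rewrite ler_wpM2r//; lra.
pose dl := c - a.
have E1 : dl * (S + (2 * a * c)^-1) = s by rewrite sE; exact: score_root_eq.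
have ci0 : 0 < c^-1 by rewrite invr_gt0.
have kap0 : 0 < (2 * a * c)^-1 by rewrite invr_gt0 !mulr_gt0.
have E2 : 2 * a * S = a^-1 + T - u - 2 * s.
  by rewrite sE ME; field; rewrite gt_eqF.
have aS : `|2 * a * S - T| <= k * v.
  have -> : 2 * a * S - T = a^-1 - u - 2 * s by rewrite E2; ring.
  have vs : 0 <= v - 1 - `|s| by rewrite /v; lra.
  have uv : u <= v by rewrite /v; lra.
  have av : a^-1 <= a^-1 * v by rewrite ler_peMr// ltW.
  have := ler_norm s; have := ler_norm (- s); rewrite normrN => n1 n2.
  by rewrite ler_norml /k mulrDl; apply/andP; split; rewrite /v in av uv *; lra.
have kv : k * v <= T / 2.
  have : (8 + 2 * k) * v <= (8 + 2 * k) * (eta * T) by rewrite ler_pM2l//; lra.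
  by rewrite mulrA (mulrC _ eta) etaK mul1r mulrDl; lra.
have v8 : 8 * v <= T.
  have : (8 + 2 * k) * v <= (8 + 2 * k) * (eta * T) by rewrite ler_pM2l//; lra.
  rewrite mulrA (mulrC _ eta) etaK mul1r mulrDl.
  have : 0 < k * v by rewrite mulr_gt0//; lra.
  lra.
have ST : T <= 4 * a * S.
  by move: aS; rewrite ler_norml => /andP[]; lra.
have dl1 : `|dl| * T <= 4 * a * v.
  apply: (@le_trans _ _ (`|dl| * (4 * a * S))); first by rewrite ler_wpM2l.
  rewrite mulrCA; apply: ler_wpM2l; first by rewrite mulr_ge0// ltW.
  apply: le_trans sv; rewrite -E1 normrM; apply: ler_wpM2l => //.
  by rewrite ger0_norm; lra.
have dla : `|dl| <= a / 2.
  rewrite -(ler_pM2r T0); apply: (le_trans dl1).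
  by rewrite (_ : a / 2 * T = 4 * a * (T / 8)); [rewrite ler_pM2l ?mulr_gt0//; lra|field].
have ca : a / 2 <= c.
  by move: dla; rewrite ler_norml /dl => /andP[]; lra.
have cia : c^-1 <= 2 / a.
  by rewrite -[leRHS]invf_div lef_pV2 ?posrE ?divr_gt0.
(* By the exact linearisation the difference is dl (T - 2aS - 1/c), a product of a factor O(v / T)
   and a factor O(v). *)
have dl2 : `|dl * T - 2 * a * s| * T <= 4 * a * (k + 2 / a) * v ^+ 2.
  have -> : dl * T - 2 * a * s = dl * (T - 2 * a * S - c^-1).
    by rewrite -E1; field; rewrite !gt_eqF.
  rewrite normrM mulrAC.
  have -> : 4 * a * (k + 2 / a) * v ^+ 2 = (4 * a * v) * ((k + 2 / a) * v) by ring.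
  apply: ler_pM => //; first exact/mulr_ge0/ltW.
  apply: (le_trans (ler_normB _ _)); rewrite distrC (gtr0_norm ci0).
  have : 2 / a <= 2 / a * v by rewrite ler_peMr// mulr_ge0// ltW.
  by rewrite mulrDl; lra.
(* The first summand is the Taylor remainder of the exponential, the second the error made in
   replacing c - a by 2as/T. *)
have key : expR (- h * c) - expR (- h * a) + 2 * a * h * expR (- h * a) * s / T =
   expR (- h * a) * ((expR (- h * dl) - 1 - (- h * dl))
                     - h * (dl * T - 2 * a * s) / T).
  have -> : - h * c = - h * a + - h * dl by rewrite /dl; ring.
  by rewrite expRD; field; rewrite gt_eqF.
rewrite key normrM (ger0_norm ea0).
apply: (@le_trans _ _ ((`|expR (- h * dl) - 1 - - h * dl| +
    `|h * (dl * T - 2 * a * s) / T|) * T ^+ 2)).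
  apply: ler_wpM2r; first exact: ltW.
  apply: (@le_trans _ _ (1 * `|expR (- h * dl) - 1 - - h * dl
     - h * (dl * T - 2 * a * s) / T|)); first by rewrite ler_wpM2r.
  by rewrite mul1r; exact: ler_normB.
rewrite mulrDl addrC /B [leRHS]mulrDl; apply: lerD.
  rewrite !normrM normfV (gtr0_norm T0) (gtr0_norm h0).
  rewrite (_ : _ * T ^+ 2 = h * (`|dl * T - 2 * a * s| * T)); last by field; rewrite gt_eqF.
  by rewrite -[leRHS]mulrA ler_pM2l.
apply: (@le_trans _ _ ((h * dl) ^+ 2 * expR `|h * dl| * T ^+ 2)).
  apply: ler_wpM2r; first exact: ltW.
  apply: (le_trans (expR_taylor1 _)).
  by rewrite mulNr sqrrN normrN.
have -> : (h * dl) ^+ 2 * expR `|h * dl| * T ^+ 2 =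
   h ^+ 2 * expR `|h * dl| * (`|dl| * T) ^+ 2.
  by rewrite [in RHS]exprMn real_normK ?num_real//; ring.
have -> : h ^+ 2 * (4 * a) ^+ 2 * expR (h * a) * v ^+ 2 =
   h ^+ 2 * expR (h * a) * (4 * a * v) ^+ 2 by ring.
apply: ler_pM; first by rewrite mulr_ge0 ?sqr_ge0 ?expR_ge0.
- exact: sqr_ge0.
- apply: ler_wpM2l; first exact: sqr_ge0.
  rewrite ler_expR normrM (gtr0_norm h0) ler_pM2l//; lra.
- by rewrite lerXn2r ?nnegrE ?mulr_ge0 ?(ltW a0) ?(ltW v0) ?(ltW T0).
Qed.

Lemma loglik_max_root M S c : 0 < c ->
  (forall x, 0 < x -> 2^-1 * ln x + x * M - x ^+ 2 / 2 * S <=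
                      2^-1 * ln c + c * M - c ^+ 2 / 2 * S) ->
  (2 * c)^-1 + M - c * S = 0.
Proof.
move=> c0 cmax.
pose f x := 2^-1 * ln x + x * M - x ^+ 2 / 2 * S.
have df x : 0 < x -> is_derive x 1 f ((2 * x)^-1 + M - x * S).
  move=> x0; have dl := is_derive1_ln x0.
  apply: is_derive_eq.
  rewrite /GRing.scale /=; field; rewrite gt_eqF//.
have [_ <-] := df c c0.
have c2 : c < c + 1 by lra.
have cin : c \in `]0, (c + 1)[ by rewrite in_itv /= c0 c2.
have := @derive1_at_max R f 0 (c + 1) c _ _ cin.
have -> : 0 <= c + 1 by lra.
move=> /(_ isT) H; have [||_ ->//] := H.
- by move=> t; rewrite in_itv /= => /andP[t0 _]; have [] := df t t0.
- by move=> t; rewrite in_itv /= => /andP[t0 _]; exact: cmax.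
Qed.

End scalar_mle.

(** * Algebras of adapted variables and expansion of expectations *)

Ltac finm := repeat (lazymatch goal with
  | |- finmom ?P (fun w => @?f w + @?g w) => apply (@finmomD _ _ _ P f g)
  | |- finmom ?P (fun w => - @?f w) => apply (@finmomN _ _ _ P f)
  | |- finmom ?P (fun w => @?f w * @?g w) => apply (@finmomM _ _ _ P f g)
  | |- finmom ?P (fun w => @?f w ^+ ?n) => apply (@finmomX _ _ _ P n f)
  | |- finmom ?P _ => first [assumption | exact (finmom_cst P _)]
  end).

Section subalgebra.
Context {d} {T : measurableType d} {R : realType}.
Variable P : probability T R.

(** Abstracts the variables measurable for the past with all moments finite; the recursions below
    use only the closure under polynomial operations. *)
Definition moment_subalgebra (F : (T -> R) -> Prop) := [/\
  forall c, F (fun=> c),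
  forall f g, F f -> F g -> F (fun w => f w + g w),
  forall f g, F f -> F g -> F (fun w => f w * g w) &
  forall f, F f -> finmom P f].

Lemma moment_subalgebraX F f n : moment_subalgebra F -> F f -> F (fun w => f w ^+ n).
Proof.
move=> [Fc _ FM _] Ff; elim: n => [|n IH].
  by rewrite (_ : (fun w => _) = fun=> 1)//; apply/funext => w; rewrite expr0.
rewrite (_ : (fun w => _) = fun w => f w * f w ^+ n); first exact: FM.
by apply/funext => w; rewrite exprS.
Qed.

Lemma EE_eq (f g : T -> R) : f =1 g -> \int[P]_w f w = \int[P]_w g w.
Proof. by move=> fg; apply: eq_Rintegral => w _; exact: fg. Qed.

Fixpoint all_finmom (s : seq (T -> R)) : Prop :=
  if s is f :: s' then finmom P f /\ all_finmom s' else True.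

Lemma EE_list s : all_finmom s ->
  finmom P (fun w => foldr (fun f r => f w + r) 0 s) /\
  \int[P]_w foldr (fun f r => f w + r) 0 s =
  foldr (fun f r => \int[P]_w f w + r) 0 s.
Proof.
elim: s => [_|f s IH] /=; first by split; [exact: finmom_cst|rewrite EE_cst].
move=> [Ff /IH[Fs Es]]; split; first exact: finmomD.
by rewrite EE_D// Es.
Qed.

(** Linearity for a whole list of terms, so that a long expansion is checked pointwise by one
    algebraic identity. *)
Lemma EE_expand g s : all_finmom s ->
  (forall w, g w = foldr (fun f r => f w + r) 0 s) ->
  \int[P]_w g w = foldr (fun f r => \int[P]_w f w + r) 0 s.
Proof. by move=> /EE_list[_ <-] gs; exact: EE_eq. Qed.

End subalgebra.

Definition normal_cst {R : realType} n : R := (2 * n)`!%:R * (2 * expR 2^-1).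

(** * Moments over one step of the scheme *)

Section one_step.
Context {d} {T : measurableType d} {R : realType}.
Variables (P : probability T R) (F : (T -> R) -> Prop).
Hypothesis FP : moment_subalgebra P F.
Variables (dt : R) (x x' : T -> R).
Hypotheses (dt0 : 0 < dt) (xN : centered_normal P dt x) (xN' : centered_normal P dt x').
Hypothesis ind : forall f i j, F f ->
  \int[P]_w (f w * (x w ^+ i * x' w ^+ j)) =
  \int[P]_w f w * \int[P]_w (x w ^+ i * x' w ^+ j).

Let fx : finmom P x := finmom_normal xN.
Let fx' : finmom P x' := finmom_normal xN'.

Lemma EE_indep1 f n : F f -> \int[P]_w (f w * x w ^+ n) =
  \int[P]_w f w * \int[P]_w (x w ^+ n).
Proof.
move=> Ff; have := ind n 0 Ff.
rewrite (@EE_eq _ _ _ P _ (fun w => f w * x w ^+ n)); last by move=> w; rewrite expr0 mulr1.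
by rewrite (@EE_eq _ _ _ P (fun w => x w ^+ n * _) (fun w => x w ^+ n))// => w; rewrite expr0 mulr1.
Qed.

Lemma EE_indep2 f n : F f -> \int[P]_w (f w * x' w ^+ n) =
  \int[P]_w f w * \int[P]_w (x' w ^+ n).
Proof.
move=> Ff; have := ind 0 n Ff.
rewrite (@EE_eq _ _ _ P _ (fun w => f w * x' w ^+ n)); last by move=> w; rewrite expr0 mul1r.
by rewrite (@EE_eq _ _ _ P (fun w => x w ^+ 0 * _) (fun w => x' w ^+ n))// => w; rewrite expr0 mul1r.
Qed.

Lemma EE_incr1 f : F f -> \int[P]_w (f w * x w) = 0.
Proof.
move=> Ff; have := EE_indep1 1 Ff; rewrite (@EE_eq _ _ _ P _ (fun w => f w * x w))// => ->.
by rewrite (@EE_eq _ _ _ P (fun w => x w ^+ 1) x)// (normal_mean xN) mulr0.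
Qed.

Lemma EE_incr2 f : F f -> \int[P]_w (f w * x w ^+ 2) = \int[P]_w f w * dt.
Proof. by move=> Ff; rewrite EE_indep1// (normal_variance xN). Qed.

Lemma euler_step_mean p Y : F Y -> \int[P]_w Y w = 0 ->
  \int[P]_w (p * Y w + x w) = 0.
Proof.
move=> FY Y0; have [_ _ _ Ff] := FP; have fY := Ff _ FY.
by rewrite EE_D; [rewrite EE_Z// Y0 mulr0 add0r (normal_mean xN)|finm|finm].
Qed.

Lemma euler_step_sqr p Y : F Y ->
  \int[P]_w ((p * Y w + x w) ^+ 2) = p ^+ 2 * \int[P]_w (Y w ^+ 2) + dt.
Proof.
move=> FY; have [Fc FD FM Ff] := FP; have fY := Ff _ FY.
rewrite (@EE_eq _ _ _ P _ (fun w => p ^+ 2 * Y w ^+ 2 + ((2 * p * Y w) * x w + x w ^+ 2)));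
  last by move=> w; ring.
rewrite EE_D; [|finm|finm]; rewrite EE_D; [|finm|finm].
rewrite EE_Z; last by finm.
rewrite EE_incr1 ?add0r ?(normal_variance xN)//.
by apply: (FM (fun=> 2 * p)).
Qed.

Lemma euler_step_pow4 p Y : F Y -> \int[P]_w Y w = 0 ->
  \int[P]_w ((p * Y w + x w) ^+ 4) = p ^+ 4 * \int[P]_w (Y w ^+ 4) +
    6 * p ^+ 2 * \int[P]_w (Y w ^+ 2) * dt + \int[P]_w (x w ^+ 4).
Proof.
move=> FY Y0; have [Fc FD FM Ff] := FP; have fY := Ff _ FY.
have FX f n Hf := @moment_subalgebraX _ _ _ P F f n FP Hf.
rewrite (@EE_eq _ _ _ P _ (fun w => p ^+ 4 * Y w ^+ 4 + ((4 * p ^+ 3 * Y w ^+ 3) * x w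
   + ((6 * p ^+ 2 * Y w ^+ 2) * x w ^+ 2 + ((4 * p * Y w) * x w ^+ 3 + x w ^+ 4)))));
  last by move=> w; ring.
rewrite EE_D; [|finm|finm]; rewrite EE_D; [|finm|finm].
rewrite EE_D; [|finm|finm]; rewrite EE_D; [|finm|finm].
rewrite EE_Z; last by finm.
rewrite EE_incr1; last by apply: (FM (fun=> 4 * p ^+ 3)) => //; exact: FX.
rewrite EE_incr2; last by apply: (FM (fun=> 6 * p ^+ 2)) => //; exact: FX.
(* The third moment of the increment is left unevaluated: it is multiplied by the mean of Y, which
   is zero. *)
rewrite EE_indep1; last by apply: (FM (fun=> 4 * p)).
rewrite EE_Z; last by finm.
by rewrite EE_Z// Y0; ring.
Qed.

Lemma normal_pow_le n : \int[P]_w (x w ^+ (2 * n)) <= normal_cst n * dt ^+ n.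
Proof. by have := normal_even_moment_le xN n dt0; rewrite /normal_cst. Qed.

(** Only the order dt^2 matters: summed over the steps of a grid, such terms vanish with the mesh.
    This covers correlated as well as equal increments. *)
Lemma normal_mixed4 :
  `|\int[P]_w (x w ^+ 2 * x' w ^+ 2) - dt ^+ 2| <= (normal_cst 2 + 1) * dt ^+ 2.
Proof.
have h1 : \int[P]_w (x w ^+ 4) <= normal_cst 2 * dt ^+ 2.
  by have := normal_even_moment_le xN 2 dt0.
have h2 : \int[P]_w (x' w ^+ 4) <= normal_cst 2 * dt ^+ 2.
  by have := normal_even_moment_le xN' 2 dt0.
have h3 : 0 <= \int[P]_w (x w ^+ 2 * x' w ^+ 2).
  by apply: EE_ge0 => w; rewrite mulr_ge0 ?sqr_ge0.
have h4 : \int[P]_w (x w ^+ 2 * x' w ^+ 2) <=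
          \int[P]_w (2^-1 * (x w ^+ 4 + x' w ^+ 4)).
  apply: EE_le; [finm|finm|move=> w].
  by have := sqr_ge0 (x w ^+ 2 - x' w ^+ 2); lra.
move: h4; rewrite EE_Z; last by finm.
rewrite EE_D; [|finm|finm] => h4.
have d2 := sqr_ge0 dt.
by rewrite ler_norml; apply/andP; split; lra.
Qed.

(** After factoring the past out, the terms linear in M or M' vanish because the increments are
    centred with variance dt, and those of degree one in Y or Y' because these have mean zero. *)
Lemma mart_step_cross p p' Y Y' M M' : F Y -> F Y' -> F M -> F M' ->
  \int[P]_w Y w = 0 -> \int[P]_w Y' w = 0 ->
  \int[P]_w ((M w + (p * Y w * x w + 2^-1 * (x w ^+ 2 - dt))) *
             (M' w + (p' * Y' w * x' w + 2^-1 * (x' w ^+ 2 - dt)))) =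
  \int[P]_w (M w * M' w) +
  p * p' * \int[P]_w (Y w * Y' w) * \int[P]_w (x w * x' w) +
  4^-1 * (\int[P]_w (x w ^+ 2 * x' w ^+ 2) - dt ^+ 2).
Proof.
move=> FY FY' FMm FM' Y0 Y0'; have [Fc FD FM Ff] := FP.
have fY := Ff _ FY; have fY' := Ff _ FY'; have fM := Ff _ FMm; have fM' := Ff _ FM'.
pose A w := p' * (M w * Y' w); pose B w := p * (M' w * Y w).
have FA : F A by apply: (FM (fun=> p')) => //; exact: FM.
have FB : F B by apply: (FM (fun=> p)) => //; exact: FM.
have FYY : F (fun w => p * p' * (Y w * Y' w)).
  by apply: (FM (fun=> p * p')) => //; exact: FM.
have FpY : F (fun w => 2^-1 * p * Y w) by exact: (FM (fun=> 2^-1 * p)).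
have FpY' : F (fun w => 2^-1 * p' * Y' w) by exact: (FM (fun=> 2^-1 * p')).
have fA := Ff _ FA; have fB := Ff _ FB.
have FYt : F (fun w => p * p' * (Y w * Y' w)) := FYY.
rewrite (@EE_expand _ _ _ P _ [:: fun w => M w * M' w;
  fun w => A w * x' w; fun w => B w * x w;
  fun w => 2^-1 * (M w * x' w ^+ 2); fun w => (- 2^-1 * dt) * M w;
  fun w => 2^-1 * (M' w * x w ^+ 2); fun w => (- 2^-1 * dt) * M' w;
  fun w => (p * p' * (Y w * Y' w)) * (x w ^+ 1 * x' w ^+ 1);
  fun w => (2^-1 * p * Y w) * (x w ^+ 1 * x' w ^+ 2);
  fun w => (- dt) * ((2^-1 * p * Y w) * x w);
  fun w => (2^-1 * p' * Y' w) * (x w ^+ 2 * x' w ^+ 1);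
  fun w => (- dt) * ((2^-1 * p' * Y' w) * x' w);
  fun w => 4^-1 * (x w ^+ 2 * x' w ^+ 2);
  fun w => (- 4^-1 * dt) * x w ^+ 2; fun w => (- 4^-1 * dt) * x' w ^+ 2;
  fun w => 4^-1 * dt ^+ 2]); [|by do ![split; first by finm]
                               |by move=> w /=; rewrite /A /B; field].
rewrite [LHS]/=.
rewrite !(ind _ _ FYt) !(ind _ _ FpY) !(ind _ _ FpY').
have fpY := Ff _ FpY; have fpY' := Ff _ FpY'; have fYt := Ff _ FYt.
rewrite !EE_Z; try finm.
rewrite EE_cst (EE_incr1 FB) (EE_incr1 FpY) (EE_incr2 FM').
have iA := EE_indep2 1 FA; have iM := EE_indep2 2 FMm; have iY := EE_indep2 1 FpY'.
rewrite (@EE_eq _ _ _ P (fun w => A w * x' w) (fun w => A w * x' w ^+ 1))// iA.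
rewrite (@EE_eq _ _ _ P (fun w => 2^-1 * p' * Y' w * x' w)
  (fun w => 2^-1 * p' * Y' w * x' w ^+ 1))// iY iM.
rewrite (@EE_eq _ _ _ P (fun w => x' w ^+ 1) x')//.
rewrite (normal_mean xN') (normal_variance xN') (normal_variance xN) Y0 Y0'.
by rewrite (@EE_eq _ _ _ P (fun w => x w ^+ 1 * x' w ^+ 1) (fun w => x w * x' w))//; ring.
Qed.

(** A Gronwall step for fourth moments. The quadratic terms in M are split by Young's inequality at
    the scale Tm of the horizon: dt M^2 Y^2 is bounded by (dt / Tm) M^4 and dt Tm Y^4, which
    iterates to a bound of order Tm^2. *)
Lemma mart_step_pow4 p Y M Tm b K4 : 0 <= p <= 1 -> F Y -> F M -> 0 < Tm ->
  dt <= Tm -> dt <= b -> \int[P]_w (Y w ^+ 4) <= K4 ->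
  \int[P]_w ((M w + (p * Y w * x w + 2^-1 * (x w ^+ 2 - dt))) ^+ 4) <=
  (1 + (8 + 2 * normal_cst 2 * b) * (dt / Tm)) * \int[P]_w (M w ^+ 4) +
  dt * Tm * (8 * K4 + 2 * normal_cst 2 * b + 24 * K4 * normal_cst 2
             + 12 * (normal_cst 4 + 1) * b ^+ 2).
Proof.
move=> /andP[p0 p1] FY FMm Tm0 dtT dtb YK; have [Fc FD FM Ff] := FP.
have fY := Ff _ FY; have fM := Ff _ FMm.
have FX f n Hf := @moment_subalgebraX _ _ _ P F f n FP Hf.
pose A w := 4 * p * (M w ^+ 3 * Y w).
pose B w := M w ^+ 2 * Y w ^+ 2.
have FA : F A by apply: (FM (fun=> 4 * p)) => //; apply: FM => //; exact: FX.
have FB : F B by apply: FM; exact: FX.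
have FM2 := FX _ 2 FMm; have FM3 := FX _ 3 FMm; have FY4 := FX _ 4 FY.
have fA := Ff _ FA; have fB := Ff _ FB.
pose c2 := normal_cst 2 : R; pose c4 := normal_cst 4 : R.
(* The terms of a pointwise upper bound for the fourth power. Those cubic in M have cancelling
   expectations, so the odd powers of M disappear after integration. *)
pose s : seq (T -> R) := [:: fun w => M w ^+ 4; fun w => A w * x w;
  fun w => 2 * (M w ^+ 3 * x w ^+ 2); fun w => (- 2 * dt) * M w ^+ 3;
  fun w => 16 * (B w * x w ^+ 2);
  fun w => 4 * (M w ^+ 2 * x w ^+ 4); fun w => (- 8 * dt) * (M w ^+ 2 * x w ^+ 2);
  fun w => (4 * dt ^+ 2) * M w ^+ 2;
  fun w => 24 * (Y w ^+ 4 * x w ^+ 4); fun w => 12 * x w ^+ 8; fun w => 12 * dt ^+ 4].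
have fs : all_finmom P s by do ![split; first by finm].
have [fS ES] := EE_list fs.
apply: (@le_trans _ _ (\int[P]_w foldr (fun f r => f w + r) 0 s)).
  apply: EE_le => //; first by finm.
  move=> w; rewrite /s /= /A /B.
  move: (M w) (Y w) (x w) => m y z.
  pose d1 := p * y * z; pose d2 := 2^-1 * (z ^+ 2 - dt).
  (* With D = d1 + d2, the term 4 m D^3 is absorbed by 2 m^2 D^2 + 2 D^4; the term linear in D is
     kept exactly because its mean vanishes. *)
  have e1 : (m + (d1 + d2)) ^+ 4 <= m ^+ 4 + 4 * m ^+ 3 * (d1 + d2) +
      8 * (m ^+ 2 * (d1 + d2) ^+ 2) + 3 * (d1 + d2) ^+ 4.
    have := sqr_ge0 (m * (d1 + d2) - (d1 + d2) ^+ 2); lra.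
  apply: (le_trans e1).
  have p2 : p ^+ 2 <= 1 by rewrite expr_le1.
  have p4 : p ^+ 4 <= 1 by rewrite expr_le1.
  have e2 : (d1 + d2) ^+ 2 <= 2 * (y ^+ 2 * z ^+ 2) + 2 * d2 ^+ 2.
    have : d1 ^+ 2 <= y ^+ 2 * z ^+ 2.
      by rewrite /d1 !exprMn -mulrA ler_piMl// mulr_ge0 ?sqr_ge0.
    by have := sqr_ge0 (d1 - d2); lra.
  have e3 : (d1 + d2) ^+ 4 <= 8 * (y ^+ 4 * z ^+ 4) + 8 * d2 ^+ 4.
    have h4 : d1 ^+ 4 <= y ^+ 4 * z ^+ 4.
      by rewrite /d1 !exprMn -mulrA ler_piMl// mulr_ge0// (exprn_double_ge0 _ 2).
    have := sqr_ge0 (d1 ^+ 2 - d2 ^+ 2); have := sqr_ge0 (d1 - d2) => g1 g2.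
    have g3 : (d1 + d2) ^+ 2 <= 2 * (d1 ^+ 2 + d2 ^+ 2) by lra.
    have : ((d1 + d2) ^+ 2) ^+ 2 <= (2 * (d1 ^+ 2 + d2 ^+ 2)) ^+ 2.
      by rewrite lerXn2r ?nnegrE ?sqr_ge0// mulr_ge0// addr_ge0 ?sqr_ge0.
    by rewrite -exprM; lra.
  have e4 : d2 ^+ 4 <= 2^-1 * (z ^+ 8 + dt ^+ 4).
    have g1 : 0 <= (z ^+ 2 + dt) ^+ 2 by exact: sqr_ge0.
    have g3 : (z ^+ 2 - dt) ^+ 2 <= 2 * (z ^+ 4 + dt ^+ 2) by lra.
    have g4 : ((z ^+ 2 - dt) ^+ 2) ^+ 2 <= (2 * (z ^+ 4 + dt ^+ 2)) ^+ 2.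
      rewrite lerXn2r ?nnegrE ?sqr_ge0// mulr_ge0// addr_ge0 ?sqr_ge0//.
      exact: (exprn_double_ge0 _ 2).
    have g5 := sqr_ge0 (z ^+ 4 - dt ^+ 2).
    rewrite /d2 exprMn; move: g4; rewrite -!exprM; lra.
  have e5 : m ^+ 2 * (d1 + d2) ^+ 2 <= m ^+ 2 * (2 * (y ^+ 2 * z ^+ 2) + 2 * d2 ^+ 2).
    by rewrite ler_wpM2l ?sqr_ge0.
  have e6 : m ^+ 2 * d2 ^+ 2 = 4^-1 * (m ^+ 2 * z ^+ 4 - 2 * dt * (m ^+ 2 * z ^+ 2)
     + dt ^+ 2 * m ^+ 2) by rewrite /d2; field.
  have e7 : 4 * m ^+ 3 * (d1 + d2) = 4 * p * (m ^+ 3 * y) * z +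
     (2 * (m ^+ 3 * z ^+ 2) + (- 2 * dt) * m ^+ 3) by rewrite /d1 /d2; field.
  lra.
rewrite ES /= (EE_incr1 FA).
have i8 : \int[P]_w (x w ^+ 8) <= c4 * dt ^+ 4 by exact: (normal_pow_le 4).
have i4 : \int[P]_w (x w ^+ 4) <= c2 * dt ^+ 2 by exact: (normal_pow_le 2).
have := EE_indep1 4 FM2; have := EE_indep1 4 FY4.
rewrite !EE_Z; try finm.
move=> -> ->.
rewrite EE_cst (EE_incr2 FM3) (EE_incr2 FB) (EE_incr2 FM2).
set m4 := \int[P]_w (M w ^+ 4); set m2 := \int[P]_w (M w ^+ 2).
set m3 := \int[P]_w (M w ^+ 3); set y4 := \int[P]_w (Y w ^+ 4) in YK *.
set bb := \int[P]_w B w; set x4 := \int[P]_w (x w ^+ 4) in i4 *.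
set x8 := \int[P]_w (x w ^+ 8) in i8 *.
have m20 : 0 <= m2 by apply: EE_ge0 => w; exact: sqr_ge0.
have y40 : 0 <= y4 by apply: EE_ge0 => w; exact: (exprn_double_ge0 _ 2).
have x40 : 0 <= x4 by apply: EE_ge0 => w; exact: (exprn_double_ge0 _ 2).
have m40 : 0 <= m4 by apply: EE_ge0 => w; exact: (exprn_double_ge0 _ 2).
have hB : bb <= 2^-1 * (m4 / Tm + Tm * y4).
  apply: (@le_trans _ _ (\int[P]_w (2^-1 * Tm^-1 * M w ^+ 4 + 2^-1 * Tm * Y w ^+ 4))).
    apply: EE_le => //; [by finm|move=> w; rewrite /B].
    rewrite -subr_ge0 [leRHS](_ : _ = (2 * Tm)^-1 * (M w ^+ 2 - Tm * Y w ^+ 2) ^+ 2).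
      by rewrite mulr_ge0 ?sqr_ge0// invr_ge0 mulr_ge0// ltW.
    by field; rewrite gt_eqF.
  rewrite EE_D; [|by finm|by finm].
  by rewrite !EE_Z; try finm; rewrite le_eqVlt; apply/orP; left; apply/eqP; rewrite -/m4 -/y4; ring.
have hm2 : m2 <= 2^-1 * (m4 / Tm + Tm).
  apply: (@le_trans _ _ (\int[P]_w (2^-1 * Tm^-1 * M w ^+ 4 + 2^-1 * Tm))).
    apply: EE_le => //; [by finm|by finm|move=> w].
    rewrite -subr_ge0 [leRHS](_ : _ = (2 * Tm)^-1 * (M w ^+ 2 - Tm) ^+ 2).
      by rewrite mulr_ge0 ?sqr_ge0// invr_ge0 mulr_ge0// ltW.
    by field; rewrite gt_eqF.
  rewrite EE_D; [|by finm|by finm].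
  by rewrite EE_cst !EE_Z; try finm; rewrite le_eqVlt; apply/orP; left; apply/eqP; rewrite -/m4; ring.
have c20 : 0 <= c2 by rewrite mulr_ge0// mulr_ge0// expR_ge0.
have c40 : 0 <= c4 by rewrite mulr_ge0// mulr_ge0// expR_ge0.
have b0 : 0 <= b by apply: le_trans dtb; exact: ltW.
have dtge := ltW dt0; have Tmge := ltW Tm0.
have h1 : bb * dt <= 2^-1 * (m4 / Tm + Tm * K4) * dt.
  rewrite ler_wpM2r//; apply: (le_trans hB); rewrite ler_pM2l// lerD2l.
  by rewrite ler_wpM2l.
have dt2b : dt ^+ 2 <= b * dt by rewrite expr2 ler_wpM2r.
have dt2T : dt ^+ 2 <= dt * Tm by rewrite expr2 ler_wpM2l.
have h2 : m2 * x4 <= 2^-1 * (m4 / Tm + Tm) * (c2 * (b * dt)).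
  apply: ler_pM => //; apply: (le_trans i4); exact: ler_wpM2l.
have h3 : y4 * x4 <= K4 * (c2 * (dt * Tm)).
  apply: ler_pM => //; apply: (le_trans i4); exact: ler_wpM2l.
have dt4 : dt ^+ 4 <= b ^+ 2 * (dt * Tm).
  rewrite (_ : dt ^+ 4 = dt ^+ 2 * dt ^+ 2); last by ring.
  apply: ler_pM => //; [exact: sqr_ge0|exact: sqr_ge0|].
  by rewrite lerXn2r ?nnegrE.
have h4 : (c4 + 1) * dt ^+ 4 <= (c4 + 1) * (b ^+ 2 * (dt * Tm)).
  by rewrite ler_wpM2l// addr_ge0.
have h5 : 0 <= dt ^+ 2 * m2 by rewrite mulr_ge0 ?sqr_ge0.
rewrite -/c2 -/c4.
have E1 : (1 + (8 + 2 * c2 * b) * (dt / Tm)) * m4 +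
  dt * Tm * (8 * K4 + 2 * c2 * b + 24 * K4 * c2 + 12 * (c4 + 1) * b ^+ 2) =
  m4 + 16 * (2^-1 * (m4 / Tm + Tm * K4) * dt) +
  4 * (2^-1 * (m4 / Tm + Tm) * (c2 * (b * dt))) +
  24 * (K4 * (c2 * (dt * Tm))) + 12 * ((c4 + 1) * (b ^+ 2 * (dt * Tm))) by field; rewrite gt_eqF.
rewrite E1; lra.
Qed.

End one_step.

(** * Moments of the discrete martingale over the whole grid *)

Section discrete_martingale.
Context {d} {T : measurableType d} {R : realType}.
Variables (P : probability T R) (F : nat -> (T -> R) -> Prop).
Variables (a : bool -> R) (dt : R) (y0 : bool -> T -> R) (xi : nat -> bool -> T -> R).
Hypothesis a0 : forall e, 0 < a e.
Hypotheses (dt0 : 0 < dt) (adt : forall e, a e * dt <= 1).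
Hypothesis FP : forall k, moment_subalgebra P (F k).
Hypothesis FS : forall k f, F k f -> F k.+1 f.
Hypothesis Fy0 : forall e, F 0 (y0 e).
Hypothesis Fxi : forall k e, F k.+1 (xi k e).
Hypothesis y0N : forall e, centered_normal P (2 * a e)^-1 (y0 e).
Hypothesis xiN : forall k e, centered_normal P dt (xi k e).
Hypothesis xi_orth : forall k, \int[P]_w (xi k false w * xi k true w) = 0.
Hypothesis ind : forall k e e' f i j, F k f ->
  \int[P]_w (f w * (xi k e w ^+ i * xi k e' w ^+ j)) =
  \int[P]_w f w * \int[P]_w (xi k e w ^+ i * xi k e' w ^+ j).

Definition eulerP e k w := euler (1 - a e * dt) (y0 e w) (fun k => xi k e w) k.
Definition martP e k w :=
  euler_mart (1 - a e * dt) (y0 e w) dt (fun k => xi k e w) k.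

Let p e : R := 1 - a e * dt.

Lemma eulerP_step e k w : eulerP e k.+1 w = p e * eulerP e k w + xi k e w.
Proof. by []. Qed.

Lemma martP_step e k w : martP e k.+1 w = martP e k w +
  (p e * eulerP e k w * xi k e w + 2^-1 * (xi k e w ^+ 2 - dt)).
Proof. by []. Qed.

Lemma F_eulerP e k : F k (eulerP e k).
Proof.
elim: k => [|k IH]; first exact: Fy0.
have [Fc FD FM _] := FP k.+1.
apply: (FD (fun w => p e * eulerP e k w) (xi k e)) => //.
by apply: (FM (fun=> p e)) => //; exact: FS.
Qed.

Lemma F_martP e k : F k (martP e k).
Proof.
elim: k => [|k IH]; first by have [Fc _ _ _] := FP 0; exact: Fc.
have [Fc FD FM _] := FP k.+1.
have FY := FS (F_eulerP e k); have Fx := Fxi k e.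
apply: (FD (martP e k) (fun w => p e * eulerP e k w * xi k e w +
   2^-1 * (xi k e w ^+ 2 - dt))); first exact: FS.
apply: (FD (fun w => p e * eulerP e k w * xi k e w)).
  apply: (FM (fun w => p e * eulerP e k w)) => //.
  exact: (FM (fun=> p e)).
apply: (FM (fun=> 2^-1)) => //; apply: (FD (fun w => xi k e w ^+ 2) (fun=> - dt)) => //.
exact: moment_subalgebraX (FP k.+1) Fx.
Qed.

Lemma eulerP_mean e k : \int[P]_w eulerP e k w = 0.
Proof.
elim: k => [|k IH]; first exact: (normal_mean (y0N e)).
exact: (euler_step_mean (FP k) (xiN k e) (p e) (F_eulerP e k) IH).
Qed.

Let p01 e : 0 <= p e <= 1.
Proof. by rewrite /p; have := adt e; have := mulr_gt0 (a0 e) dt0; lra. Qed.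

Let vden e : 0 < 2 * a e - a e ^+ 2 * dt.
Proof.
have -> : 2 * a e - a e ^+ 2 * dt = a e * (2 - a e * dt) by ring.
by rewrite mulr_gt0//; have := adt e; lra.
Qed.

(** The variance obeys v -> p^2 v + dt. The lower end is the stationary variance of the continuous
    process, which this map does not decrease; the upper end is its fixed point, the stationary
    variance of the Euler chain. *)
Lemma eulerP_var e k :
  (2 * a e)^-1 <= \int[P]_w (eulerP e k w ^+ 2) <= (2 * a e - a e ^+ 2 * dt)^-1.
Proof.
have ae := a0 e; have V := vden e.
elim: k => [|k /andP[IH1 IH2]].
  rewrite (_ : \int[P]_w (eulerP e 0 w ^+ 2) = (2 * a e)^-1); last first.
    exact: (normal_variance (y0N e)).
  by rewrite lexx lef_pV2 ?posrE ?mulr_gt0//; have := mulr_ge0 (sqr_ge0 (a e)) (ltW dt0); lra.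
have := euler_step_sqr (FP k) (xiN k e) (fun f i j => @ind k e e f i j) (p e) (F_eulerP e k).
rewrite (@EE_eq _ _ _ P _ (fun w => eulerP e k.+1 w ^+ 2))// => ->.
move: (\int[P]_w (eulerP e k w ^+ 2)) IH1 IH2 => v v1 v2.
have e1 : p e ^+ 2 * (2 * a e - a e ^+ 2 * dt)^-1 + dt = (2 * a e - a e ^+ 2 * dt)^-1.
  by rewrite /p; field; rewrite gt_eqF.
have e2 : (2 * a e)^-1 <= p e ^+ 2 * (2 * a e)^-1 + dt.
  rewrite -subr_ge0 [leRHS](_ : _ = a e * dt ^+ 2 / 2); last by rewrite /p; field; rewrite gt_eqF.
  by rewrite !mulr_ge0 ?sqr_ge0// ltW.
apply/andP; split.
  by apply: (le_trans e2); rewrite lerD2r ler_wpM2l ?sqr_ge0.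
by rewrite -[leRHS]e1 lerD2r ler_wpM2l ?sqr_ge0.
Qed.

Lemma eulerP_var_le e k : \int[P]_w (eulerP e k w ^+ 2) <= (a e)^-1.
Proof.
have /andP[_ h] := eulerP_var e k; apply: (le_trans h).
rewrite lef_pV2 ?posrE//.
have -> : 2 * a e - a e ^+ 2 * dt = a e + a e * (1 - a e * dt) by ring.
by rewrite lerDl mulr_ge0 ?subr_ge0 ?adt// ltW.
Qed.

Let c2 := normal_cst 2 : R.
Let c20 : 0 <= c2. Proof. by rewrite mulr_ge0// mulr_ge0// expR_ge0. Qed.

Lemma eulerP_pow4 e k : \int[P]_w (eulerP e k w ^+ 4) <= (6 + c2) / a e ^+ 2.
Proof.
have ae := a0 e; have dtge := ltW dt0.
have dta : dt <= (a e)^-1 by rewrite -[leRHS]mul1r ler_pdivlMr// mulrC.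
have aV := invr_gt0 (a e); rewrite ae in aV.
elim: k => [|k IH].
  rewrite (@EE_eq _ _ _ P _ (fun w => y0 e w ^+ 4))//.
  have v0 : 0 < (2 * a e)^-1 by rewrite invr_gt0 mulr_gt0.
  have := normal_pow_le v0 (y0N e) 2 => h; apply: (le_trans h); rewrite -/c2.
  rewrite exprVn exprMn invfM mulrA ler_wpM2r ?invr_ge0 ?sqr_ge0//.
  by have := c20; lra.
have := euler_step_pow4 (FP k) (xiN k e) (fun f i j => @ind k e e f i j) (p e) (F_eulerP e k) (eulerP_mean e k).
rewrite (@EE_eq _ _ _ P _ (fun w => eulerP e k.+1 w ^+ 4))// => ->.
have V := eulerP_var_le e k.
have X4 := normal_pow_le dt0 (xiN k e) 2; rewrite -/c2 in X4.
have /andP[pe0 pe1] := p01 e.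
have y40 : 0 <= \int[P]_w (eulerP e k w ^+ 4).
  by apply: EE_ge0 => w; exact: (exprn_double_ge0 _ 2).
have y20 : 0 <= \int[P]_w (eulerP e k w ^+ 2) by apply: EE_ge0 => w; exact: sqr_ge0.
set q := \int[P]_w (eulerP e k w ^+ 4) in IH y40 *.
set v := \int[P]_w (eulerP e k w ^+ 2) in V y20 *.
set x4 := \int[P]_w (xi k e w ^+ 4) in X4 *.
set K := (6 + c2) / a e ^+ 2 in IH *.
have p2 : p e ^+ 2 <= 1 by rewrite expr_le1.
have h1 : p e ^+ 4 * q <= p e * K.
  apply: ler_pM => //; first exact: (exprn_double_ge0 _ 2).
  by rewrite (_ : p e ^+ 4 = p e * p e ^+ 3); [rewrite ler_piMr// expr_le1|ring].
have h2 : p e ^+ 2 * v <= 1 * (a e)^-1 by apply: ler_pM => //; exact: sqr_ge0.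
have h3 : p e ^+ 2 * v * dt <= 1 * (a e)^-1 * dt by rewrite ler_wpM2r.
have h4 : c2 * dt ^+ 2 <= c2 * ((a e)^-1 * dt).
  by rewrite ler_wpM2l// expr2 ler_wpM2r.
(* K is the value for which the loss a dt K in one contraction equals the bound on the noise added
   in that step. *)
have -> : K = p e * K + (6 * (1 * (a e)^-1 * dt) + c2 * ((a e)^-1 * dt)).
  by rewrite /K /p; field; rewrite gt_eqF.
lra.
Qed.

(** The increments are orthogonal and each contributes p^2 E Y^2 dt up to O(dt^2). At the end of the
    grid both bounds tend to T / (2a) with the mesh. *)
Lemma martP_var e k :
  k%:R * (p e ^+ 2 * (2 * a e)^-1 * dt - (c2 + 1) * dt ^+ 2) <=
  \int[P]_w (martP e k w ^+ 2) <=
  k%:R * ((2 * a e - a e ^+ 2 * dt)^-1 * dt + (c2 + 1) * dt ^+ 2).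
Proof.
elim: k => [|k /andP[IH1 IH2]].
  rewrite !mul0r (@EE_eq _ _ _ P _ (fun=> 0)) ?EE_cst ?lexx//.
  by move=> w; rewrite /martP /= expr0n.
have := mart_step_cross (FP k) (xiN k e) (xiN k e) (fun f i j => @ind k e e f i j) (p e) (p e)
  (F_eulerP e k) (F_eulerP e k) (F_martP e k) (F_martP e k)
  (eulerP_mean e k) (eulerP_mean e k).
have N4 := normal_mixed4 dt0 (xiN k e) (xiN k e).
rewrite (@EE_eq _ _ _ P _ (fun w => martP e k.+1 w ^+ 2)); last first.
  by move=> w; rewrite martP_step expr2.
rewrite (@EE_eq _ _ _ P (fun w => martP e k w * _) (fun w => martP e k w ^+ 2)); last first.
  by move=> w; rewrite expr2.
rewrite (@EE_eq _ _ _ P (fun w => eulerP e k w * _) (fun w => eulerP e k w ^+ 2)); last first.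
  by move=> w; rewrite expr2.
rewrite (@EE_eq _ _ _ P (fun w => xi k e w * _) (fun w => xi k e w ^+ 2)); last first.
  by move=> w; rewrite expr2.
rewrite (normal_variance (xiN k e)) => ->.
have /andP[V1 V2] := eulerP_var e k.
have p2 : p e ^+ 2 <= 1 by have /andP[pe0 pe1] := p01 e; rewrite expr_le1.
have p20 := sqr_ge0 (p e).
move: N4; rewrite -/c2 ler_norml => /andP[N1 N2].
move: (\int[P]_w (xi k e w ^+ 2 * xi k e w ^+ 2)) N1 N2 => x4 N1 N2.
move: (\int[P]_w (martP e k w ^+ 2)) IH1 IH2 => m IH1 IH2.
move: (\int[P]_w (eulerP e k w ^+ 2)) V1 V2 => v V1 V2.
have VV : 0 <= (2 * a e)^-1 by rewrite invr_ge0 mulr_ge0// ltW.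
have h1 : p e ^+ 2 * (2 * a e)^-1 * dt <= p e ^+ 2 * v * dt.
  by rewrite ler_pM2r// ler_wpM2l.
have h2 : p e ^+ 2 * v * dt <= (2 * a e - a e ^+ 2 * dt)^-1 * dt.
  rewrite ler_pM2r//; apply: (le_trans _ V2); rewrite ler_piMl//; exact: le_trans V1.
have D0 := mulr_ge0 c20 (sqr_ge0 dt); have d20 := sqr_ge0 dt.
rewrite -[k.+1%:R]natr1; apply/andP; split.
  by rewrite [leLHS]mulrDl mul1r; lra.
by rewrite [leRHS]mulrDl mul1r; lra.
Qed.

(** The increments of the two noises being uncorrelated, each step leaves only the mixed
    fourth-order term, of size dt^2. *)
Lemma martP_cross k :
  `|\int[P]_w (martP false k w * martP true k w)| <= k%:R * ((c2 + 1) * dt ^+ 2).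
Proof.
elim: k => [|k IH].
  rewrite !mul0r (@EE_eq _ _ _ P _ (fun=> 0)) ?EE_cst ?normr0//.
  by move=> w; rewrite /martP /= mulr0.
have := mart_step_cross (FP k) (xiN k false) (xiN k true) (fun f i j => @ind k false true f i j)
  (p false) (p true) (F_eulerP false k) (F_eulerP true k) (F_martP false k)
  (F_martP true k) (eulerP_mean false k) (eulerP_mean true k).
rewrite xi_orth mulr0 addr0.
rewrite (@EE_eq _ _ _ P _ (fun w => martP false k.+1 w * martP true k.+1 w))// => ->.
have := normal_mixed4 dt0 (xiN k false) (xiN k true); rewrite -/c2 => N.
apply: (le_trans (ler_normD _ _)); rewrite -[k.+1%:R]natr1 [leRHS]mulrDl mul1r; apply: lerD => //.
rewrite normrM ger0_norm; last by rewrite invr_ge0.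
by have := normr_ge0 (\int[P]_w (xi k false w ^+ 2 * xi k true w ^+ 2) - dt ^+ 2); lra.
Qed.

(** The constants of [mart_step_pow4] for b = 1/a and the fourth moment bound of [eulerP_pow4]; they
    do not depend on the mesh. *)
Definition mart_rate (b : R) : R := 8 + 2 * normal_cst 2 * b.
Definition mart_bound (b : R) : R := let K := (6 + normal_cst 2) * b ^+ 2 in
  8 * K + 2 * normal_cst 2 * b + 24 * K * normal_cst 2 + 12 * (normal_cst 4 + 1) * b ^+ 2.

(** Discrete Gronwall: with u = dt / Tm, the factor 1 + r u of each step is at most exp(r u). *)
Lemma martP_pow4 e Tm k : dt <= Tm ->
  \int[P]_w (martP e k w ^+ 4) <=
  k%:R * (dt * Tm * mart_bound (a e)^-1) * expR (mart_rate (a e)^-1 * (k%:R * dt / Tm)).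
Proof.
move=> dtT; have Tm0 : 0 < Tm by exact: lt_le_trans dtT.
have ae := a0 e.
have aV : 0 < (a e)^-1 by rewrite invr_gt0.
have dta : dt <= (a e)^-1 by rewrite -[leRHS]mul1r ler_pdivlMr// mulrC.
have c40 : 0 <= normal_cst 4 :> R by rewrite mulr_ge0// mulr_ge0// expR_ge0.
have r0 : 0 <= mart_rate (a e)^-1.
  by rewrite addr_ge0// !mulr_ge0// ltW.
have b0 : 0 <= mart_bound (a e)^-1.
  by rewrite /mart_bound /= !addr_ge0// !mulr_ge0 ?addr_ge0 ?exprn_ge0// ltW.
elim: k => [|k IH].
  rewrite !mul0r (@EE_eq _ _ _ P _ (fun=> 0)) ?EE_cst//.
  by move=> w; rewrite /martP /= expr0n.
have Y4 : \int[P]_w (eulerP e k w ^+ 4) <= (6 + c2) * (a e)^-1 ^+ 2.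
  by have := eulerP_pow4 e k; rewrite exprVn.
have := mart_step_pow4 (FP k) dt0 (xiN k e) (fun f i j => @ind k e e f i j) (p01 e)
  (F_eulerP e k) (F_martP e k) Tm0 dtT dta Y4.
rewrite (@EE_eq _ _ _ P _ (fun w => martP e k.+1 w ^+ 4))// => h.
apply: (le_trans h); rewrite -/(mart_rate _).
set r := mart_rate _ in r0 IH *; set B := mart_bound _ in b0 IH *.
rewrite -[X in _ + dt * Tm * X]/B.
set u := dt / Tm; have u0 : 0 < u by rewrite divr_gt0.
have kE : k.+1%:R * dt / Tm = u + k%:R * dt / Tm by rewrite -natr1 /u; ring.
rewrite kE [r * (u + _)]mulrDr expRD.
set E := expR (r * (k%:R * dt / Tm)) in IH *; set E1 := expR (r * u).
have dT0 : 0 <= dt * Tm * B by rewrite !mulr_ge0// ltW.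
have h1 : 1 + r * u <= E1 by exact: expR_ge1Dx.
have h2 : 1 <= E.
  by rewrite -[leLHS]expR0 ler_expR !mulr_ge0// ?invr_ge0 ltW.
have h3 : 1 <= E1 by apply: le_trans h1; rewrite lerDl mulr_ge0// ltW.
have m40 : 0 <= \int[P]_w (martP e k w ^+ 4).
  by apply: EE_ge0 => w; exact: (exprn_double_ge0 _ 2).
rewrite -[k.+1%:R]natr1 [X in _ <= X * _]mulrDl mul1r [leRHS]mulrDl; apply: lerD.
  rewrite [leRHS]mulrCA; apply: ler_pM => //.
  by apply: addr_ge0 => //; apply: mulr_ge0 => //; exact: ltW.
by rewrite ler_peMr// -[leLHS]mulr1; apply: ler_pM.
Qed.

End discrete_martingale.

(** * Eigenvalues of Q and rotated coordinates *)

Section rotated_coordinates.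
Context {R : realType}.
Implicit Types (e : bool) (v : 'cV[R]_2).

(** The boolean indexes the eigenpairs of Q: [false] is alpha + beta along (1, 1), [true] is alpha -
    beta along (1, -1). [lam] is the eigenvalue and [pr] the coordinate along the unit
    eigenvector. *)
Definition sg e : R := if e then -1 else 1.

Definition lam (theta : 'cV[R]_2) e : R := theta 0 0 + sg e * theta 1 0.

Definition pr e v : R := (Num.sqrt 2)^-1 * v 0 0 + (sg e * (Num.sqrt 2)^-1) * v 1 0.

Lemma sqrt2V_sqr : (Num.sqrt 2)^-1 ^+ 2 = 2^-1 :> R.
Proof. by rewrite exprVn sqr_sqrtr. Qed.

Lemma sg_sqr e : sg e ^+ 2 = 1.
Proof. by case: e; rewrite /sg ?sqrrN expr1n. Qed.

(** Positive definiteness is tested on the eigenvector (1, sg e). *)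
Lemma Theta_lam (theta : 'cV[R]_2) e : Theta theta -> 0 < lam theta e.
Proof.
move=> [_ /(_ (\col_i (if i == 0 then 1 else sg e)))].
have n0 : (\col_i (if i == 0 then 1 else sg e) : 'cV[R]_2) != 0.
  apply/eqP => /matrixP/(_ 0 0); rewrite !mxE /= => /eqP; by rewrite oner_eq0.
move=> /(_ n0); rewrite /quadform !(mxE, sum2E) /= => h.
suff : 0 < 2 * lam theta e by lra.
have s2 := sg_sqr e; move: h; rewrite /lam; move: (sg e) s2 => s s2 h.
have -> : 2 * (theta 0 0 + s * theta 1 0) =
  theta 0 0 + s ^+ 2 * theta 0 0 + 2 * s * theta 1 0 by rewrite s2; ring.
by apply: lt_le_trans h _; rewrite le_eqVlt; apply/orP; left; apply/eqP; ring.
Qed.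

Lemma lam_Theta (theta : 'cV[R]_2) : (forall e, 0 < lam theta e) -> Theta theta.
Proof.
move=> l0; have := l0 false; have := l0 true; rewrite /lam /sg => h1 h2.
split; first by apply/matrixP => i j; rewrite !mxE eq_sym.
move=> v v0; rewrite /quadform !(mxE, sum2E) /=.
rewrite (_ : _ + _ = 2^-1 * ((theta 0 0 + 1 * theta 1 0) * (v 0 0 + v 1 0) ^+ 2 +
   (theta 0 0 + -1 * theta 1 0) * (v 0 0 - v 1 0) ^+ 2)); last by field.
rewrite mulr_gt0//.
have [s0|s0] := eqVneq (v 0 0 + v 1 0) 0; have [d0|d0] := eqVneq (v 0 0 - v 1 0) 0.
- exfalso; move/eqP : v0; apply; apply: mx2P => j; rewrite ord1 mxE; lra.
- apply: ltr_wpDl; first by rewrite mulr_ge0 ?sqr_ge0// ltW.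
  by rewrite mulr_gt0// exprn_even_gt0.
- apply: ltr_pwDl; last by rewrite mulr_ge0 ?sqr_ge0// ltW.
  by rewrite mulr_gt0// exprn_even_gt0.
- apply: ltr_pwDl; last by rewrite mulr_ge0 ?sqr_ge0// ltW.
  by rewrite mulr_gt0// exprn_even_gt0.
Qed.

Lemma det_Q (theta : 'cV[R]_2) : \det (Q theta) = lam theta false * lam theta true.
Proof. by rewrite det2E !mxE /= /lam /sg; ring. Qed.

Lemma invmx_Q (theta : 'cV[R]_2) : Theta theta -> invmx (Q theta) =
  (lam theta false * lam theta true)^-1 *:
  \matrix_(i, j) (if i == j then theta 0 0 else - theta 1 0).
Proof.
move=> Th; have l0 := Theta_lam false Th; have l1 := Theta_lam true Th.
rewrite invmx2E; last by rewrite det_Q unitfE mulf_neq0 ?gt_eqF.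
rewrite det_Q; congr (_ *: _); apply: mx2P => j; elim/ord2P: j; by rewrite !mxE.
Qed.

End rotated_coordinates.

(** * Laws of the rotated coordinates *)

Section laws.
Context {d} {Omega : measurableType d} {R : realType}.
Variables (P : probability Omega R) (V : Omega -> 'cV[R]_2).
Hypothesis mV : measurable_fun setT (fun w => coords (V w)).

Lemma scalar_law_normal (s : R) e : 0 < s -> has_law P V (gaussian (s%:M)) ->
  centered_normal P s (fun w => pr e (V w)).
Proof.
move=> s0 PV.
have := gaussian_law_normal mV ((Num.sqrt 2)^-1) (sg e * (Num.sqrt 2)^-1) _ _ _ PV.
rewrite det2E !mxE /= !mulr1n !mulr0n mulr0 subr0 => /(_ erefl s0 (mulr_gt0 s0 s0)).
rewrite [X in centered_normal P X](_ : _ = s)//.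
by rewrite exprMn sg_sqr sqrt2V_sqr; field.
Qed.

(** Polarisation: the two rotated coordinates sum to sqrt 2 times the first coordinate, whose
    variance 2s is already the sum of their variances. *)
Lemma scalar_law_orth (s : R) : 0 < s -> has_law P V (gaussian (s%:M)) ->
  \int[P]_w (pr false (V w) * pr true (V w)) = 0.
Proof.
move=> s0 PV.
have N0 := scalar_law_normal false s0 PV; have N1 := scalar_law_normal true s0 PV.
have := gaussian_law_normal mV (Num.sqrt 2) 0 _ _ _ PV.
rewrite det2E !mxE /= !mulr1n !mulr0n mulr0 subr0 => /(_ erefl s0 (mulr_gt0 s0 s0)).
move=> N; have f0 := finmom_normal N0; have f1 := finmom_normal N1.
have f2 := finmom_normal N.
have := normal_variance N.
rewrite (@EE_expand _ _ _ P _ [:: fun w => pr false (V w) ^+ 2;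
   fun w => pr true (V w) ^+ 2; fun w => 2 * (pr false (V w) * pr true (V w))]).
- rewrite [LHS]/= (normal_variance N0) (normal_variance N1) EE_Z; last by finm.
  rewrite expr0n /= sqr_sqrtr//; lra.
- by do ![split; first by finm].
- move=> w /=; rewrite /pr /sg.
  have E : Num.sqrt 2 = 2 * (Num.sqrt 2)^-1 :> R.
    have q0 : Num.sqrt 2 != 0 :> R by rewrite gt_eqF// sqrtr_gt0.
    by apply: (mulIf q0); rewrite mulfVK// -expr2 sqr_sqrtr.
  transitivity ((2 * (Num.sqrt 2)^-1 * V w 0 0) ^+ 2); last by ring.
  by rewrite -E mul0r addr0.
Qed.

Lemma stationary_law_normal theta e : Theta theta ->
  has_law P V (mu_ theta) -> centered_normal P (2 * lam theta e)^-1 (fun w => pr e (V w)).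
Proof.
move=> Th PV.
have l0 := Theta_lam false Th; have l1 := Theta_lam true Th.
have a0 : 0 < theta 0 0 by move: l0 l1; rewrite /lam /sg; lra.
have D0 : 0 < lam theta false * lam theta true by rewrite mulr_gt0.
have := gaussian_law_normal mV ((Num.sqrt 2)^-1) (sg e * (Num.sqrt 2)^-1) _ _ _ PV.
rewrite det2E invmx_Q// !mxE /=.
set D := lam theta false * lam theta true in D0 *.
have DE : D = theta 0 0 ^+ 2 - theta 1 0 ^+ 2 by rewrite /D /lam /sg; ring.
have h1 : 0 < 2^-1 * (D^-1 * theta 0 0) by rewrite !mulr_gt0 ?invr_gt0.
have h2 : 0 < 2^-1 * (D^-1 * theta 0 0) * (2^-1 * (D^-1 * theta 0 0)) -
   2^-1 * (D^-1 * - theta 1 0) * (2^-1 * (D^-1 * - theta 1 0)).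
  rewrite [ltRHS](_ : _ = 4^-1 * D^-1); first by rewrite mulr_gt0 ?invr_gt0.
  have E : D^-1 = D^-1 * D^-1 * (theta 0 0 ^+ 2 - theta 1 0 ^+ 2).
    by rewrite -DE; field; rewrite gt_eqF.
  by rewrite [RHS](_ : _ = 4^-1 * (D^-1 * D^-1 * (theta 0 0 ^+ 2 - theta 1 0 ^+ 2)));
    [field; rewrite gt_eqF|rewrite -E].
move=> /(_ erefl h1 h2).
rewrite [X in centered_normal P X](_ : _ = (2 * lam theta e)^-1)//.
rewrite exprMn sg_sqr sqrt2V_sqr.
have E2 : (Num.sqrt 2)^-1 * (Num.sqrt 2)^-1 = 2^-1 :> R by rewrite -expr2 sqrt2V_sqr.
rewrite (_ : _ * (Num.sqrt 2)^-1 * _ = 2 * (2^-1 * (D^-1 * - theta 1 0)) * sg e *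
  ((Num.sqrt 2)^-1 * (Num.sqrt 2)^-1)); last by ring.
rewrite E2 /D; have := l0; have := l1; rewrite /lam.
by case: e; rewrite /sg => h3 h4; field; rewrite ?mulN1r ?mul1r; rewrite !gt_eqF//; lra.
Qed.

End laws.

(** * The filtration generated by the initial value and the grid increments *)

Section grid_filtration.
Context {d} {Omega : measurableType d} {R : realType}.
Variables (P : probability Omega R) (X0 : Omega -> 'cV[R]_2)
  (W : R -> Omega -> 'cV[R]_2) (t : nat -> R).
Hypothesis mX0 : measurable_fun setT (fun w => coords (X0 w)).
Hypothesis mW : forall i, measurable_fun setT (fun w => coords (W (t i) w)).
Hypothesis t0 : forall i, 0 <= t i.
Hypothesis t_le : {homo t : i j / (i <= j)%N >-> i <= j}.
Hypothesis Wincr : independent_increments P W.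
Hypothesis XW : independent_of_process P X0 W.

Notation dW i := (increment W (t i) (t i.+1)).

Definition initial_rect (A : set (R * R)) (B : nat -> set (R * R)) k : set Omega :=
  hits X0 A `&` \bigcap_(i < k) hits (dW i) (B i).

(** A pi-system generating the sigma-algebra of X_0 and of the first k increments. *)
Definition grid_rect k : set (set Omega) := [set E | exists A B,
  [/\ measurable A, forall i, measurable (B i) & E = initial_rect A B k]].

(** The analogue for the values of W, the form in which the independence of X_0 and W is given. *)
Definition path_rect k : set (set Omega) := [set E | exists B,
  (forall i, measurable (B i)) /\ E = \bigcap_(i < k) hits (W (t i)) (B i)].

Lemma measurable_hits (V : Omega -> 'cV[R]_2) (B : set (R * R)) :
  measurable_fun setT (fun w => coords (V w)) -> measurable B ->
  measurable (hits V B).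
Proof. by move=> mV mB; have := mV measurableT B mB; rewrite setTI. Qed.

Lemma coords_incr (U V : Omega -> 'cV[R]_2) w :
  coords (U w - V w) = ((coords (U w)).1 - (coords (V w)).1,
                        (coords (U w)).2 - (coords (V w)).2).
Proof. by rewrite /coords /= !mxE. Qed.

Lemma measurable_coordsB d' (T' : measurableType d') (U V : T' -> R * R) :
  measurable_fun setT U -> measurable_fun setT V ->
  measurable_fun setT (fun w => ((U w).1 - (V w).1, (U w).2 - (V w).2)).
Proof.
move=> mU mV.
have m1 : measurable_fun setT (fst : R * R -> R) by exact: measurable_fst.
have m2 : measurable_fun setT (snd : R * R -> R) by exact: measurable_snd.
apply: measurable_fun_pair; apply: measurable_funB.
- exact: (measurableT_comp m1 mU).
- exact: (measurableT_comp m1 mV).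
- exact: (measurableT_comp m2 mU).
- exact: (measurableT_comp m2 mV).
Qed.

Lemma measurable_incr i : measurable_fun setT (fun w => coords (dW i w)).
Proof.
rewrite (_ : (fun w => _) = fun w =>
  ((coords (W (t i.+1) w)).1 - (coords (W (t i) w)).1,
   (coords (W (t i.+1) w)).2 - (coords (W (t i) w)).2)).
  exact: measurable_coordsB.
by apply/funext => w; rewrite -coords_incr.
Qed.

Lemma bigcap_hits_setI k (V : nat -> Omega -> 'cV[R]_2) (B B' : nat -> set (R * R)) :
  \bigcap_(i < k) hits (V i) (B i) `&` \bigcap_(i < k) hits (V i) (B' i) =
  \bigcap_(i < k) hits (V i) (B i `&` B' i).
Proof.
by apply/seteqP; split => w /=; [move=> [h1 h2] i ik; split; [exact: h1|exact: h2]
  |move=> h; split => i ik; have [] := h i ik].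
Qed.

Lemma grid_rectI k : setI_closed (grid_rect k).
Proof.
move=> _ _ [A [B [mA mB ->]]] [A' [B' [mA' mB' ->]]].
exists (A `&` A'), (fun i => B i `&` B' i); split; first exact: measurableI.
  by move=> i; exact: measurableI.
by rewrite /initial_rect setIACA bigcap_hits_setI.
Qed.

Lemma path_rectI k : setI_closed (path_rect k).
Proof.
move=> _ _ [B [mB ->]] [B' [mB' ->]]; exists (fun i => B i `&` B' i).
by split; [move=> i; exact: measurableI|rewrite bigcap_hits_setI].
Qed.

Lemma grid_rect_measurable k : grid_rect k `<=` measurable.
Proof.
move=> _ [A [B [mA mB ->]]]; apply: measurableI; first exact: measurable_hits.
apply: bigcap_measurableType => // i _; apply: measurable_hits => //.
exact: measurable_incr.
Qed.

Lemma path_rect_measurable k : path_rect k `<=` measurable.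
Proof.
move=> _ [B [mB ->]]; apply: bigcap_measurableType => // i _; exact: measurable_hits.
Qed.

Lemma path_rect_coord k i : (i < k)%N ->
  measurable_fun setT
    ((fun w => coords (W (t i) w)) : g_sigma_algebraType (path_rect k) -> R * R).
Proof.
move=> ik _ B mB; rewrite setTI; apply: sub_sigma_algebra.
exists (fun j => if j == i then B else setT); split.
  by move=> j; case: ifP.
apply/seteqP; split => w /=.
  by move=> Bw j _; rewrite /hits /=; case: eqP => [->|].
by move=> /(_ i ik); rewrite /hits /= eqxx.
Qed.

(** The first k increments are functions of the first k + 1 values of W, so independence from X_0 is
    carried over from values to increments by Dynkin's argument. *)
Lemma initial_rectE A B k : measurable A -> (forall i, measurable (B i)) ->
  P (initial_rect A B k) =
  (P (hits X0 A) * P (\bigcap_(i < k) hits (dW i) (B i)))%E.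
Proof.
move=> mA mB.
have mC : measurable (hits X0 A) by exact: measurable_hits.
have sE : <<s path_rect k.+1 >> (\bigcap_(i < k) hits (dW i) (B i)).
  have : measurable (\bigcap_(i < k) hits (dW i) (B i) :
      set (g_sigma_algebraType (path_rect k.+1))); last by [].
  apply: bigcap_measurableType => // i /= ik.
  have m : measurable_fun setT ((fun w => coords (dW i w)) :
      g_sigma_algebraType (path_rect k.+1) -> R * R).
    rewrite (_ : (fun w => _) = fun w =>
      ((coords (W (t i.+1) w)).1 - (coords (W (t i) w)).1,
       (coords (W (t i.+1) w)).2 - (coords (W (t i) w)).2)).
      by apply: measurable_coordsB; apply: path_rect_coord; rewrite ltnS// ltnW.
    by apply/funext => w; rewrite -coords_incr.
  by have := m measurableT (B i) (mB i); rewrite setTI.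
have H : forall E, path_rect k.+1 E -> P (E `&` hits X0 A) = (P E * P (hits X0 A))%E.
  move=> _ [B' [mB' ->]]; rewrite setIC XW// muleC//.
have [_ ] := indep_g_sigma (@path_rectI k.+1) (@path_rect_measurable k.+1) mC H sE.
by rewrite /initial_rect setIC muleC.
Qed.

(** B is appended as the k-th constraint; then both sides factor completely by the independence of
    the increments. *)
Lemma grid_rect_indep k E B : grid_rect k E -> measurable B ->
  P (E `&` hits (dW k) B) = (P E * P (hits (dW k) B))%E.
Proof.
move=> [A [B' [mA mB' ->]]] mB.
pose B1 i := if i == k then B else B' i.
have mB1 i : measurable (B1 i) by rewrite /B1; case: ifP.
have B1k : B1 k = B by rewrite /B1 eqxx.
have EB : \bigcap_(i < k) hits (dW i) (B' i) = \bigcap_(i < k) hits (dW i) (B1 i).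
  apply: eq_bigcapr => i /= ik; congr hits.
  by rewrite /B1; case: eqP ik => // ->; rewrite ltnn.
have -> : initial_rect A B' k `&` hits (dW k) B = initial_rect A B1 k.+1.
  rewrite /initial_rect EB -setIA; congr (_ `&` _).
  rewrite -B1k; apply/seteqP; split => w /=.
    move=> [h1 h2] i /=; rewrite ltnS leq_eqVlt => /predU1P[->//|]; exact: h1.
  by move=> h; split; [move=> i /= ik; apply: h => /=; exact: ltnW|apply: h => /=].
have -> : initial_rect A B' k = initial_rect A B1 k by rewrite /initial_rect EB.
rewrite !initial_rectE// !Wincr// big_ord_recr /= B1k muleA.
by [].
Qed.

Lemma sub_grid_sigma k l E : (k <= l)%N -> <<s grid_rect k >> E -> <<s grid_rect l >> E.
Proof.
move=> kl; apply: smallest_sub; first exact: smallest_sigma_algebra.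
move=> {}E [A [B [mA mB ->]]].
apply: sub_sigma_algebra.
exists A, (fun i => if (i < k)%N then B i else setT); split => //.
  by move=> i; case: ifP.
rewrite /initial_rect; congr (_ `&` _); apply/seteqP; split => w /= h i /= ik.
  by case: ifP => // ik'; exact: h.
by have := h i (leq_trans ik kl); rewrite ik.
Qed.

Definition adapted k (f : Omega -> R) : Prop :=
  measurable_fun setT (f : g_sigma_algebraType (grid_rect k) -> R) /\ finmom P f.

Lemma adapted_subalgebra k : moment_subalgebra P (adapted k).
Proof.
split.
- by move=> c; split; [exact: measurable_cst|exact: finmom_cst].
- move=> f g [mf Ff] [mg Fg]; split; last exact: finmomD.
  exact: measurable_funD.
- move=> f g [mf Ff] [mg Fg]; split; last exact: finmomM.
  exact: measurable_funM.
- by move=> f [].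
Qed.

Lemma adaptedS k f : adapted k f -> adapted k.+1 f.
Proof.
move=> [mf Ff]; split => // _ Y mY; have := mf measurableT Y mY.
exact: (sub_grid_sigma (leqnSn k)).
Qed.

Lemma measurable_pr d' (T' : measurableType d') e (V : T' -> 'cV[R]_2) :
  measurable_fun setT (fun w => coords (V w)) ->
  measurable_fun setT (fun w => pr e (V w)).
Proof.
move=> mV.
have m1 : measurable_fun setT (fst : R * R -> R) by exact: measurable_fst.
have m2 : measurable_fun setT (snd : R * R -> R) by exact: measurable_snd.
have m : measurable_fun setT (fun z : R * R =>
    (Num.sqrt 2)^-1 * z.1 + (sg e * (Num.sqrt 2)^-1) * z.2).
  by apply: measurable_funD; exact: measurable_funM.
exact: (measurableT_comp m mV).
Qed.

Lemma adapted_initial e : finmom P (fun w => pr e (X0 w)) ->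
  adapted 0 (fun w => pr e (X0 w)).
Proof.
move=> Ff; split => //; apply: measurable_pr => _ B mB; rewrite setTI.
apply: sub_sigma_algebra; exists B, (fun=> setT); split => //.
by rewrite /initial_rect bigcap_mkord big_ord0 setIT.
Qed.

Lemma adapted_incr k e : finmom P (fun w => pr e (dW k w)) ->
  adapted k.+1 (fun w => pr e (dW k w)).
Proof.
move=> Ff; split => //; apply: measurable_pr => _ B mB; rewrite setTI.
apply: sub_sigma_algebra; exists setT, (fun i => if i == k then B else setT).
split => //; first by move=> i; case: ifP.
apply/seteqP; split => w /=.
  by move=> h; split => // i _; case: eqP => // ->.
by move=> [_ /(_ k (ltnSn k))]; rewrite /= eqxx.
Qed.

Lemma adapted_indep k e e' f i j :
  (forall e, finmom P (fun w => pr e (dW k w))) -> adapted k f ->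
  \int[P]_w (f w * (pr e (dW k w) ^+ i * pr e' (dW k w) ^+ j)) =
  \int[P]_w f w * \int[P]_w (pr e (dW k w) ^+ i * pr e' (dW k w) ^+ j).
Proof.
move=> fW [mf Ff].
pose q e (z : R * R) := (Num.sqrt 2)^-1 * z.1 + (sg e * (Num.sqrt 2)^-1) * z.2.
have mq e0 : measurable_fun setT (q e0).
  have m1 : measurable_fun setT (fst : R * R -> R) by exact: measurable_fst.
  have m2 : measurable_fun setT (snd : R * R -> R) by exact: measurable_snd.
  by apply: measurable_funD; exact: measurable_funM.
apply: (@indep_g_sigma_integral _ _ _ P (grid_rect k) _ (R * R)%type
  (fun w => coords (dW k w)) f (fun z => q e z ^+ i * q e' z ^+ j)) => //.
- exact: grid_rectI.
- exact: grid_rect_measurable.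
- exact: measurable_incr.
- by move=> A B GA mB; exact: grid_rect_indep.
- by apply: measurable_funM; apply: measurable_funX.
- have := fW e; have := fW e' => f2 f1.
  by apply: finmomM; exact: finmomX.
Qed.

End grid_filtration.

(** * The scalar equations along the eigenvectors *)

Section scalar_equation.
Context {d} {Omega : measurableType d} {R : realType}.
Notation mu := (@lebesgue_measure R).
Variables (P : probability Omega R) (theta : 'cV[R]_2) (X W : R -> Omega -> 'cV[R]_2).
Hypothesis cX : continuous_process X.
Hypothesis XWP : OU_solution P theta X W.

Lemma prB e (u v : 'cV[R]_2) : pr e (u - v) = pr e u - pr e v.
Proof. by rewrite /pr !mxE; ring. Qed.

Lemma prD e (u v : 'cV[R]_2) : pr e (u + v) = pr e u + pr e v.
Proof. by rewrite /pr !mxE; ring. Qed.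

Lemma pr_Q e (v : 'cV[R]_2) : pr e (Q theta *m v) = lam theta e * pr e v.
Proof.
rewrite /pr /lam !mxE !sum2E !mxE /=.
have := sg_sqr (R := R) e; move: (sg e) ((Num.sqrt 2)^-1) => s q s2.
rewrite (_ : (_ + _) * (_ + _) = q * (theta 0 0 * v 0 0 + s ^+ 2 * theta 1 0 * v 1 0 +
  s * (theta 1 0 * v 0 0 + theta 0 0 * v 1 0))); last by ring.
by rewrite s2; ring.
Qed.

Lemma continuous_coord w (i : 'I_2) (T : R) :
  {within `[0, T], continuous (fun t => X t w i 0)}.
Proof.
have [_ /(_ w) c] := cX.
have c1 : {within `[0, T], continuous (fun t => X t w)}.
  apply: continuous_subspaceW c => x /=.
  by rewrite !in_itv /= andbT => /andP[].
apply/subspace_continuousP => x xT; move/subspace_continuousP : c1 => c1.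
exact: (cvg_comp _ _ (c1 x xT) (@coord_continuous R 2 1 i 0 (X x w))).
Qed.

Lemma continuous_lincomb (T c0 c1 : R) (f g : R -> R) :
  {within `[0, T], continuous f} -> {within `[0, T], continuous g} ->
  {within `[0, T], continuous (fun t => c0 * f t + c1 * g t)}.
Proof.
move=> /subspace_continuousP cf /subspace_continuousP cg.
apply/subspace_continuousP => x xT.
by apply: cvgD; apply: cvgMl_tmp; [exact: cf|exact: cg].
Qed.

Lemma continuous_pr e w (T : R) :
  {within `[0, T], continuous (fun t => pr e (X t w))}.
Proof. by apply: continuous_lincomb; exact: continuous_coord. Qed.

Lemma continuous_sqr (T : R) (f : R -> R) : {within `[0, T], continuous f} ->
  {within `[0, T], continuous (fun t => f t ^+ 2)}.
Proof.
move=> /subspace_continuousP cf; apply/subspace_continuousP => x xT.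
exact: (cvg_comp _ _ (cf x xT) (@exprn_continuous R 2 (f x))).
Qed.

Lemma Rintegral_lincomb (T c0 c1 : R) (f g : R -> R) :
  {within `[0, T], continuous f} -> {within `[0, T], continuous g} ->
  \int[mu]_(t in `[0, T]) (c0 * f t + c1 * g t) =
  c0 * \int[mu]_(t in `[0, T]) f t + c1 * \int[mu]_(t in `[0, T]) g t.
Proof.
move=> cf cg.
have iF := integrable_itv cf (lexx 0) (lexx T).
have iG := integrable_itv cg (lexx 0) (lexx T).
have mI : measurable (`[0, T]%classic : set (measurableTypeR R)).
  exact: measurable_itv.
have i1 : mu.-integrable `[0, T] (EFin \o (fun t => c0 * f t)).
  by have := integrableZl mI c0 iF.
have i2 : mu.-integrable `[0, T] (EFin \o (fun t => c1 * g t)).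
  by have := integrableZl mI c1 iG.
by rewrite (RintegralD _ i1 i2)// !RintegralZl.
Qed.

(** Projecting on an eigenvector decouples the system; one null set serves both coordinates and all
    times. *)
Lemma scalar_OU : {ae P, forall w, forall e t, 0 <= t ->
  pr e (X t w) = pr e (X 0 w)
    - lam theta e * \int[mu]_(s in `[0, t]) pr e (X s w) + pr e (W t w)}.
Proof.
apply: filterS XWP => w H e t t0.
rewrite {1}(H t t0) prD prB; congr (_ - _ + _).
have cc (i : 'I_2) : {within `[0, t], continuous (fun t => X t w i 0)}.
  exact: continuous_coord.
rewrite {1}/pr /mxintegral !mxE.
pose q0 (i : 'I_2) := Q theta i 0; pose q1 (i : 'I_2) := Q theta i 1.
have E i : \int[mu]_(s in `[0, t]) (Q theta *m X s w) i 0 =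
    q0 i * \int[mu]_(s in `[0, t]) X s w 0 0 + q1 i * \int[mu]_(s in `[0, t]) X s w 1 0.
  rewrite -Rintegral_lincomb//; apply: eq_Rintegral => s _.
  by rewrite !mxE sum2E.
rewrite !E Rintegral_lincomb// /q0 /q1 !mxE /= /lam.
have := sg_sqr (R := R) e; move: (sg e) ((Num.sqrt 2)^-1) => s q s2.
set I0 := \int[mu]_(_ in _) X _ w 0 0; set I1 := \int[mu]_(_ in _) X _ w 1 0.
rewrite (_ : (_ + _) * (_ + _) = q * (theta 0 0 * I0 + s ^+ 2 * theta 1 0 * I1 +
  s * (theta 1 0 * I0 + theta 0 0 * I1))); last by ring.
by rewrite s2; ring.
Qed.

End scalar_equation.

(** With u = x / (n + 1) < 1, 1 - u lies between exp(-u / (1 - u)) and exp(-u); raise to the power n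
    + 1. *)
Lemma expR_power_cvg {R : realType} (x : R) : 0 <= x ->
  (1 - x / n.+1%:R) ^+ n.+1 @[n --> \oo] --> expR (- x).
Proof.
move=> x0.
have cu : x / n.+1%:R @[n --> \oo] --> (0 : R).
  by rewrite -[X in _ --> X](mulr0 x); apply: cvgMl_tmp; exact: cvg_harmonic.
apply: (@squeeze_cvgr _ _ _ _ (fun n => expR (- x * (1 - x / n.+1%:R)^-1))
   (fun=> expR (- x))).
- have /cvgrPdist_lt/(_ _ ltr01) := cu; apply: filterS => n.
  have u0 : 0 <= x / n.+1%:R by rewrite divr_ge0.
  rewrite sub0r normrN ger0_norm// => u1.
  have p0 : 0 < 1 - x / n.+1%:R by rewrite subr_gt0.
  have nx : n.+1%:R * (x / n.+1%:R) = x by rewrite mulrCA divff ?mulr1// pnatr_eq0.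
  apply/andP; split.
    rewrite (_ : - x * (1 - x / n.+1%:R)^-1 = n.+1%:R *
      - (x / n.+1%:R / (1 - x / n.+1%:R))); last by rewrite mulrN mulrA nx mulNr.
    rewrite expRM_natl; apply: lerXn2r; rewrite ?nnegrE ?expR_ge0 ?(ltW p0)//.
    rewrite expRN -[leRHS]invrK lef_pV2 ?posrE ?invr_gt0 ?expR_gt0//.
    apply: le_trans (expR_ge1Dx _).
    rewrite le_eqVlt; apply/orP; left; apply/eqP.
    by move: p0; set u := x / _ => p0; field; rewrite gt_eqF.
  have -> : - x = n.+1%:R * - (x / n.+1%:R) by rewrite mulrN nx.
  rewrite expRM_natl; apply: lerXn2r; rewrite ?nnegrE ?expR_ge0 ?(ltW p0)//.
  exact: expR_ge1Dx.
- rewrite -[X in _ --> expR X](_ : - x * (1 - 0)^-1 = - x); last by rewrite subr0 invr1 mulr1.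
  apply: continuous_cvg; first exact: continuous_expR.
  apply: cvgMl_tmp; apply: cvgV; first by rewrite subr0 oner_neq0.
  by apply: cvgB => //; exact: cvg_cst.
- exact: cvg_cst.
Qed.

(** * From the grid to continuous time at a fixed horizon *)

Section stationary_process.
Context {d} {Omega : measurableType d} {R : realType}.
Notation mu := (@lebesgue_measure R).
Variables (P : probability Omega R) (theta : 'cV[R]_2) (X W : R -> Omega -> 'cV[R]_2).
Hypothesis Th : Theta theta.
Hypothesis cX : continuous_process X.
Hypothesis WP : standard_wiener P W.
Hypothesis XWind : independent_of_process P (X 0) W.
Hypothesis XWP : OU_solution P theta X W.
Hypothesis Xlaw : forall t, 0 <= t -> has_law P (X t) (mu_ theta).

Let a e : R := lam theta e.
Let a0 e : 0 < a e. Proof. exact: Theta_lam. Qed.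

Lemma marginal_normal e t : 0 <= t ->
  centered_normal P (2 * a e)^-1 (fun w => pr e (X t w)).
Proof.
move=> t0; apply: stationary_law_normal => //; last exact: Xlaw.
by have [mX _] := cX; exact: mX.
Qed.

Lemma marginal_finmom e t : 0 <= t -> finmom P (fun w => pr e (X t w)).
Proof. by move=> t0; exact: finmom_normal (marginal_normal e t0). Qed.

(** By Ito's formula this is the stochastic integral of y against its Wiener process over [0, T];
    taken as a definition, it is a function of the path. *)
Definition stoch_integral e T w : R :=
  2^-1 * (pr e (X T w) ^+ 2 - pr e (X 0 w) ^+ 2 - T) +
  a e * \int[mu]_(s in `[0, T]) (pr e (X s w) ^+ 2).

Section fixed_horizon.
Variable T : R.
Hypothesis T0 : 0 < T.

Let t n k : R := grid T n k.
Let dt n : R := T / n.+1%:R.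
Let dW n k w := increment W (t n k) (t n k.+1) w.
Let xi n k e w : R := pr e (dW n k w).
Let M n e := martP a (dt n) (fun e w => pr e (X 0 w)) (xi n) e n.+1.
Let Y n e := eulerP a (dt n) (fun e w => pr e (X 0 w)) (xi n) e n.+1.

Let dt_gt0 n : 0 < dt n. Proof. by rewrite divr_gt0// ltr0n. Qed.

Let t_ge0 n k : 0 <= t n k. Proof. exact: (grid_ge0 T0). Qed.

Let t_homo n : {homo t n : i j / (i <= j)%N >-> i <= j}.
Proof. by move=> i j ij; exact: (grid_le T0 n ij). Qed.

Let mW n i : measurable_fun setT (fun w => coords (W (t n i) w)).
Proof. by have [[mW _] _ _ _] := WP; exact: mW. Qed.

Let mX0 : measurable_fun setT (fun w => coords (X 0 w)).
Proof. by have [mX _] := cX; exact: mX. Qed.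

Let Wincr : independent_increments P W.
Proof. by have [_ _ ? _] := WP. Qed.

Let dW_law n k : has_law P (dW n k) (gaussian (dt n)%:M).
Proof.
have [_ _ _ H] := WP; rewrite /dt -(grid_step T n k); apply: H => //.
by rewrite -subr_gt0 /t grid_step; exact: dt_gt0.
Qed.

Let mdW n k : measurable_fun setT (fun w => coords (dW n k w)).
Proof. exact: (measurable_incr (t := t n) (mW n)). Qed.

Let xiN n k e : centered_normal P (dt n) (xi n k e).
Proof. exact: scalar_law_normal. Qed.

Let F n := adapted P (X 0) W (t n).

Let FP n k : moment_subalgebra P (F n k).
Proof. exact: adapted_subalgebra. Qed.

Let FS n k f : F n k f -> F n k.+1 f.
Proof. exact: adaptedS. Qed.

Let Fy0 n e : F n 0 (fun w => pr e (X 0 w)).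
Proof. by apply: adapted_initial => //; exact: marginal_finmom. Qed.

Let Fxi n k e : F n k.+1 (xi n k e).
Proof. by apply: adapted_incr; exact: finmom_normal (xiN n k e). Qed.

Let ind n k e e' f i j : F n k f ->
  \int[P]_w (f w * (xi n k e w ^+ i * xi n k e' w ^+ j)) =
  \int[P]_w f w * \int[P]_w (xi n k e w ^+ i * xi n k e' w ^+ j).
Proof.
move=> Ff; apply: (adapted_indep (X0 := X 0) (t := t n)) => //.
by move=> e0; exact: finmom_normal (xiN n k e0).
Qed.

Let xi_orth n k : \int[P]_w (xi n k false w * xi n k true w) = 0.
Proof. exact: scalar_law_orth (dW_law n k). Qed.

Let y0N e : centered_normal P (2 * a e)^-1 (fun w => pr e (X 0 w)).
Proof. exact: marginal_normal. Qed.

Let fM n e : finmom P (M n e).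
Proof. by have [_ _ _] := FP n n.+1; apply; exact: (F_martP _ _ (FP n) (@FS n) (Fy0 n) (Fxi n)). Qed.

Let fY n e : finmom P (Y n e).
Proof. by have [_ _ _] := FP n n.+1; apply; exact: (F_eulerP _ _ (FP n) (@FS n) (Fy0 n) (Fxi n)). Qed.

Let fine_grid : \forall n \near \oo, forall e, a e * dt n <= 1.
Proof.
near=> n => e; case: e; near: n.
  exact: euler_step_small.
exact: euler_step_small.
Unshelve. all: by end_near. Qed.

Let grid_incrE n e w : (fun k => xi n k e w) = grid_incr T (fun s => pr e (W s w)) n.
Proof. by apply/funext => k; rewrite /xi /dW /increment prB. Qed.

Let M_cvg : {ae P, forall w e, M n e w @[n --> \oo] --> stoch_integral e T w}.
Proof.
apply: filterS (scalar_OU cX XWP) => w H e.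
have yE (s : R) : 0 <= s <= T -> pr e (X s w) =
    pr e (X 0 w) - a e * \int[mu]_(s in `[0, s]) pr e (X s w) + pr e (W s w).
  by move=> /andP[s0 _]; exact: H.
have := @euler_mart_cvg R (a e) T (fun s => pr e (X s w)) (fun s => pr e (W s w))
  (a0 e) T0 (@continuous_pr _ _ _ X cX e w T) yE.
rewrite (_ : (fun n => euler_mart _ _ _ _ _) = (fun n => M n e w)) //.
by apply/funext => n; rewrite -grid_incrE.
Qed.

Let Y_cvg : {ae P, forall w e, Y n e w @[n --> \oo] --> pr e (X T w)}.
Proof.
apply: filterS (scalar_OU cX XWP) => w H e.
have yE (s : R) : 0 <= s <= T -> pr e (X s w) =
    pr e (X 0 w) - a e * \int[mu]_(s in `[0, s]) pr e (X s w) + pr e (W s w).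
  by move=> /andP[s0 _]; exact: H.
have := @euler_cvg R (a e) T (fun s => pr e (X s w)) (fun s => pr e (W s w))
  (a0 e) T0 (@continuous_pr _ _ _ X cX e w T) yE.
rewrite (_ : (fun n => euler _ _ _ _) = (fun n => Y n e w)) //.
by apply/funext => n; rewrite -grid_incrE.
Qed.

Lemma measurable_pr_X e s : 0 <= s -> measurable_fun setT (fun w => pr e (X s w)).
Proof. by move=> s0; have [] := marginal_normal e s0. Qed.

(** The path integral is measurable in the sample point as a pointwise limit of Riemann sums. *)
Lemma measurable_energy e :
  measurable_fun setT (fun w => \int[mu]_(s in `[0, T]) (pr e (X s w) ^+ 2)).
Proof.
apply: (measurable_fun_cvg (h := fun n w =>
   \sum_(i < n.+1) (T / n.+1%:R * pr e (X (grid T n i) w) ^+ 2))).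
  move=> n; apply: measurable_sum => i; apply: measurable_funM => //.
  by apply: measurable_funX; apply: measurable_pr_X; exact: grid_ge0.
move=> w _; apply: (@riemann_sum_cvg R T T0 (fun s => pr e (X s w) ^+ 2)).
by apply: continuous_sqr; exact: continuous_pr.
Qed.

Lemma measurable_stoch_integral e : measurable_fun setT (stoch_integral e T).
Proof.
apply: measurable_funD; apply: measurable_funM => //; last exact: measurable_energy.
apply: measurable_funB => //.
by apply: measurable_funB; apply: measurable_funX; apply: measurable_pr_X => //; exact: ltW.
Qed.

Definition stoch_const e : R := mart_bound (a e)^-1 * expR (mart_rate (a e)^-1).

Let M_pow4 e : \forall n \near \oo,
  \int[P]_w (M n e w ^+ 4) <= stoch_const e * T ^+ 2.
Proof.
apply: filterS fine_grid => n adt.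
have dtT : dt n <= T by rewrite ler_pdivrMr ?ltr0n// ler_peMr ?ler1n// ltW.
have := martP_pow4 a0 (dt_gt0 n) adt (FP n) (@FS n) (Fy0 n) (Fxi n) y0N (xiN n)
  (@ind n) e n.+1 dtT.
have E : n.+1%:R * dt n = T by rewrite /dt mulrCA divff ?mulr1// pnatr_eq0.
rewrite E divff ?gt_eqF// mulr1 (_ : n.+1%:R * (_ * _ * _) =
  n.+1%:R * dt n * T * mart_bound (a e)^-1); last by ring.
by rewrite E => h; apply: (le_trans h); rewrite /stoch_const; lra.
Qed.

Lemma dt_cvg0 : dt n @[n --> \oo] --> 0.
Proof.
rewrite -[X in _ --> X](mulr0 T); apply: cvgMl_tmp; exact: cvg_harmonic.
Qed.

Let M_var e : \int[P]_w (M n e w ^+ 2) @[n --> \oo] --> T / (2 * a e).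
Proof.
have cd := dt_cvg0.
have ae := a0 e.
pose l n := T * ((1 - a e * dt n) ^+ 2 * (2 * a e)^-1 - (normal_cst 2 + 1) * dt n).
pose u n := T * ((2 * a e - a e ^+ 2 * dt n)^-1 + (normal_cst 2 + 1) * dt n).
apply: (@squeeze_cvgr _ _ _ _ l u).
- apply: filterS fine_grid => n adt.
  have := martP_var a0 (dt_gt0 n) adt (FP n) (@FS n) (Fy0 n) (Fxi n) y0N (xiN n)
    (@ind n) e n.+1.
  have E : n.+1%:R * dt n = T by rewrite /dt mulrCA divff ?mulr1// pnatr_eq0.
  rewrite /l /u -E.
  rewrite (_ : n.+1%:R * (_ * _ * _ - _) = n.+1%:R * dt n *
    ((1 - a e * dt n) ^+ 2 * (2 * a e)^-1 - (normal_cst 2 + 1) * dt n)); last by ring.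
  rewrite (_ : n.+1%:R * (_ * _ + _) = n.+1%:R * dt n *
    ((2 * a e - a e ^+ 2 * dt n)^-1 + (normal_cst 2 + 1) * dt n)); last by ring.
  by [].
- rewrite /l (_ : T / (2 * a e) = T * ((1 - a e * 0) ^+ 2 * (2 * a e)^-1 - (normal_cst 2 + 1) * 0));
    last by ring.
  apply: cvgMl_tmp; apply: cvgB; last exact: cvgMl_tmp.
  apply: cvgMr_tmp.
  apply: (cvg_comp (fun n => 1 - a e * dt n) (fun x => x ^+ 2)); last exact: exprn_continuous.
  by apply: cvgB; [exact: cvg_cst|exact: cvgMl_tmp].
- rewrite /u (_ : T / (2 * a e) = T * ((2 * a e - a e ^+ 2 * 0)^-1 + (normal_cst 2 + 1) * 0));
    last by rewrite !mulr0 subr0 addr0.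
  apply: cvgMl_tmp; apply: cvgD; last exact: cvgMl_tmp.
  apply: cvgV; first by rewrite mulr0 subr0 gt_eqF// mulr_gt0.
  by apply: cvgB; [exact: cvg_cst|exact: cvgMl_tmp].
Qed.

Let M_cross : \int[P]_w (M n false w * M n true w) @[n --> \oo] --> 0.
Proof.
have cd := dt_cvg0.
apply: norm_cvg0.
apply: (@squeeze_cvgr _ _ _ _ (fun=> 0) (fun n => T * ((normal_cst 2 + 1) * dt n))).
- apply: filterS fine_grid => n adt.
  have := martP_cross (dt_gt0 n) (FP n) (@FS n) (Fy0 n) (Fxi n) y0N (xiN n)
    (@xi_orth n) (@ind n) n.+1.
  have E : n.+1%:R * dt n = T by rewrite /dt mulrCA divff ?mulr1// pnatr_eq0.
  rewrite (_ : n.+1%:R * (_ * _) = n.+1%:R * dt n * ((normal_cst 2 + 1) * dt n)); last by ring.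
  by rewrite E normr_ge0 => ->.
- exact: cvg_cst.
- rewrite -[X in _ --> X](mulr0 T); apply: cvgMl_tmp.
  by rewrite -[X in _ --> X](mulr0 (normal_cst 2 + 1)); apply: cvgMl_tmp.
Qed.

Let sqr_pow4 e : \forall n \near \oo,
  \int[P]_w ((M n e w ^+ 2) ^+ 2) <= stoch_const e * T ^+ 2.
Proof.
apply: filterS (M_pow4 e) => n; apply: le_trans.
by rewrite le_eqVlt; apply/orP; left; apply/eqP; apply: EE_eq => w; rewrite -exprM.
Qed.

Let sqr_cvg e : {ae P, forall w, M n e w ^+ 2 @[n --> \oo] --> stoch_integral e T w ^+ 2}.
Proof.
apply: filterS M_cvg => w H.
exact: (cvg_comp _ _ (H e) (@exprn_continuous R 2 _)).
Qed.

Let msqr e : measurable_fun setT (fun w => stoch_integral e T w ^+ 2).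
Proof. by apply: measurable_funX; exact: measurable_stoch_integral. Qed.

(** Fatou's lemma for the squares of the discrete martingale, whose second moments are its fourth
    moments. *)
Lemma stoch_integral_pow4 e : P.-integrable setT (EFin \o (fun w => stoch_integral e T w ^+ 4))
  /\ \int[P]_w (stoch_integral e T w ^+ 4) <= stoch_const e * T ^+ 2.
Proof.
have fM2 n := finmomX 2 (fM n e).
have i1 := second_moment_integrable_sqr fM2 (msqr e) (sqr_pow4 e) (sqr_cvg e).
have := second_moment_le fM2 (msqr e) (sqr_pow4 e) (sqr_cvg e).
have E : (fun w => (stoch_integral e T w ^+ 2) ^+ 2) = (fun w => stoch_integral e T w ^+ 4).
  by apply/funext => w; rewrite -exprM.
rewrite E in i1.
move=> h; split => //; rewrite -lee_fin -EE_finE//; apply: le_trans h.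
by rewrite le_eqVlt; apply/orP; left; apply/eqP; apply: eq_integral => w _; rewrite -exprM.
Qed.

(** The fourth moment bound makes the second moments converge; their limit is known from the
    grid. *)
Lemma stoch_integral_var e :
  P.-integrable setT (EFin \o (fun w => stoch_integral e T w ^+ 2)) /\
  \int[P]_w (stoch_integral e T w ^+ 2) = T / (2 * a e).
Proof.
have fM2 n := finmomX 2 (fM n e).
split; first exact: second_moment_integrable fM2 (msqr e) (sqr_pow4 e) (sqr_cvg e).
have L := second_moment_cvg fM2 (msqr e) (sqr_pow4 e) (sqr_cvg e).
by rewrite -(cvg_lim (@Rhausdorff R) L); exact: (cvg_lim (@Rhausdorff R) (@M_var e)).
Qed.

(** The product of the two discrete martingales has second moments bounded by their fourth moments,
    so its expectation passes to the limit 0. *)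
Lemma stoch_integral_orth :
  P.-integrable setT (EFin \o (fun w => stoch_integral false T w * stoch_integral true T w)) /\
  \int[P]_w (stoch_integral false T w * stoch_integral true T w) = 0.
Proof.
pose g_ n w := M n false w * M n true w.
have fg n : finmom P (g_ n) by apply: finmomM; exact: fM.
have mg : measurable_fun setT (fun w => stoch_integral false T w * stoch_integral true T w).
  by apply: measurable_funM; exact: measurable_stoch_integral.
have gK : \forall n \near \oo, \int[P]_w (g_ n w ^+ 2) <=
    2^-1 * (stoch_const false * T ^+ 2 + stoch_const true * T ^+ 2).
  near=> n.
  have h0 : \int[P]_w (M n false w ^+ 4) <= stoch_const false * T ^+ 2.
    by near: n; exact: M_pow4.
  have h1 : \int[P]_w (M n true w ^+ 4) <= stoch_const true * T ^+ 2.
    by near: n; exact: M_pow4.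
  have f0 := finmomX 4 (fM n false); have f1 := finmomX 4 (fM n true).
  apply: (@le_trans _ _ (\int[P]_w (2^-1 * (M n false w ^+ 4 + M n true w ^+ 4)))).
    apply: EE_le; [exact: finmomX|exact: (finmomZ _ (finmomD f0 f1))|move=> w].
    by rewrite /g_; have := sqr_ge0 (M n false w ^+ 2 - M n true w ^+ 2); lra.
  by rewrite (EE_Z _ (finmomD f0 f1)) (EE_D f0 f1); lra.
have gc : {ae P, forall w, g_ n w @[n --> \oo] -->
    stoch_integral false T w * stoch_integral true T w}.
  by apply: filterS M_cvg => w H; apply: cvgM; exact: H.
split; first exact: second_moment_integrable fg mg gK gc.
have L := second_moment_cvg fg mg gK gc.
by rewrite -(cvg_lim (@Rhausdorff R) L); exact: (cvg_lim (@Rhausdorff R) M_cross).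
Unshelve. all: by end_near. Qed.

(* The Euler scheme started at [X 0] has conditional mean p^n X_0, p = 1 - a T / n. *)
Lemma initial_regression e (A : set (R * R)) : measurable A ->
  \int[P]_(w in hits (X 0) A) pr e (X T w) =
  expR (- a e * T) * \int[P]_(w in hits (X 0) A) pr e (X 0 w).
Proof.
move=> mA.
have mhA : measurable (hits (X 0) A) by exact: measurable_hits.
pose I w : R := \1_(hits (X 0) A) w.
have fI : finmom P I by exact: finmom_indic.
have adI n : adapted P (X 0) W (t n) 0 I.
  split => //; apply: measurable_indic; apply: sub_sigma_algebra.
  by exists A, (fun=> setT); split => //; rewrite /initial_rect bigcap_mkord big_ord0 setIT.
have adIk n k : F n k I by elim: k => [|k IH]; [exact: adI|exact: FS].
have EI f : \int[P]_(w in hits (X 0) A) f w = \int[P]_w (I w * f w).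
  rewrite Rintegral_mkcond; apply: eq_Rintegral => w _.
  by rewrite patchE /I indicE; case: (_ \in _); rewrite ?mul1r ?mul0r.
rewrite !EI.
have step n k : \int[P]_w (I w * eulerP a (dt n) (fun e w => pr e (X 0 w)) (xi n) e k w) =
    (1 - a e * dt n) ^+ k * \int[P]_w (I w * pr e (X 0 w)).
  elim: k => [|k IH]; first by rewrite expr0 mul1r.
  have [Fc FD FM Ff] := FP n k.
  have FYk := F_eulerP a (dt n) (FP n) (@FS n) (Fy0 n) (Fxi n) e k.
  set Yk := eulerP a (dt n) _ (xi n) e k in IH FYk *.
  have fYk := Ff _ FYk; have fx := finmom_normal (xiN n k e).
  pose p : R := 1 - a e * dt n.
  rewrite (@EE_expand _ _ _ P _ [:: fun w => p * (I w * Yk w); fun w => I w * xi n k e w]).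
  - rewrite [LHS]/= EE_Z; last by finm.
    rewrite IH (EE_incr1 (xiN n k e) (fun f i j => @ind n k e e f i j)) ?addr0; last exact: adIk.
    by rewrite -/p exprS; ring.
  - by do ![split; first by finm].
  - move=> w; rewrite /= eulerP_step -/Yk -/p; ring.
have Ycv : {ae P, forall w, I w * Y n e w @[n --> \oo] --> I w * pr e (X T w)}.
  by apply: filterS Y_cvg => w H; apply: cvgMl_tmp; exact: H.
have YK : \forall n \near \oo, \int[P]_w ((I w * Y n e w) ^+ 2) <= (a e)^-1.
  apply: filterS fine_grid => n adt.
  have := eulerP_var_le a0 (dt_gt0 n) adt (FP n) (@FS n) (Fy0 n) (Fxi n) y0N (xiN n)
    (@ind n) e n.+1.
  apply: le_trans; apply: EE_le; [exact: (finmomX 2 (finmomM fI (fY n e)))|exact: (finmomX 2 (fY n e))|move=> w].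
  rewrite exprMn ler_piMl ?sqr_ge0//.
  by rewrite /I indicE; case: (_ \in _); rewrite ?mulr1n ?mulr0n ?expr1n ?expr0n ?ler01.
have mIX : measurable_fun setT (fun w => I w * pr e (X T w)).
  apply: measurable_funM; first by case: fI.
  by apply: measurable_pr_X; exact: ltW.
have L := second_moment_cvg (fun n => finmomM fI (fY n e)) mIX YK Ycv.
rewrite (_ : (fun n => \int[P]_w (I w * Y n e w)) = (fun n =>
  (1 - a e * dt n) ^+ n.+1 * \int[P]_w (I w * pr e (X 0 w)))) in L; last first.
  by apply/funext => n; exact: step.
have L2 : (1 - a e * dt n) ^+ n.+1 @[n --> \oo] --> expR (- a e * T).
  have xT : 0 <= a e * T by rewrite mulr_ge0// ltW.
  have := expR_power_cvg xT; rewrite mulNr.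
  by under eq_fun do rewrite -mulrA.
rewrite -(cvg_lim (@Rhausdorff R) L); apply: (cvg_lim (@Rhausdorff R)).
exact: cvgMr_tmp.
Qed.

End fixed_horizon.
End stationary_process.

(** * Elementary inequalities and domination *)

Section scalar_inequalities.
Context {R : realType}.
Implicit Types q z m x y : R.

Lemma norm_mul_le q z m : 0 < q -> `|z * m| <= 2^-1 * (q * z ^+ 2 + q^-1 * m ^+ 2).
Proof.
move=> q0.
have : 0 <= q^-1 * (q * z - m) ^+ 2 by rewrite mulr_ge0 ?sqr_ge0// invr_ge0 ltW.
have : 0 <= q^-1 * (q * z + m) ^+ 2 by rewrite mulr_ge0 ?sqr_ge0// invr_ge0 ltW.
have -> : q^-1 * (q * z + m) ^+ 2 = q * z ^+ 2 + q^-1 * m ^+ 2 + 2 * (z * m).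
  by field; rewrite gt_eqF.
have -> : q^-1 * (q * z - m) ^+ 2 = q * z ^+ 2 + q^-1 * m ^+ 2 - 2 * (z * m).
  by field; rewrite gt_eqF.
move: (q * z ^+ 2) (q^-1 * m ^+ 2) (z * m) => A B C h1 h2.
by rewrite ler_norml; apply/andP; split; lra.
Qed.

Lemma cross_terms_le q (x y n m : R) : 0 < q -> `|(x - n) * (y - m) - n * m| <=
  2^-1 * ((q + 1) * (x ^+ 2 + y ^+ 2) + q^-1 * (n ^+ 2 + m ^+ 2)).
Proof.
move=> q0.
have -> : (x - n) * (y - m) - n * m = x * y - (x * m + y * n) by ring.
apply: (le_trans (ler_normB _ _)).
have := ler_normD (x * m) (y * n).
have := norm_mul_le x m q0; have := norm_mul_le y n q0.
have := norm_mul_le x y ltr01; rewrite invr1 !mul1r.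
have -> : 2^-1 * ((q + 1) * (x ^+ 2 + y ^+ 2) + q^-1 * (n ^+ 2 + m ^+ 2)) =
  2^-1 * (x ^+ 2 + y ^+ 2) + 2^-1 * (q * x ^+ 2 + q^-1 * m ^+ 2) +
  2^-1 * (q * y ^+ 2 + q^-1 * n ^+ 2) by ring.
by lra.
Qed.

Lemma exprD4_le x y : (x + y) ^+ 4 <= 8 * (x ^+ 4 + y ^+ 4).
Proof.
have h1 : (x + y) ^+ 2 <= 2 * (x ^+ 2 + y ^+ 2) by have := sqr_ge0 (x - y); lra.
have h2 : ((x + y) ^+ 2) ^+ 2 <= (2 * (x ^+ 2 + y ^+ 2)) ^+ 2.
  by rewrite lerXn2r ?nnegrE ?sqr_ge0// mulr_ge0// addr_ge0 ?sqr_ge0.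
by have := sqr_ge0 (x ^+ 2 - y ^+ 2); move: h2; rewrite -exprM; lra.
Qed.

Lemma exprD3_4_le x y z : (2 * x ^+ 2 + y ^+ 2 + z) ^+ 4 <=
  4096 * x ^+ 8 + (256 * y ^+ 8 + 16 * z ^+ 4).
Proof.
have D4 (u v : R) : (u + v) ^+ 4 <= 16 * (u ^+ 4 + v ^+ 4).
  by apply: (le_trans (exprD4_le u v)); have := exprn_double_ge0 u 2;
    have := exprn_double_ge0 v 2; rewrite /muln /=; lra.
have h1 := D4 (2 * x ^+ 2 + y ^+ 2) z; have h2 := D4 (2 * x ^+ 2) (y ^+ 2).
by move: h1 h2; lra.
Qed.

Lemma absorb_le (u v A c t : R) : u <= A * t -> v <= c -> 0 <= c -> 1 <= t ->
  u + v <= (A + c) * t.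
Proof.
move=> uA vc c0 t1; rewrite mulrDl; apply: lerD => //; apply: (le_trans vc).
by rewrite ler_peMr.
Qed.

Lemma tail_const_ge0 n (b g : R) : 0 < b -> 0 < g ->
  0 <= 256 * 17 * (normal_cst n * b ^+ 4) + 16 * g ^+ 4.
Proof.
move=> b0 g0; have n0 : 0 <= normal_cst n :> R by rewrite mulr_ge0 ?ler0n// mulr_ge0 ?expR_ge0.
have h1 : 0 <= normal_cst n * b ^+ 4 by rewrite mulr_ge0// exprn_ge0// ltW.
have h2 : 0 <= g ^+ 4 by rewrite exprn_ge0// ltW.
apply: addr_ge0; last by apply: mulr_ge0 h2; exact: ler0n.
by apply: mulr_ge0 h1; apply: mulr_ge0; exact: ler0n.
Qed.

Lemma cov_bound_le q x y : 1 <= q -> 0 <= x ->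
  2^-1 * ((q + 1) * x + q * y) <= 2^-1 * (2 * x + y) * q.
Proof.
move=> q1 x0; have : (q + 1) * x <= (2 * q) * x by rewrite ler_wpM2r//; lra.
by lra.
Qed.

End scalar_inequalities.

Section integrability.
Context {d} {T : measurableType d} {R : realType}.
Variable P : probability T R.
Implicit Types f g : T -> R.

Lemma ae_dominated f g : measurable_fun setT f ->
  P.-integrable setT (EFin \o g) -> (forall w, 0 <= g w) ->
  {ae P, forall w, `|f w| <= g w} ->
  P.-integrable setT (EFin \o f) /\ `|\int[P]_w f w| <= \int[P]_w g w.
Proof.
move=> mf ig g0 fg.
have mfE : measurable_fun setT (EFin \o f) by exact/measurable_EFinP.
have mg : measurable_fun setT (EFin \o g) by case/integrableP : ig.
have le : (\int[P]_w `|(f w)%:E| <= \int[P]_w (g w)%:E)%E.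
  apply: ae_ge0_le_integral => //.
  - exact: measurableT_comp.
  - by move=> w _; rewrite lee_fin.
  - by apply: filterS fg => w h _; rewrite /= lee_fin.
have iF : P.-integrable setT (EFin \o f).
  apply/integrableP; split => //; apply: le_lt_trans le _.
  by have := integrable_fin_num measurableT ig; rewrite ge0_fin_numE// integral_ge0// => w _;
    rewrite lee_fin.
split => //; apply: (le_trans (le_normr_Rintegral measurableT iF)).
rewrite -lee_fin -!EE_finE//.
by move/integrable_norm : iF.
Qed.

Lemma integrableM_sqr f g : measurable_fun setT f -> measurable_fun setT g ->
  P.-integrable setT (EFin \o (fun w => f w ^+ 2)) ->
  P.-integrable setT (EFin \o (fun w => g w ^+ 2)) ->
  P.-integrable setT (EFin \o (fun w => f w * g w)).
Proof.
move=> mf mg if2 ig2.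
apply: (prob_integrable_le (g := fun w => f w ^+ 2 + g w ^+ 2)).
- exact: measurable_funM.
- exact: prob_integrableD.
- move=> w; have := sqr_ge0 (f w - g w); have := sqr_ge0 (f w + g w).
  by have := sqr_ge0 (f w); have := sqr_ge0 (g w) => *; rewrite ler_norml; apply/andP; split; lra.
Qed.

Lemma orth_bool (n : bool -> T -> R) b b' :
  P.-integrable setT (EFin \o (fun w => n false w * n true w)) /\
    \int[P]_w (n false w * n true w) = 0 -> b != b' ->
  P.-integrable setT (EFin \o (fun w => n b w * n b' w)) /\
    \int[P]_w (n b w * n b' w) = 0.
Proof.
have sw : (fun w => n true w * n false w) = (fun w => n false w * n true w).
  by apply/funext => w; rewrite mulrC.
by case: b b' => [] [] // H _; rewrite sw.
Qed.

End integrability.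

(** * Long-time moments of the scores *)

Section long_time.
Context {d} {Omega : measurableType d} {R : realType}.
Notation mu := (@lebesgue_measure R).
Variables (P : probability Omega R) (theta : 'cV[R]_2) (X : R -> Omega -> 'cV[R]_2).
Hypothesis Th : Theta theta.
Hypothesis cX : continuous_process X.
Hypothesis SX : stationary_OU P theta X.

Let a e : R := lam theta e.
Let a0 e : 0 < a e. Proof. exact: Theta_lam. Qed.
Let N e T w : R := stoch_integral theta X e T w.
Let y e t w : R := pr e (X t w).

Let Xlaw t : 0 <= t -> has_law P (X t) (mu_ theta).
Proof. by have [W [_ _ _ _ H]] := SX; exact: H. Qed.

Let mN e T : 0 < T -> measurable_fun setT (N e T).
Proof. by move=> T0; exact: (measurable_stoch_integral Th cX Xlaw). Qed.

Let yN e t : 0 <= t -> centered_normal P (2 * a e)^-1 (y e t).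
Proof. by move=> t0; exact: (marginal_normal Th cX Xlaw). Qed.

Let fy e t : 0 <= t -> finmom P (y e t).
Proof. by move=> t0; exact: finmom_normal (yN e t0). Qed.

Let N4 e T : 0 < T -> P.-integrable setT (EFin \o (fun w => N e T w ^+ 4))
  /\ \int[P]_w (N e T w ^+ 4) <= stoch_const theta e * T ^+ 2.
Proof.
by have [W [h1 h2 h3 _ h4]] := SX; move=> T0; exact: (stoch_integral_pow4 Th cX h1 h2 h3 h4).
Qed.

Let N2 e T : 0 < T -> P.-integrable setT (EFin \o (fun w => N e T w ^+ 2)) /\
  \int[P]_w (N e T w ^+ 2) = T / (2 * a e).
Proof.
by have [W [h1 h2 h3 _ h4]] := SX; move=> T0; exact: (stoch_integral_var Th cX h1 h2 h3 h4).
Qed.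

Lemma stoch_integral_cov e e' T : 0 < T ->
  P.-integrable setT (EFin \o (fun w => N e T w * N e' T w)) /\
  \int[P]_w (N e T w * N e' T w) = if e == e' then T / (2 * a e) else 0.
Proof.
move=> T0.
have [W [h1 h2 h3 _ h4]] := SX.
have orth := stoch_integral_orth Th cX h1 h2 h3 h4 T0.
have [->|ne] := eqVneq e e'.
  have [i E] := N2 e' T0.
  rewrite (_ : (fun w => _) = fun w => N e' T w ^+ 2); last by apply/funext => w; rewrite expr2.
  by [].
exact: (orth_bool (n := fun b => N b T) orth ne).
Qed.

(** The derivative of the log-likelihood in the eigenvalue a, namely 1/(2a) + M - a S, rewritten
    with the stochastic integral. *)
Definition score1 e T w : R := (2 * a e)^-1 - y e 0 w ^+ 2 - N e T w.

Let c e w : R := (2 * a e)^-1 - y e 0 w ^+ 2.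
Let fc e : finmom P (c e).
Proof. by have f := fy e (lexx 0); apply: finmomB; [exact: finmom_cst|exact: finmomX]. Qed.

Lemma measurable_score1 e T : 0 < T -> measurable_fun setT (score1 e T).
Proof.
by move=> T0; apply: measurable_funB; [case: (fc e)|exact: mN].
Qed.

Definition cov_const e e' : R :=
  2^-1 * (2 * (\int[P]_w (c e w ^+ 2) + \int[P]_w (c e' w ^+ 2)) +
  ((2 * a e)^-1 + (2 * a e')^-1)).

(** The score is -N plus a boundary term of fixed law. Young's inequality with weight sqrt T bounds
    the mixed terms by O(sqrt T), negligible against T. *)
Lemma score1_cov e e' T : 1 <= T ->
  P.-integrable setT (EFin \o (fun w => score1 e T w * score1 e' T w)) /\
  `|\int[P]_w (score1 e T w * score1 e' T w) - (if e == e' then T / (2 * a e) else 0)|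
   <= cov_const e e' * Num.sqrt T.
Proof.
move=> T1; have T0 : 0 < T by lra.
pose q := Num.sqrt T; have q2 : q ^+ 2 = T by rewrite sqr_sqrtr// ltW.
have q1 : 1 <= q by rewrite -[leLHS]sqrtr1 ler_wsqrtr.
have q0 : 0 < q by lra.
have [iNN ENN] := stoch_integral_cov e e' T0.
have [iN EN] := N2 e T0; have [iN' EN'] := N2 e' T0.
have fc2 := finmomX 2 (fc e); have fc2' := finmomX 2 (fc e').
have ic2 := finmom_integrable fc2; have ic2' := finmom_integrable fc2'.
pose g w := 2^-1 * ((q + 1) * (c e w ^+ 2 + c e' w ^+ 2) + q^-1 * (N e T w ^+ 2 + N e' T w ^+ 2)).
have i1 := prob_integrableD ic2 ic2'; have i2 := prob_integrableD iN iN'.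
have i3 := prob_integrableZ (q + 1) i1; have i4 := prob_integrableZ q^-1 i2.
have i5 := prob_integrableD i3 i4.
have ig : P.-integrable setT (EFin \o g) by exact: (prob_integrableZ 2^-1 i5).
have Eg : \int[P]_w g w = 2^-1 * ((q + 1) * (\int[P]_w (c e w ^+ 2) + \int[P]_w (c e' w ^+ 2)) +
    q^-1 * (T / (2 * a e) + T / (2 * a e'))).
  rewrite /g RintegralZl// (RintegralD _ i3 i4)// !RintegralZl//.
  by rewrite (RintegralD _ ic2 ic2')// (RintegralD _ iN iN')// EN EN'.
have dle w : `|score1 e T w * score1 e' T w - N e T w * N e' T w| <= g w.
  by rewrite /score1 /g -/(c e w) -/(c e' w); exact: cross_terms_le.
have md : measurable_fun setT (fun w => score1 e T w * score1 e' T w - N e T w * N e' T w).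
  by apply: measurable_funB; apply: measurable_funM; first [exact: measurable_score1|exact: mN].
have g0 w : 0 <= g w by apply: le_trans (dle w).
have [id dE] := ae_dominated md ig g0 (aeW P dle).
have iss : P.-integrable setT (EFin \o (fun w => score1 e T w * score1 e' T w)).
  have := prob_integrableD id iNN.
  by under [X in _.-integrable _ (EFin \o X)]eq_fun do rewrite subrK.
split => //.
have : \int[P]_w (score1 e T w * score1 e' T w - N e T w * N e' T w) =
  \int[P]_w (score1 e T w * score1 e' T w) - (if e == e' then T / (2 * a e) else 0).
  by rewrite (RintegralB _ iss iNN)// ENN.
move=> <-; apply: (le_trans dE); rewrite Eg /cov_const -/q.
have -> : q^-1 * (T / (2 * a e) + T / (2 * a e')) = q * ((2 * a e)^-1 + (2 * a e')^-1).
  by rewrite -q2; field; rewrite !gt_eqF.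
have C0 : 0 <= \int[P]_w (c e w ^+ 2) + \int[P]_w (c e' w ^+ 2).
  by rewrite addr_ge0//; apply: EE_ge0 => w; exact: sqr_ge0.
exact: cov_bound_le.
Qed.

Lemma score1_cov_cvg e e' :
  T^-1 * \int[P]_w (score1 e T w * score1 e' T w) @[T --> +oo] -->
  if e == e' then (2 * a e)^-1 else 0.
Proof.
apply/cvgrPdist_le => eps eps0.
pose K := cov_const e e' / eps.
near=> T.
have T1 : 1 <= T by near: T; apply: nbhs_pinfty_ge; rewrite num_real.
have T0 : 0 < T by lra.
have TK : K ^+ 2 <= T by near: T; apply: nbhs_pinfty_ge; rewrite num_real.
have [_ h] := score1_cov e e' T1.
pose q := Num.sqrt T; have q2 : q ^+ 2 = T by rewrite sqr_sqrtr// ltW.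
have q0 : 0 < q by rewrite sqrtr_gt0.
have qK : K <= q.
  by apply: (le_trans (ler_norm _)); rewrite -sqrtr_sqr ler_wsqrtr.
rewrite distrC.
have -> : T^-1 * \int[P]_w (score1 e T w * score1 e' T w) -
  (if e == e' then (2 * a e)^-1 else 0) =
  T^-1 * (\int[P]_w (score1 e T w * score1 e' T w) - (if e == e' then T / (2 * a e) else 0)).
  rewrite mulrBr; congr (_ - _); case: ifP => _; last by rewrite mulr0.
  by rewrite mulKf// gt_eqF.
rewrite normrM gtr0_norm ?invr_gt0// ler_pdivrMl//.
have cK : cov_const e e' <= q * eps by move: qK; rewrite /K ler_pdivrMr.
apply: (le_trans h); rewrite -/q.
apply: (@le_trans _ _ (q * eps * q)); first by rewrite ler_pM2r.
by rewrite mulrAC -expr2 q2.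
Unshelve. all: by end_near. Qed.

(** The quantity v that controls the remainder in [mle_exp_approx]. *)
Definition vfun e T w : R := `|score1 e T w| + (y e 0 w ^+ 2 + y e T w ^+ 2) + 1.

Lemma vfun_ge0 e T w : 0 <= vfun e T w.
Proof. by rewrite !addr_ge0 ?sqr_ge0. Qed.

Lemma score1_le_vfun e T w : `|score1 e T w| <= vfun e T w.
Proof. by rewrite /vfun -addrA lerDl addr_ge0// addr_ge0 ?sqr_ge0. Qed.

Definition v_const e : R := 8 * (stoch_const theta e +
  (256 * 17 * (normal_cst 4 * (2 * a e)^-1 ^+ 4) + 16 * (1 + (2 * a e)^-1) ^+ 4)).

(** v is at most |N| + H, where N has a fourth moment O(T^2) and H, built from two stationary values
    of y, has one bounded in T. *)
Lemma vfun_pow4 e T : 1 <= T ->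
  P.-integrable setT (EFin \o (fun w => vfun e T w ^+ 4)) /\
  \int[P]_w (vfun e T w ^+ 4) <= v_const e * T ^+ 2.
Proof.
move=> T1; have T0 : 0 < T by lra.
have ae : 0 < (2 * a e)^-1 by rewrite invr_gt0 mulr_gt0.
pose g0 : R := 1 + (2 * a e)^-1.
have f0 := fy e (lexx 0); have fT := fy e (ltW T0).
have [i4 E4] := N4 e T0.
pose H w := 2 * y e 0 w ^+ 2 + y e T w ^+ 2 + g0.
have fH : finmom P H by rewrite /H; finm.
have m8 t : 0 <= t -> \int[P]_w (y e t w ^+ 8) <= normal_cst 4 * (2 * a e)^-1 ^+ 4.
  by move=> t0; exact: (normal_pow_le ae (yN e t0) 4).
have EH : \int[P]_w (H w ^+ 4) <=
    256 * 17 * (normal_cst 4 * (2 * a e)^-1 ^+ 4) + 16 * g0 ^+ 4.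
  apply: (@le_trans _ _ (\int[P]_w (4096 * y e 0 w ^+ 8 + (256 * y e T w ^+ 8 + 16 * g0 ^+ 4)))).
    apply: EE_le; [by finm|by finm|move=> w].
    exact: exprD3_4_le.
  rewrite EE_D; [|by finm|by finm]; rewrite EE_D; [|by finm|by finm].
  rewrite !EE_Z; try finm.
  by rewrite EE_cst; have := m8 0 (lexx 0); have := m8 T (ltW T0); lra.
have fH4 := finmomX 4 fH.
have iH := finmom_integrable fH4.
pose g w := 8 * (N e T w ^+ 4 + H w ^+ 4).
have iNH := prob_integrableD i4 iH.
have ig : P.-integrable setT (EFin \o g) by exact: (prob_integrableZ 8 iNH).
have vg w : vfun e T w ^+ 4 <= g w.
  have v0 : 0 <= vfun e T w by rewrite !addr_ge0 ?sqr_ge0.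
  have vNH : vfun e T w <= `|N e T w| + H w.
    rewrite /vfun /H /score1 /g0.
    apply: (@le_trans _ _ (`|(2 * a e)^-1 - y e 0 w ^+ 2| + `|N e T w| +
        (y e 0 w ^+ 2 + y e T w ^+ 2) + 1)).
      by rewrite !lerD2r; exact: ler_normB.
    have := ler_normB ((2 * a e)^-1) (y e 0 w ^+ 2).
    by rewrite (gtr0_norm ae) (ger0_norm (sqr_ge0 _)); lra.
  have NH0 : 0 <= `|N e T w| + H w by exact: le_trans vNH.
  apply: (@le_trans _ _ ((`|N e T w| + H w) ^+ 4)).
    by rewrite lerXn2r ?nnegrE.
  rewrite /g.
  have -> : N e T w ^+ 4 = `|N e T w| ^+ 4.
    by rewrite -[LHS]ger0_norm ?(exprn_double_ge0 _ 2)// normrX.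
  exact: exprD4_le.
have g0' w : 0 <= g w by apply: le_trans (vg w); exact: (exprn_double_ge0 _ 2).
have mv : measurable_fun setT (fun w => vfun e T w ^+ 4).
  apply: measurable_funX; apply: measurable_funD => //; apply: measurable_funD.
    by apply: measurableT_comp => //; exact: measurable_score1.
  by apply: measurable_funD; apply: measurable_funX; [case: f0|case: fT].
have nv w : `|vfun e T w ^+ 4| <= g w by rewrite ger0_norm ?(exprn_double_ge0 _ 2).
have [iv Ev] := ae_dominated mv ig g0' (aeW P nv).
split => //; apply: (le_trans (ler_norm _)); apply: (le_trans Ev).
rewrite /g RintegralZl// (RintegralD _ i4 iH)// /v_const -mulrA ler_wpM2l//.
have T21 : 1 <= T ^+ 2 by rewrite exprn_ege1.
move: EH; rewrite -/g0 => EH.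
have g0p : 0 < g0 by rewrite addr_gt0.
exact: absorb_le E4 EH (tail_const_ge0 4 ae g0p) T21.
Qed.

End long_time.

(** * Mean square error of the estimated exponentials *)

(** Writing p = r - k s / T, the difference of squares is r^2 - 2 k s r / T. The cubic term v^3 is
    traded for v^4 / q + q^3 with q = sqrt T, so that fourth moments control everything. *)
Lemma sqr_perturb_le {R : realType} (k C T q p s v : R) : 0 < T -> q ^+ 2 = T -> 0 < q ->
  0 <= k -> 0 <= C -> 0 <= v -> `|s| <= v -> `|p + k * s / T| <= C * v ^+ 2 / T ^+ 2 ->
  `|p ^+ 2 - k ^+ 2 * T^-1 ^+ 2 * s ^+ 2| <=
  (C ^+ 2 * T^-1 ^+ 4 + 2 * k * C * T^-1 ^+ 3 * q^-1) * v ^+ 4 + 2 * k * C * T^-1 ^+ 3 * q ^+ 3.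
Proof.
move=> T0 q2 q0 k0 C0 v0 sv pb.
pose r := p + k * s / T.
have E : p ^+ 2 - k ^+ 2 * T^-1 ^+ 2 * s ^+ 2 = r ^+ 2 - 2 * k * T^-1 * (s * r).
  by rewrite /r; ring.
have i0 : 0 <= T^-1 by rewrite invr_ge0 ltW.
have b0 : 0 <= C * v ^+ 2 / T ^+ 2 by apply: le_trans pb.
have r2 : r ^+ 2 <= C ^+ 2 * T^-1 ^+ 4 * v ^+ 4.
  have -> : C ^+ 2 * T^-1 ^+ 4 * v ^+ 4 = (C * v ^+ 2 / T ^+ 2) ^+ 2 by field; rewrite gt_eqF.
  by rewrite -real_normK ?num_real//; apply: lerXn2r; rewrite ?nnegrE.
have sr : `|s * r| <= C * T^-1 ^+ 2 * v ^+ 3.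
  have -> : C * T^-1 ^+ 2 * v ^+ 3 = v * (C * v ^+ 2 / T ^+ 2) by field; rewrite gt_eqF.
  by rewrite normrM; apply: ler_pM.
have v3 : v ^+ 3 <= q^-1 * v ^+ 4 + q ^+ 3.
  have qi : 0 <= q^-1 by rewrite invr_ge0 ltW.
  have [vq|qv] := lerP v q.
    apply: (@le_trans _ _ (q ^+ 3)); first by apply: lerXn2r => //; rewrite ?nnegrE// ltW.
    by rewrite lerDr mulr_ge0// exprn_ge0.
  apply: (@le_trans _ _ (q^-1 * v ^+ 4)); last by rewrite lerDl exprn_ge0 ?ltW.
  by rewrite ler_pdivlMl// [v ^+ 4]exprS; apply: ler_wpM2r (ltW qv); exact: exprn_ge0.
have kC : 0 <= 2 * k * T^-1 by rewrite !mulr_ge0.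
rewrite E; apply: (le_trans (ler_normB _ _)).
rewrite (ger0_norm (sqr_ge0 _)) normrM (ger0_norm kC).
have h1 : 2 * k * T^-1 * `|s * r| <= 2 * k * T^-1 * (C * T^-1 ^+ 2 * (q^-1 * v ^+ 4 + q ^+ 3)).
  apply: ler_wpM2l => //; apply: (le_trans sr); apply: ler_wpM2l v3.
  by rewrite mulr_ge0// exprn_ge0.
apply: (le_trans (lerD r2 h1)).
by rewrite le_eqVlt; apply/orP; left; apply/eqP; ring.
Qed.

Lemma mle_const_ge0 {R : realType} (a h : R) : 0 < a -> 0 < h -> 0 <= mle_const a h.
Proof.
move=> a0 h0.
have i0 : 0 <= a^-1 by rewrite invr_ge0 ltW.
have k0 : 0 <= 2 + a^-1 by rewrite addr_ge0// ler0n.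
have e0 : 0 <= (8 + 2 * (2 + a^-1))^-1^-1 by rewrite invrK addr_ge0 ?ler0n// mulr_ge0.
have f0 : 0 <= 4 * a by rewrite mulr_ge0 ?ler0n// ltW.
have hh := ltW h0.
rewrite /mle_const; apply: addr_ge0; apply: addr_ge0.
- exact: exprn_ge0.
- by apply: mulr_ge0 e0; apply: mulr_ge0 hh; rewrite mulr_ge0// ltW.
- by apply: mulr_ge0 hh _; apply: mulr_ge0 f0 _; rewrite addr_ge0// mulr_ge0.
- by rewrite mulr_ge0 ?expR_ge0// mulr_ge0// exprn_ge0.
Qed.

Lemma rate_le {R : realType} (T q C k K : R) : 1 <= q -> q ^+ 2 = T -> 0 <= C -> 0 <= K ->
  T * ((C ^+ 2 * T^-1 ^+ 4 + 2 * k * C * T^-1 ^+ 3 * q^-1) * (K * T ^+ 2) +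
    2 * k * C * T^-1 ^+ 3 * q ^+ 3) <= (C ^+ 2 * K + 2 * k * C * (K + 1)) / q.
Proof.
move=> q1 <- C0 K0; have q0 : 0 < q by exact: lt_le_trans q1.
have -> : q ^+ 2 * ((C ^+ 2 * (q ^+ 2)^-1 ^+ 4 + 2 * k * C * (q ^+ 2)^-1 ^+ 3 * q^-1) *
    (K * (q ^+ 2) ^+ 2) + 2 * k * C * (q ^+ 2)^-1 ^+ 3 * q ^+ 3) =
  C ^+ 2 * K * (q^-1 * q^-1) + 2 * k * C * (K + 1) * q^-1 by field; rewrite gt_eqF.
rewrite [leRHS]mulrDl lerD2r; apply: ler_wpM2l; first by rewrite mulr_ge0// exprn_ge0.
by rewrite ler_piMl ?invr_ge0 ?(ltW q0)// invf_le1.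
Qed.

Lemma inv_sqrt_cvg0 {R : realType} : (Num.sqrt T)^-1 @[T --> +oo] --> (0 : R).
Proof.
apply/cvgrPdist_le => eps eps0; near=> T.
have T0 : eps^-1 ^+ 2 <= T by near: T; apply: nbhs_pinfty_ge; rewrite num_real.
have i0 : 0 < eps^-1 by rewrite invr_gt0.
have iT : eps^-1 <= Num.sqrt T.
  by rewrite -(ger0_norm (ltW i0)) -sqrtr_sqr ler_wsqrtr.
rewrite sub0r normrN ger0_norm ?invr_ge0 ?sqrtr_ge0//.
by rewrite -[eps]invrK lef_pV2 ?posrE// (lt_le_trans i0).
Unshelve. all: by end_near. Qed.

Section eigenvalue_estimation.
Context {d} {Omega : measurableType d} {R : realType}.
Notation mu := (@lebesgue_measure R).
Variables (P : probability Omega R) (theta : 'cV[R]_2) (X : R -> Omega -> 'cV[R]_2).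
Hypothesis Th : Theta theta.
Hypothesis cX : continuous_process X.
Hypothesis SX : stationary_OU P theta X.

Let a e : R := lam theta e.
Let a0 e : 0 < a e. Proof. exact: Theta_lam. Qed.
Let y e t w : R := pr e (X t w).

Variables (h : R) (chat : R -> bool -> Omega -> R).
Hypothesis h0 : 0 < h.
Hypothesis mchat : forall T e, 0 < T -> measurable_fun setT (chat T e).
Hypothesis chat_root : forall T, 0 < T -> {ae P, forall w, forall e, 0 < chat T e w /\
  (2 * chat T e w)^-1 + 2^-1 * (T - (y e 0 w ^+ 2 + y e T w ^+ 2))
   - chat T e w * \int[mu]_(s in `[0, T]) (y e s w ^+ 2) = 0}.

Definition perr T e w : R := expR (- h * chat T e w) - expR (- h * a e).

Lemma measurable_perr T e : 0 < T -> measurable_fun setT (perr T e).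
Proof.
move=> T0; apply: measurable_funB => //; apply: measurableT_comp => //.
by apply: measurable_funM => //; exact: mchat.
Qed.

Lemma perr_norm_le1 T : 0 < T -> {ae P, forall w, forall e, `|perr T e w| <= 1}.
Proof.
move=> T0; apply: filterS (chat_root T0) => w H e; have [c0 _] := H e.
have E (c : R) : 0 < c -> 0 < expR (- h * c) /\ expR (- h * c) <= 1.
  by move=> c0'; rewrite expR_gt0 -expR0 ler_expR mulNr oppr_le0 mulr_ge0// ltW.
have [? ?] := E _ c0; have [? ?] := E _ (a0 e).
by rewrite /perr ler_norml; apply/andP; split; lra.
Qed.

Lemma perr_integrable T e e' : 0 < T ->
  P.-integrable setT (EFin \o (fun w => perr T e w * perr T e' w)).
Proof.
move=> T0.
have m : measurable_fun setT (fun w => perr T e w * perr T e' w).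
  by apply: measurable_funM; exact: measurable_perr.
apply: (proj1 (ae_dominated m (prob_integrable_cst P 1) (fun _ => ler01) _)).
apply: filterS (perr_norm_le1 T0) => w H.
by rewrite normrM mulr_ile1.
Qed.

Let kap e : R := 2 * a e * h * expR (- h * a e).
Let kap0 e : 0 <= kap e.
Proof. by rewrite !mulr_ge0 ?expR_ge0 ?ltW. Qed.

Lemma perr_score T e : 0 < T -> {ae P, forall w,
  `|perr T e w + kap e * score1 theta X e T w / T| <=
  mle_const (a e) h * vfun theta X e T w ^+ 2 / T ^+ 2}.
Proof.
move=> T0; apply: filterS (chat_root T0) => w H; have [c0 E] := H e.
apply: (@mle_exp_approx _ (a e) h T (\int[mu]_(s in `[0, T]) (y e s w ^+ 2))
  (2^-1 * (T - (y e 0 w ^+ 2 + y e T w ^+ 2))) (y e 0 w ^+ 2 + y e T w ^+ 2)) => //.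
- by apply: Rintegral_ge0 => s _; exact: sqr_ge0.
- by rewrite addr_ge0 ?sqr_ge0.
- exact: mulrC.
rewrite /score1 /stoch_integral /y /a.
have := a0 e; rewrite /a.
move: (pr e (X 0 w)) (pr e (X T w)) (lam theta e) (\int[mu]_(s in `[0, T]) _) => u v b S b0.
by field; rewrite gt_eqF.
Qed.

(** The error is - kap s / T up to the pathwise remainder, so T times its mean square follows kap^2
    E s^2 / T, which tends to kap^2 / (2a). *)
Lemma perr_sqr_cvg e :
  T * \int[P]_w (perr T e w ^+ 2) @[T --> +oo] --> 2 * a e * h ^+ 2 * expR (- (2 * h) * a e).
Proof.
have -> : 2 * a e * h ^+ 2 * expR (- (2 * h) * a e) = kap e ^+ 2 * (2 * a e)^-1.
  have -> : - (2 * h) * a e = - h * a e + - h * a e by ring.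
  by rewrite expRD /kap; field; rewrite gt_eqF.
pose C := mle_const (a e) h.
have C0 : 0 <= C by exact: mle_const_ge0.
pose K := v_const theta e.
pose L := C ^+ 2 * K + 2 * kap e * C * (K + 1).
have K0 : 0 <= K.
  have [_ vK] := vfun_pow4 Th cX SX e (lexx 1); rewrite expr1n mulr1 in vK.
  by apply: le_trans vK; apply: EE_ge0 => w; exact: (exprn_double_ge0 _ 2).
(* The remainder integrates, by the fourth moment of v, to a contribution O(T^(-1/2)) after
   multiplication by T. *)
have bound T : 1 <= T ->
    `|T * \int[P]_w (perr T e w ^+ 2) -
      kap e ^+ 2 * (T^-1 * \int[P]_w (score1 theta X e T w * score1 theta X e T w))|
    <= L / Num.sqrt T.
  move=> T1; have T0 : 0 < T by exact: lt_le_trans T1.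
  pose q := Num.sqrt T; have q2 : q ^+ 2 = T by rewrite sqr_sqrtr// ltW.
  have q0 : 0 < q by rewrite sqrtr_gt0.
  have q1 : 1 <= q by rewrite -[leLHS]sqrtr1 ler_wsqrtr.
  have [iv vK] := vfun_pow4 Th cX SX e T1.
  have [iss _] := score1_cov Th cX SX e e T1.
  have ip := perr_integrable e e T0.
  pose k2 := kap e ^+ 2 * T^-1 ^+ 2.
  pose A := C ^+ 2 * T^-1 ^+ 4 + 2 * kap e * C * T^-1 ^+ 3 * q^-1.
  pose B := 2 * kap e * C * T^-1 ^+ 3 * q ^+ 3.
  have Ti : 0 <= T^-1 by rewrite invr_ge0 ltW.
  have qi : 0 <= q^-1 by rewrite invr_ge0 ltW.
  have A0 : 0 <= A.
    by apply: addr_ge0; do ?[exact: kap0 | apply: mulr_ge0 | apply: exprn_ge0].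
  have B0 : 0 <= B.
    have q0' := ltW q0; rewrite /B; apply: mulr_ge0; last exact: exprn_ge0.
    by do ?[exact: kap0 | apply: mulr_ge0 | apply: exprn_ge0].
  have iss2 : P.-integrable setT (EFin \o (fun w => score1 theta X e T w ^+ 2)).
    exact: iss.
  have ip2 : P.-integrable setT (EFin \o (fun w => perr T e w ^+ 2)).
    exact: ip.
  have iks := prob_integrableZ k2 iss2.
  have idiff : measurable_fun setT
      (fun w => perr T e w ^+ 2 - k2 * score1 theta X e T w ^+ 2).
    apply: measurable_funB; first by apply: measurable_funX; exact: measurable_perr.
    by apply: measurable_funM => //; apply: measurable_funX; exact: (measurable_score1 Th cX SX).
  have iAv := prob_integrableZ A iv.
  have ig := prob_integrableD iAv (prob_integrable_cst P B).
  have g0 w : 0 <= A * vfun theta X e T w ^+ 4 + B.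
    by apply: addr_ge0 B0; apply: mulr_ge0 A0 _; exact: exprn_ge0 (vfun_ge0 _ _ _ _ _).
  have [_ dle] := ae_dominated idiff ig g0 (filterS (fun w H =>
    sqr_perturb_le T0 q2 q0 (kap0 e) C0 (vfun_ge0 theta X e T w) (score1_le_vfun theta X e T w) H)
    (perr_score e T0)).
  move: dle; rewrite (RintegralB _ ip2 iks)// RintegralZl//.
  rewrite (RintegralD _ iAv (prob_integrable_cst P B))// RintegralZl// EE_cst => dle.
  have -> : \int[P]_w (score1 theta X e T w * score1 theta X e T w) =
    \int[P]_w (score1 theta X e T w ^+ 2) by [].
  have -> : T * \int[P]_w (perr T e w ^+ 2) -
      kap e ^+ 2 * (T^-1 * \int[P]_w (score1 theta X e T w ^+ 2)) =
      T * (\int[P]_w (perr T e w ^+ 2) - k2 * \int[P]_w (score1 theta X e T w ^+ 2)).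
    by rewrite /k2; field; rewrite gt_eqF.
  rewrite normrM gtr0_norm//.
  have AK := ler_wpM2l A0 vK.
  apply: (le_trans (ler_wpM2l (ltW T0) (le_trans dle (lerD AK (lexx B))))).
  exact: rate_le.
have scvg : kap e ^+ 2 * (T^-1 * \int[P]_w (score1 theta X e T w * score1 theta X e T w))
    @[T --> +oo] --> kap e ^+ 2 * (2 * a e)^-1.
  by apply: cvgMl_tmp; have := @score1_cov_cvg _ _ _ _ _ _ Th cX SX e e; rewrite eqxx.
rewrite -[X in _ --> X]addr0.
have Lc : L / Num.sqrt T @[T --> +oo] --> 0.
  rewrite -[X in _ --> X](mulr0 L); apply: cvgMl_tmp.
  exact: inv_sqrt_cvg0.
pose u T := T * \int[P]_w (perr T e w ^+ 2).
pose v T := kap e ^+ 2 * (T^-1 * \int[P]_w (score1 theta X e T w * score1 theta X e T w)).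
have -> : (fun T => T * \int[P]_w (perr T e w ^+ 2)) = (fun T => v T + (u T - v T)).
  by apply/funext => T; rewrite addrC subrK.
apply: cvgD scvg _; apply/norm_cvg0P.
apply: (squeeze_cvgr _ (cvg_cst 0) Lc); near=> T.
have T1 : 1 <= T by near: T; apply: nbhs_pinfty_ge; rewrite num_real.
by rewrite normr_ge0; exact: bound.
Unshelve. all: by end_near. Qed.

End eigenvalue_estimation.

(** * Spectral decomposition and the matrix exponential *)

Section spectral_decomposition.
Context {R : realType}.
Implicit Types (theta v : 'cV[R]_2) (e : bool) (c : R).

Definition crd e (i : 'I_2) : R := if i == 0 then 1 else sg e.

Definition evec e : 'cV[R]_2 := \col_i ((Num.sqrt 2)^-1 * crd e i).

Definition eproj e : 'M[R]_2 := \matrix_(i, j) (2^-1 * (crd e i * crd e j)).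

Lemma evec_mul e i j : evec e i 0 * evec e j 0 = eproj e i j.
Proof.
rewrite !mxE -sqrt2V_sqr; ring.
Qed.

(** As [lam] is linear, this is the partial derivative of the eigenvalue in the i-th parameter: it
    coincides with the i-th entry of the unnormalised eigenvector, which is how the eigenvectors of
    Q enter the score and the Jacobian. *)
Lemma crd_lam e i : lam (delta_mx i 0) e = crd e i.
Proof.
by elim/ord2P: i; rewrite /lam /crd !mxE /= ?mulr0 ?addr0 ?mulr1 ?add0r.
Qed.

Lemma eproj_mul e v : eproj e *m v = pr e v *: evec e.
Proof.
apply/colP => i; rewrite !mxE sum2E !mxE /pr -sqrt2V_sqr.
have c0 : crd e 0 = 1 by [].
have c1 : crd e 1 = sg e by [].
by rewrite c0 c1; ring.
Qed.

Lemma eprojM e e' : eproj e * eproj e' = if e == e' then eproj e else 0.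
Proof.
apply/matrixP => i j; rewrite !mxE sum2E !mxE.
have c0 b : crd b 0 = 1 by [].
have c1 b : crd b 1 = sg b by [].
rewrite !c0 !c1; have := sg_sqr (R := R) e.
by case: e; case: e'; rewrite /= !mxE /sg => E; field.
Qed.

Lemma eproj_sum : eproj false + eproj true = 1.
Proof.
by apply/matrixP => i j; elim/ord2P: i; elim/ord2P: j; rewrite !mxE /crd /sg /=; field.
Qed.

Lemma Q_eproj theta : Q theta = lam theta false *: eproj false + lam theta true *: eproj true.
Proof.
by apply/matrixP => i j; elim/ord2P: i; elim/ord2P: j; rewrite !mxE /crd /sg /lam /=; field.
Qed.

Lemma Q_power c theta k : (c *: Q theta) ^+ k =
  (c * lam theta false) ^+ k *: eproj false + (c * lam theta true) ^+ k *: eproj true.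
Proof.
elim: k => [|k IH]; first by rewrite !expr0 !scale1r eproj_sum.
rewrite exprS IH Q_eproj scalerDr !scalerA mulrDl !mulrDr -!scalerAl -!scalerAr !scalerA.
by rewrite !eprojM /= !scaler0 addr0 add0r -!exprS.
Qed.

Definition spec_exp c theta : 'M[R]_2 :=
  expR (c * lam theta false) *: eproj false + expR (c * lam theta true) *: eproj true.

(** The eigenprojections are orthogonal idempotents, so the series splits into two scalar
    exponential series. *)
Lemma expmx_Q c theta : expmx (c *: Q theta) = spec_exp c theta.
Proof.
rewrite /expmx.
have -> : series (fun k => (k`!%:R)^-1 *: (c *: Q theta) ^+ k) =
    fun n => series (exp_coeff (c * lam theta false)) n *: eproj false +
             series (exp_coeff (c * lam theta true)) n *: eproj true.
  apply/funext => n; rewrite /series /= !scaler_suml -big_split /=.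
  by apply: eq_bigr => k _; rewrite Q_power scalerDr !scalerA /exp_coeff /= ![_ * _^-1]mulrC.
apply: cvg_lim; first exact: norm_hausdorff.
by apply: cvgD; apply: cvgZr_tmp; exact: is_cvg_series_exp_coeff.
Qed.

Lemma rE h v theta : r h v theta =
  (expR (- h * lam theta false) * pr false v) *: evec false +
  (expR (- h * lam theta true) * pr true v) *: evec true.
Proof. by rewrite /r expmx_Q mulmxDl -!scalemxAl !eproj_mul !scalerA. Qed.

End spectral_decomposition.

(** * Derivatives of functions of the eigenvalues *)

Section directional_derivatives.
Context {R : realType}.

Lemma cvg_is_derive (V W : normedModType R) (f : V -> W) a v df :
  (h^-1 *: ((f \o shift a) (h *: v) - f a) @[h --> 0^']) --> df -> is_derive a v f df.
Proof. by move=> H; split; [exact: cvgP H|exact: (cvg_lim _ H)]. Qed.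

Lemma is_derive_cvg (V W : normedModType R) (f : V -> W) a v df : is_derive a v f df ->
  (h^-1 *: ((f \o shift a) (h *: v) - f a) @[h --> 0^']) --> df.
Proof. by case=> H <-. Qed.

Lemma is_derive_dir (W : normedModType R) (f : R -> W) (a k : R) df :
  is_derive a 1 f df -> is_derive a k f (k *: df).
Proof.
case=> /derivable1_diffP H <-; split; first exact: diff_derivable.
by rewrite !deriveE// -[k in LHS]mulr1 -[k * 1]/(k *: 1) linearZ.
Qed.

Lemma is_derive_scalel (W : normedModType R) (f : R -> R) (a df : R) (u : W) :
  is_derive a 1 f df -> is_derive a 1 (fun t => f t *: u) (df *: u).
Proof.
move=> /is_derive_cvg H; apply: cvg_is_derive.
under eq_fun do rewrite /= -scalerBl scalerA.
by apply: cvgZr_tmp; exact: H.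
Qed.

(** By linearity of [lam], the difference quotient along v is that of f on the line along the number
    [lam v e]. *)
Lemma is_derive_lam (W : normedModType R) (f : R -> W) (theta v : 'cV[R]_2) e df :
  is_derive (lam theta e) (1 : R) f df ->
  is_derive theta v (fun eta => f (lam eta e)) (lam v e *: df).
Proof.
move=> /(is_derive_dir (lam v e)) /is_derive_cvg H; apply: cvg_is_derive.
under eq_fun => h.
  rewrite /= (_ : lam (h *: v + theta) e = h *: lam v e + lam theta e); last first.
    by rewrite /lam !mxE /GRing.scale /=; ring.
  over.
exact: H.
Qed.

End directional_derivatives.

(** * The likelihood factorises over the eigenvalues *)

Section likelihood_in_eigenvalues.
Context {R : realType}.
Notation mu := (@lebesgue_measure R).
Implicit Types (theta eta v : 'cV[R]_2) (e : bool).

Lemma quadform_Q theta v : quadform (Q theta) v =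
  lam theta false * pr false v ^+ 2 + lam theta true * pr true v ^+ 2.
Proof.
rewrite /quadform !mxE sum2E !mxE !sum2E !mxE /= /pr /lam /sg.
have q2 := sqrt2V_sqr (R := R); move: (Num.sqrt 2)^-1 q2 => q q2.
have E (x y : R) : (q * x + y * q * v 1 0) ^+ 2 = 2^-1 * (x + y * v 1 0) ^+ 2.
  by rewrite -q2; ring.
by rewrite !E; field.
Qed.

Lemma sqnorm_pr v : sqnorm v = pr false v ^+ 2 + pr true v ^+ 2.
Proof.
rewrite /sqnorm !mxE sum2E !mxE /= /pr /sg.
have q2 := sqrt2V_sqr (R := R); move: (Num.sqrt 2)^-1 q2 => q q2.
have E (x y : R) : (q * x + y * q * v 1 0) ^+ 2 = 2^-1 * (x + y * v 1 0) ^+ 2.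
  by rewrite -q2; ring.
by rewrite !E; field.
Qed.

Lemma of_lam (l : bool -> R) : exists eta, forall e, lam eta e = l e.
Proof.
exists (\col_i (if i == 0 then (l false + l true) / 2 else (l false - l true) / 2)) => e.
by rewrite /lam /sg !mxE /=; case: e; field.
Qed.

Variables (T : R) (x : R -> 'cV[R]_2).
Hypothesis cx : forall e, {within `[0, T], continuous (fun t => pr e (x t))}.

Let S e : R := \int[mu]_(t in `[0, T]) (pr e (x t) ^+ 2).
Let M e : R := 2^-1 * (T - (pr e (x 0) ^+ 2 + pr e (x T) ^+ 2)).

Lemma likelihoodE theta : likelihood T x theta =
  2 * Num.sqrt (lam theta false * lam theta true) *
  expR ((lam theta false * M false - lam theta false ^+ 2 / 2 * S false) +
        (lam theta true * M true - lam theta true ^+ 2 / 2 * S true)).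
Proof.
rewrite /likelihood det_Q; congr (_ * expR _).
rewrite !quadform_Q.
have -> : \int[mu]_(t in `[0, T]) sqnorm (Q theta *m x t) =
  lam theta false ^+ 2 * S false + lam theta true ^+ 2 * S true.
  rewrite -Rintegral_lincomb; try by apply: continuous_sqr; exact: cx.
  by apply: eq_Rintegral => t _; rewrite sqnorm_pr !pr_Q !exprMn.
have -> : theta 0 0 = 2^-1 * (lam theta false + lam theta true).
  by rewrite /lam /sg; field.
by rewrite /M; field.
Qed.

Lemma ln_likelihoodE theta : (forall e, 0 < lam theta e) -> ln (likelihood T x theta) =
  ln 2 + ((2^-1 * ln (lam theta false) + lam theta false * M false - lam theta false ^+ 2 / 2 * S false)
   + (2^-1 * ln (lam theta true) + lam theta true * M true - lam theta true ^+ 2 / 2 * S true)).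
Proof.
move=> l0; have l2 : 0 < lam theta false * lam theta true by rewrite mulr_gt0.
have s0 : 0 < Num.sqrt (lam theta false * lam theta true) by rewrite sqrtr_gt0.
rewrite likelihoodE lnM ?posrE ?expR_gt0 ?mulr_gt0// expRK lnM ?posrE//.
have -> : ln (Num.sqrt (lam theta false * lam theta true)) =
  2^-1 * (ln (lam theta false) + ln (lam theta true)).
  have E : ln (lam theta false * lam theta true) =
    ln (Num.sqrt (lam theta false * lam theta true)) *+ 2.
    by rewrite -lnXn// sqr_sqrtr// ltW.
  by rewrite -lnM ?posrE// E -mulr_natr; field.
by ring.
Qed.

(** One eigenvalue is varied with the other held fixed, which stays in Theta; the maximum is then
    that of a scalar function, at an interior point. *)
Lemma mle_eigenvalue_root theta e : Theta theta ->
  (forall eta, Theta eta -> likelihood T x eta <= likelihood T x theta) ->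
  (2 * lam theta e)^-1 + M e - lam theta e * S e = 0.
Proof.
move=> Th mx; have l0 b := Theta_lam b Th.
apply: loglik_max_root => // z z0.
have [eta etaE] := of_lam (fun b => if b == e then z else lam theta b).
have eta0 b : 0 < lam eta b by rewrite etaE; case: ifP.
have L0 th : (forall b, 0 < lam th b) -> 0 < likelihood T x th.
  by move=> H; rewrite likelihoodE !mulr_gt0 ?expR_gt0// sqrtr_gt0 mulr_gt0.
have le : ln (likelihood T x eta) <= ln (likelihood T x theta).
  by rewrite ler_ln ?posrE; [exact: mx eta (lam_Theta eta0)|exact: L0|exact: L0].
have eq_ler (p q : R) : p = q -> p <= q by move=> ->.
have := le_trans (eq_ler _ _ (esym (ln_likelihoodE eta0))) (le_trans le (eq_ler _ _ (ln_likelihoodE l0))).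
rewrite lerD2l (etaE false) (etaE true).
by case: e etaE => _ /=; rewrite ?lerD2l ?lerD2r.
Qed.

Lemma scoreE theta i : Theta theta -> score T x theta i 0 =
  crd false i * ((2 * lam theta false)^-1 + M false - lam theta false * S false) +
  crd true i * ((2 * lam theta true)^-1 + M true - lam theta true * S true).
Proof.
move=> Th; have l0 e := Theta_lam e Th.
rewrite /score /gradient mxE.
pose k e l := 2^-1 * ln l + l * M e - l ^+ 2 / 2 * S e.
have dk e : is_derive (lam theta e) 1 (k e) ((2 * lam theta e)^-1 + M e - lam theta e * S e).
  rewrite /k; have l1 := l0 e.
  have d1 := is_derive1_ln l1.
  have did := is_derive_id (lam theta e) (1 : R).
  have D := is_deriveB (is_deriveD (is_deriveZ (2^-1 : R) d1) (is_deriveZ (M e) did))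
     (is_deriveZ (S e / 2) (is_deriveM did did)).
  have -> : (fun l => 2^-1 * ln l + l * M e - l ^+ 2 / 2 * S e) =
    2^-1 \*: (@ln R) + M e \*: id - (S e / 2) \*: (id * id).
    apply/funext => l; transitivity (2^-1 * ln l + M e * l - S e / 2 * (l * l)); last by [].
    by ring.
  apply: (is_derive_eq D); rewrite /GRing.scale /=; field.
  by rewrite gt_eqF.
pose G eta : R := ln 2 + (k false (lam eta false) + k true (lam eta true)).
(* The logarithmic formula holds only where both eigenvalues are positive, which is a neighbourhood
   of theta; that suffices for derivatives. *)
have nE : \near theta, ln (likelihood T x theta) = G theta.
  have N e : \forall eta \near theta, 0 < lam eta e.
    have c : lam eta e @[eta --> theta] --> lam theta e.
      have c00 : (eta : 'cV[R]_2) 0 0 @[eta --> theta] --> theta 0 0.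
        exact: (@coord_continuous R 2 1 0 0 theta).
      have c10 : (eta : 'cV[R]_2) 1 0 @[eta --> theta] --> theta 1 0.
        exact: (@coord_continuous R 2 1 1 0 theta).
      apply: (@cvgD _ _ _ (nbhs theta) (nbhs_filter theta)); first exact: c00.
      by apply: (@cvgMl_tmp _ _ (nbhs theta) (nbhs_filter theta)); exact: c10.
    by apply: (cvgr_gt _ c); exact: l0.
  near=> eta; rewrite ln_likelihoodE// => e.
  by case: e; near: eta; exact: N.
rewrite (near_eq_derive _ nE) -!crd_lam.
have d e := is_derive_lam (delta_mx i 0 : 'cV[R]_2) (dk e).
have D := is_deriveD (is_derive_cst (ln 2) theta (delta_mx i 0 : 'cV[R]_2)) (is_deriveD (d false) (d true)).
by rewrite (@derive_val _ _ _ _ _ _ _ D) add0r.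
Unshelve. all: by end_near. Qed.

End likelihood_in_eigenvalues.

(** * Integrals over an event determined by restricted laws *)

Section restricted_laws.
Context {d} {Omega : measurableType d} {R : realType}.
Variable P : probability Omega R.
Implicit Types (A : set Omega) (V : Omega -> 'cV[R]_2).

Lemma ge0_integral_mrestr A (mA : measurable A) V (f : R * R -> \bar R) :
  measurable_fun setT (fun w => coords (V w)) ->
  measurable_fun setT f -> (forall z, 0 <= f z)%E ->
  (\int[P]_(w in A) f (coords (V w)) = \int[mrestr P mA]_w f (coords (V w)))%E.
Proof.
move=> mV mf f0.
have mfV : measurable_fun setT (fun w => f (coords (V w))) by exact: measurableT_comp.
have nA : mrestr P mA (~` A) = 0%E by rewrite /mrestr setICl measure0.
rewrite [RHS](ge0_negligible_integral _ _ _ _ nA)//; last exact: measurableC.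
rewrite setTD setCK.
by apply: eq_measure_integral => B mB BA; rewrite -[RHS]/(P (B `&` A)) setIidl.
Qed.

Lemma same_law_integral (m1 m2 : {measure set Omega -> \bar R}) V V' (f : R * R -> \bar R) :
  measurable_fun setT (fun w => coords (V w)) ->
  measurable_fun setT (fun w => coords (V' w)) ->
  (forall B, measurable B -> m1 (hits V B) = m2 (hits V' B)) ->
  measurable_fun setT f -> (forall z, 0 <= f z)%E ->
  (\int[m1]_w f (coords (V w)) = \int[m2]_w f (coords (V' w)))%E.
Proof.
move=> mV mV' m12 mf f0.
have E1 := ge0_integral_pushforward mV m1 measurableT mf (fun z _ => f0 z).
have E2 := ge0_integral_pushforward mV' m2 measurableT mf (fun z _ => f0 z).
apply: etrans (esym E1) (etrans _ E2).
by apply: eq_measure_integral => B mB _; exact: m12.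
Qed.

Lemma restricted_law_integral A A' V V' (f : R * R -> \bar R) :
  measurable A -> measurable A' ->
  measurable_fun setT (fun w => coords (V w)) ->
  measurable_fun setT (fun w => coords (V' w)) ->
  (forall B, measurable B -> P (A `&` hits V B) = P (A' `&` hits V' B)) ->
  measurable_fun setT f -> (forall z, 0 <= f z)%E ->
  (\int[P]_(w in A) f (coords (V w)) = \int[P]_(w in A') f (coords (V' w)))%E.
Proof.
move=> mA mA' mV mV' PV mf f0.
rewrite (ge0_integral_mrestr mA mV mf f0) (ge0_integral_mrestr mA' mV' mf f0).
apply: same_law_integral => // B mB.
have H : P (hits V B `&` A) = P (hits V' B `&` A').
  by rewrite [hits V B `&` A]setIC [hits V' B `&` A']setIC; exact: PV.
exact H.
Qed.

Lemma restricted_law_Rintegral A A' V V' (f : R * R -> R) :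
  measurable A -> measurable A' ->
  measurable_fun setT (fun w => coords (V w)) ->
  measurable_fun setT (fun w => coords (V' w)) ->
  (forall B, measurable B -> P (A `&` hits V B) = P (A' `&` hits V' B)) ->
  measurable_fun setT f ->
  \int[P]_(w in A) f (coords (V w)) = \int[P]_(w in A') f (coords (V' w)).
Proof.
move=> mA mA' mV mV' PV mf; rewrite /Rintegral; congr fine.
have mfE : measurable_fun setT (EFin \o f) by exact/measurable_EFinP.
have E1 := restricted_law_integral mA mA' mV mV' PV (measurable_funepos mfE) (funepos_ge0 _).
have E2 := restricted_law_integral mA mA' mV mV' PV (measurable_funeneg mfE) (funeneg_ge0 _).
have pE (V1 : Omega -> 'cV[R]_2) : (fun w => ((EFin \o f)^\+)%E (coords (V1 w))) =
    ((fun w => (f (coords (V1 w)))%:E)^\+)%E by apply/funext => w; rewrite /= !funeposE.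
have nE (V1 : Omega -> 'cV[R]_2) : (fun w => ((EFin \o f)^\-)%E (coords (V1 w))) =
    ((fun w => (f (coords (V1 w)))%:E)^\-)%E by apply/funext => w; rewrite /= !funenegE.
rewrite !pE in E1; rewrite !nE in E2.
rewrite [LHS]integralE [RHS]integralE.
exact (f_equal2 (fun u v : \bar R => u - v)%E E1 E2).
Qed.

End restricted_laws.

(** * The regression function *)

Section regression.
Context {d} {Omega : measurableType d} {R : realType}.
Variables (P : probability Omega R) (theta : 'cV[R]_2) (X : R -> Omega -> 'cV[R]_2).
Hypothesis Th : Theta theta.
Hypothesis cX : continuous_process X.
Hypothesis SX : stationary_OU P theta X.

Let a e : R := lam theta e.

Let mX t : 0 <= t -> measurable_fun setT (fun w => coords (X t w)).
Proof. by have [mX _] := cX; exact: mX. Qed.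

Lemma coord_pr (v : 'cV[R]_2) i : v i 0 =
  evec false i 0 * pr false v + evec true i 0 * pr true v.
Proof.
have E : (1 : 'M[R]_2) *m v = v by exact: mul1mx.
by rewrite -[in LHS]E -eproj_sum mulmxDl !eproj_mul !mxE; ring.
Qed.

(** Stationarity at two times: the pairs (X_T, X_{T+h}) and (X_0, X_h) have the same joint law,
    which reduces the regression at time T to the one at time 0. *)
Lemma stationary_shift e (B : set (R * R)) T h : measurable B -> 0 <= T -> 0 <= h ->
  \int[P]_(w in hits (X T) B) pr e (X (T + h) w) =
  \int[P]_(w in hits (X 0) B) pr e (X h w).
Proof.
move=> mB T0 h0; have [W [_ _ _ st _]] := SX.
have Th0 : 0 <= T + h by exact: addr_ge0.
have E (V : Omega -> 'cV[R]_2) w : pr e (V w) = (fun z => pr e (col2 z)) (coords (V w)).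
  by rewrite /pr !mxE.
under eq_Rintegral do rewrite (E (X (T + h))).
under [RHS]eq_Rintegral do rewrite (E (X h)).
apply: (@restricted_law_Rintegral _ _ _ P (hits (X T) B) (hits (X 0) B) (X (T + h)) (X h)
  (fun z => pr e (col2 z))); try exact: mX.
- by apply: measurable_hits => //; exact: mX.
- by apply: measurable_hits => //; exact: mX.
- move=> C mC.
  have := st T (fun n => if n is 0%N then 0 else h) 2%N
    (fun n => if n is 0%N then B else C) T0.
  rewrite !bigcap_mkord !big_ord_recl !big_ord0 /= !setIT add0r [h + T]addrC.
  by apply; case.
- have : measurable_fun setT (fun z : R * R => (Num.sqrt 2)^-1 * z.1 + (sg e * (Num.sqrt 2)^-1) * z.2).
    by apply: measurable_funD; apply: measurable_funM => //.
  by apply: eq_measurable_fun => z _; rewrite /pr !mxE.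
Qed.

Lemma regression_pr e (B : set (R * R)) T h : measurable B -> 0 <= T -> 0 < h ->
  \int[P]_(w in hits (X T) B) pr e (X (T + h) w) =
  expR (- h * a e) * \int[P]_(w in hits (X T) B) pr e (X T w).
Proof.
move=> mB T0 h0; rewrite (stationary_shift e mB T0 (ltW h0)).
have := stationary_shift e mB T0 (lexx 0); rewrite addr0 => ->.
have [W [h1 h2 h3 _ h4]] := SX.
rewrite (initial_regression Th cX h1 h2 h3 h4 h0 e mB); congr (expR _ * _).
by rewrite !mulNr mulrC.
Qed.

Lemma regression_OU h : 0 < h -> regression_function P X h (r h ^~ theta).
Proof.
move=> h0.
have [W [_ _ _ _ Xl]] := SX.
split.
  have m e : measurable_fun setT (fun z : R * R => pr e (col2 z)).
    apply: measurable_pr; rewrite [X in measurable_fun _ X](_ : _ = id)//.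
    by apply/funext => -[x y]; rewrite /coords !mxE.
  have mi i : measurable_fun setT (fun z : R * R => r h (col2 z) theta i 0).
    under eq_fun do rewrite rE !mxE.
    by apply: measurable_funD; apply: measurable_funM => //; apply: measurable_funM.
  exact: measurable_fun_pair (mi 0) (mi 1).
move=> T T0.
have f e t : 0 <= t -> finmom P (fun w => pr e (X t w)).
  by move=> t0; exact: (marginal_finmom Th cX Xl e t0).
have fX e := f e T T0; have fXh e := f e (T + h) (addr_ge0 T0 (ltW h0)).
have gE i w : r h (X T w) theta i 0 =
  (evec false i 0 * expR (- h * a false)) * pr false (X T w) +
  (evec true i 0 * expR (- h * a true)) * pr true (X T w).
  by rewrite rE !mxE -/(a _) -/(a _); ring.
split.
  move=> i; have F := finmomD (finmomZ (evec false i 0 * expR (- h * a false)) (fX false))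
    (finmomZ (evec true i 0 * expR (- h * a true)) (fX true)).
  by under eq_fun do rewrite gE; exact: finmom_integrable F.
move=> B mB.
have mhB : measurable (hits (X T) B) by apply: measurable_hits => //; exact: mX.
have lin c0 c1 t : 0 <= t -> \int[P]_(w in hits (X T) B) (c0 * pr false (X t w) + c1 * pr true (X t w)) =
  c0 * \int[P]_(w in hits (X T) B) pr false (X t w) + c1 * \int[P]_(w in hits (X T) B) pr true (X t w).
  move=> t0.
  have i0 := integrableS measurableT mhB (@subsetT _ _) (finmom_integrable (f false t t0)).
  have i1 := integrableS measurableT mhB (@subsetT _ _) (finmom_integrable (f true t t0)).
  have j0 := integrableZl mhB c0 i0; have j1 := integrableZl mhB c1 i1.
  by rewrite (RintegralD mhB j0 j1)// !RintegralZl.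
apply/matrixP => i j; rewrite !mxE ord1.
under eq_Rintegral do rewrite coord_pr.
under [RHS]eq_Rintegral do rewrite gE.
rewrite (lin _ _ _ (addr_ge0 T0 (ltW h0))) (lin _ _ _ T0) !(regression_pr _ mB T0 h0).
by ring.
Qed.

End regression.

(** * Entrywise limits, the Jacobian and quadratic expressions *)

Lemma cvg_mx22 {T : Type} {R : realType} (F : set_system T) {FF : Filter F}
    (f : T -> 'M[R]_2) (A : 'M[R]_2) :
  (forall i j, f t i j @[t --> F] --> A i j) -> f t @[t --> F] --> A.
Proof.
move=> H.
have E (B : 'M[R]_2) : B = (B 0 0 *: delta_mx 0 0 + B 0 1 *: delta_mx 0 1) +
    (B 1 0 *: delta_mx 1 0 + B 1 1 *: delta_mx 1 1).
  by rewrite {1}(matrix_sum_delta B) !sum2E.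
rewrite (E A); under eq_fun do rewrite (E (f _)).
by apply: cvgD; apply: cvgD; apply: cvgZr_tmp; exact: H.
Qed.

Lemma jacobian_r {R : realType} (h : R) (z theta : 'cV[R]_2) i j :
  jacobianmx (r h z) theta i j =
  crd false j * (- h * expR (- h * lam theta false) * pr false z * evec false i 0) +
  crd true j * (- h * expR (- h * lam theta true) * pr true z * evec true i 0).
Proof.
rewrite /jacobianmx mxE.
have -> : r h z = fun eta =>
    (expR (- h * lam eta false) * pr false z) *: evec false +
    (expR (- h * lam eta true) * pr true z) *: evec true.
  by apply/funext => eta; rewrite rE.
have de (b : R) e : is_derive b (1 : R) (fun t => expR (- h * t) * pr e z)
    (- h * expR (- h * b) * pr e z).
  have d1 : is_derive b (1 : R) (fun t => - h * t) (- h).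
    have := is_deriveZ (- h) (is_derive_id b (1 : R)).
    by move=> D; apply: (is_derive_eq D); rewrite /GRing.scale /= mulr1.
  have D := is_deriveZ (pr e z) (is_derive1_comp (is_derive_expR (- h * b)) d1).
  have -> : (fun t => expR (- h * t) * pr e z) = pr e z \*: (expR \o (fun t => - h * t)).
    by apply/funext => t; exact: mulrC.
  by apply: (is_derive_eq D); rewrite /GRing.scale /=; ring.
have dj e := is_derive_lam (delta_mx j 0 : 'cV[R]_2)
  (is_derive_scalel (evec e) (de (lam theta e) e)).
have D := is_deriveD (dj false) (dj true).
by rewrite (@derive_val _ _ _ _ _ _ _ D) !mxE !crd_lam; ring.
Qed.

Section quadratic_forms.
Context {d} {T : measurableType d} {R : realType}.
Variables (P : probability T R) (n : bool -> T -> R).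
Hypothesis iN : forall e e', P.-integrable setT (EFin \o (fun w => n e w * n e' w)).

Lemma Rintegral_quadratic (c : bool -> bool -> R) :
  \int[P]_w (c false false * (n false w * n false w) + c false true * (n false w * n true w) +
    (c true false * (n true w * n false w) + c true true * (n true w * n true w))) =
  c false false * \int[P]_w (n false w * n false w) +
  c false true * \int[P]_w (n false w * n true w) +
  (c true false * \int[P]_w (n true w * n false w) +
   c true true * \int[P]_w (n true w * n true w)).
Proof.
have i e e' := prob_integrableZ (c e e') (iN e e').
have iD e := prob_integrableD (i e false) (i e true).
rewrite (RintegralD _ (iD false) (iD true))//.
rewrite (RintegralD _ (i false false) (i false true))//.
rewrite (RintegralD _ (i true false) (i true true))//.
by rewrite !RintegralZl.
Qed.

Lemma quadratic_integrable (c : bool -> bool -> R) :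
  P.-integrable setT (EFin \o (fun w => c false false * (n false w * n false w) +
    c false true * (n false w * n true w) +
    (c true false * (n true w * n false w) + c true true * (n true w * n true w)))).
Proof.
have i e e' := prob_integrableZ (c e e') (iN e e').
have iD e := prob_integrableD (i e false) (i e true).
exact: prob_integrableD (iD false) (iD true).
Qed.

End quadratic_forms.

(** * Fisher information and second moments under the stationary law *)

Section information.
Context {d} {Omega : measurableType d} {R : realType}.
Variables (P : probability Omega R) (theta : 'cV[R]_2) (X : R -> Omega -> 'cV[R]_2).
Hypothesis Th : Theta theta.
Hypothesis cX : continuous_process X.
Hypothesis SX : stationary_OU P theta X.

Let a e : R := lam theta e.
Let a0 e : 0 < a e. Proof. exact: Theta_lam. Qed.

Lemma score_score1 T w i : score T (X ^~ w) theta i 0 =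
  crd false i * score1 theta X false T w + crd true i * score1 theta X true T w.
Proof.
rewrite scoreE//; last by move=> e; exact: continuous_pr.
by congr (_ * _ + _ * _); rewrite /score1 /stoch_integral;
  [have l := Theta_lam false Th|have l := Theta_lam true Th];
  move: (\int[_]_(_ in _) _) => S; field; rewrite gt_eqF.
Qed.

Lemma invmx_Q_eproj : invmx (Q theta) = \matrix_(i, j)
  (crd false i * crd false j * (2 * a false)^-1 + crd true i * crd true j * (2 * a true)^-1).
Proof.
rewrite invmx_Q// /a; have l0 := Theta_lam false Th; have l1 := Theta_lam true Th.
have E0 : theta 0 0 = 2^-1 * (lam theta false + lam theta true) by rewrite /lam /sg; field.
have E1 : theta 1 0 = 2^-1 * (lam theta false - lam theta true) by rewrite /lam /sg; field.
apply/matrixP => i j; rewrite !mxE E0 E1.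
move: (lam theta false) (lam theta true) l0 l1 => u v u0 v0.
elim/ord2P: i; elim/ord2P: j; rewrite /crd /sg /=; field; rewrite !gt_eqF//.
Qed.

(** In the parameter theta the score is the combination of the two scalar scores along the
    eigenvectors. Its normalised covariance loses the mixed terms in the limit, and the rest is the
    spectral form of Q^-1. *)
Lemma fisher_information_cvg :
  T^-1 *: fisher_information P X theta T @[T --> +oo] --> invmx (Q theta).
Proof.
rewrite invmx_Q_eproj; apply: cvg_mx22 => i j; rewrite !mxE.
pose G T e e' := \int[P]_w (score1 theta X e T w * score1 theta X e' T w).
have L e e' := @score1_cov_cvg _ _ _ _ _ _ Th cX SX e e'.
pose c e e' := crd e i * crd e' j : R.
pose F T := c false false * (T^-1 * G T false false) + c false true * (T^-1 * G T false true) +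
   (c true false * (T^-1 * G T true false) + c true true * (T^-1 * G T true true)).
have LF : F T @[T --> +oo] --> (c false false * (2 * a false)^-1 + c false true * 0) +
    (c true false * 0 + c true true * (2 * a true)^-1).
  by apply: cvgD; apply: cvgD; apply: cvgMl_tmp; exact: L.
rewrite !mulr0 addr0 add0r in LF.
apply: cvg_trans LF; apply: near_eq_cvg; near=> T.
have T1 : 1 <= T by near: T; apply: nbhs_pinfty_ge; rewrite num_real.
have iS e e' := (score1_cov Th cX SX e e' T1).1.
have E : T^-1 * \int[P]_w (score T (X ^~ w) theta *m (score T (X ^~ w) theta)^T) i j = F T.
  have pE (s : 'cV[R]_2) : (s *m s^T) i j = s i 0 * s j 0.
    by rewrite [LHS]mxE big_ord1 [X in _ * X]mxE.
  have Q := Rintegral_quadratic iS c.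
  have I : \int[P]_w (score T (X ^~ w) theta *m (score T (X ^~ w) theta)^T) i j =
    c false false * G T false false + c false true * G T false true +
    (c true false * G T true false + c true true * G T true true).
    rewrite -[RHS]Q; apply: eq_Rintegral => w _.
    rewrite pE !score_score1 /c.
    by move: (score1 theta X false T w) (score1 theta X true T w) => s t; ring.
  rewrite I /F; move: (G T false false) (G T false true) (G T true false) (G T true true).
  by move=> G0 G1 G2 G3; ring.
rewrite -E [RHS]mxE; congr (_ * _); rewrite [RHS]mxE.
by [].
Unshelve. all: by end_near. Qed.

Lemma asymptotic_informationE : asymptotic_information P X theta = invmx (Q theta).
Proof. by apply: cvg_lim fisher_information_cvg; exact: norm_hausdorff. Qed.

Let y e w : R := pr e (X 0 w).

Let mX0 : measurable_fun setT (fun w => coords (X 0 w)).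
Proof. by have [mX _] := cX; exact: mX. Qed.

Let X0law : has_law P (X 0) (mu_ theta).
Proof. by have [W [_ _ _ _ H]] := SX; exact: H. Qed.

Let yN e : centered_normal P (2 * a e)^-1 (y e).
Proof. exact: stationary_law_normal. Qed.

(** Polarisation again: the variance of sqrt 2 times the first coordinate of X_0 is the sum of the
    variances of the rotated ones. *)
Lemma initial_orth : \int[P]_w (y false w * y true w) = 0.
Proof.
have u0 e : 0 < (2 * a e)^-1 by rewrite invr_gt0; apply: mulr_gt0 (a0 e); rewrite ltr0n.
have SE i j : (2^-1 *: invmx (Q theta)) i j = 2^-1 *
    (crd false i * crd false j * (2 * a false)^-1 + crd true i * crd true j * (2 * a true)^-1).
  by rewrite mxE invmx_Q_eproj mxE.
pose u := (2 * a false)^-1; pose v := (2 * a true)^-1.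
have u1 := u0 false; have v1 := u0 true; rewrite -/u -/v in u1 v1.
have S00 : (2^-1 *: invmx (Q theta)) 0 0 = 2^-1 * (u + v).
  by rewrite SE /crd /= !mul1r.
have S01 : (2^-1 *: invmx (Q theta)) 0 1 = 2^-1 * (u - v).
  by rewrite SE /crd /sg /= !mul1r mulN1r.
have S10 : (2^-1 *: invmx (Q theta)) 1 0 = 2^-1 * (u - v).
  by rewrite SE /crd /sg /= !mulr1 mul1r mulN1r.
have S11 : (2^-1 *: invmx (Q theta)) 1 1 = 2^-1 * (u + v).
  by rewrite SE /crd /sg /= mulrNN !mul1r.
have h1 : 0 < (2^-1 *: invmx (Q theta)) 1 1 by rewrite S11 mulr_gt0// addr_gt0.
have h2 : 0 < \det (2^-1 *: invmx (Q theta)).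
  rewrite det2E S00 S11 S01 S10 [ltRHS](_ : _ = u * v); first by rewrite mulr_gt0.
  by field.
have N := gaussian_law_normal mX0 (Num.sqrt 2) 0 (etrans S10 (esym S01)) h1 h2 X0law.
rewrite S00 in N.
have Eu := normal_variance (yN false); have Ev := normal_variance (yN true).
have f0 := finmom_normal (yN false); have f1 := finmom_normal (yN true).
have := normal_variance N.
rewrite (@EE_expand _ _ _ P _ [:: fun w => y false w ^+ 2;
   fun w => y true w ^+ 2; fun w => 2 * (y false w * y true w)]).
- rewrite [LHS]/= Eu Ev EE_Z; last exact: finmomM f0 f1.
  rewrite -/u -/v expr0n /= sqr_sqrtr// !mulr0 !addr0.
  by move: (\int[P]_w _) => I0; lra.
- by do ![split; first by finm].
- move=> w /=; rewrite /y /pr /sg.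
  have E : Num.sqrt 2 = 2 * (Num.sqrt 2)^-1 :> R.
    have q0 : Num.sqrt 2 != 0 :> R by rewrite gt_eqF// sqrtr_gt0.
    by apply: (mulIf q0); rewrite mulfVK// -expr2 sqr_sqrtr.
  transitivity ((2 * (Num.sqrt 2)^-1 * X 0 w 0 0) ^+ 2); last by ring.
  by rewrite -E mul0r addr0.
Qed.

(** The integral is an expectation at X_0, whose law is mu_theta; orthogonality removes the mixed
    coefficients. *)
Lemma mu_quadratic (c : bool -> bool -> R) :
  \int[mu_ theta]_z (c false false * (pr false (col2 z) * pr false (col2 z)) +
    c false true * (pr false (col2 z) * pr true (col2 z)) +
    (c true false * (pr true (col2 z) * pr false (col2 z)) +
     c true true * (pr true (col2 z) * pr true (col2 z)))) =
  c false false * (2 * a false)^-1 + c true true * (2 * a true)^-1.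
Proof.
have iy e e' : P.-integrable setT (EFin \o (fun w => y e w * y e' w)).
  exact: finmom_integrable (finmomM (finmom_normal (yN e)) (finmom_normal (yN e'))).
have cK (v : 'cV[R]_2) : col2 (coords v) = v.
  by apply/colP => i; elim/ord2P: i; rewrite !mxE.
have Iy := quadratic_integrable iy c.
have m e : measurable_fun setT (fun z : R * R => pr e (col2 z)).
  apply: measurable_pr; rewrite [X in measurable_fun _ X](_ : _ = id)//.
  by apply/funext => -[u v]; rewrite /coords !mxE.
rewrite (law_Rintegral mX0 X0law).
- under eq_Rintegral do rewrite cK.
  rewrite (Rintegral_quadratic iy c).
  have s : \int[P]_w (y true w * y false w) = 0.
    by under eq_Rintegral do rewrite mulrC; exact: initial_orth.
  have v e : \int[P]_w (y e w * y e w) = (2 * a e)^-1 by exact: (normal_variance (yN e)).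
  by rewrite s initial_orth !v !mulr0 addr0 add0r.
- by do ![apply: measurable_funD | apply: measurable_funM => // | exact: m].
- by under eq_fun do rewrite cK; exact: Iy.
Qed.

End information.

(** * Risk of the plug-in estimator *)

Section plug_in_risk.
Context {d} {Omega : measurableType d} {R : realType}.
Notation mu := (@lebesgue_measure R).
Variables (P : probability Omega R) (theta : 'cV[R]_2) (X thetahat : R -> Omega -> 'cV[R]_2).
Variable h : R.
Hypothesis h0 : 0 < h.
Hypothesis Th : Theta theta.
Hypothesis cX : continuous_process X.
Hypothesis SX : stationary_OU P theta X.
Hypothesis mhat : forall T, 0 < T -> measurable_fun setT (fun w => coords (thetahat T w)).
Hypothesis mle : forall T, 0 < T -> {ae P, forall w, Theta (thetahat T w) /\
  forall eta, Theta eta ->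
    likelihood T (X ^~ w) eta <= likelihood T (X ^~ w) (thetahat T w)}.

Let a e : R := lam theta e.
Let a0 e : 0 < a e. Proof. exact: Theta_lam. Qed.
Let chat T e w : R := lam (thetahat T w) e.

Lemma lam_pr (v : 'cV[R]_2) e : lam v e = Num.sqrt 2 * pr e v.
Proof.
have q0 : Num.sqrt 2 != 0 :> R by rewrite gt_eqF// sqrtr_gt0.
by rewrite /lam /pr; field.
Qed.

Let mchat T e : 0 < T -> measurable_fun setT (chat T e).
Proof.
move=> T0; rewrite /chat; under eq_fun do rewrite lam_pr.
by apply: measurable_funM => //; exact: measurable_pr (mhat T0).
Qed.

Let chat_root T : 0 < T -> {ae P, forall w, forall e, 0 < chat T e w /\
  (2 * chat T e w)^-1 + 2^-1 * (T - (pr e (X 0 w) ^+ 2 + pr e (X T w) ^+ 2))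
   - chat T e w * \int[mu]_(s in `[0, T]) (pr e (X s w) ^+ 2) = 0}.
Proof.
move=> T0; apply: filterS (mle T0) => w [Tw mw] e; split; first exact: Theta_lam.
by apply: mle_eigenvalue_root => // b; exact: continuous_pr.
Qed.

Let p T e w : R := perr theta h chat T e w.

Lemma plug_in_error T w z : r h z (thetahat T w) - r h z theta =
  (p T false w * pr false z) *: evec false + (p T true w * pr true z) *: evec true.
Proof.
rewrite !rE /p /perr -/(chat T false w) -/(chat T true w).
by apply/matrixP => i j; rewrite !mxE; ring.
Qed.

(** The inner expectation is a quadratic expression in the rotated coordinates of z. Integration
    over z removes the mixed term, so the covariance of the two eigenvalue errors never has to be
    evaluated. *)
Lemma plug_in_risk_entry T i j : 0 < T ->
  mxintegral (mu_ theta) setT (fun z => mxintegral P setT (fun w =>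
    (r h (col2 z) (thetahat T w) - r h (col2 z) theta) *m
    (r h (col2 z) (thetahat T w) - r h (col2 z) theta)^T)) i j =
  \int[P]_w (p T false w ^+ 2) * eproj false i j * (2 * a false)^-1 +
  \int[P]_w (p T true w ^+ 2) * eproj true i j * (2 * a true)^-1.
Proof.
move=> T0.
have ip e e' := perr_integrable Th h0 mchat chat_root e e' T0.
pose G e e' := \int[P]_w (p T e w * p T e' w).
pose K e e' := G e e' * (evec e i 0 * evec e' j 0).
have inner z : mxintegral P setT (fun w =>
    (r h z (thetahat T w) - r h z theta) *m (r h z (thetahat T w) - r h z theta)^T) i j =
  K false false * (pr false z * pr false z) + K false true * (pr false z * pr true z) +
  (K true false * (pr true z * pr false z) + K true true * (pr true z * pr true z)).
  pose c e e' := (pr e z * pr e' z) * (evec e i 0 * evec e' j 0) : R.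
  have I := Rintegral_quadratic ip c.
  rewrite [LHS]mxE.
  transitivity (c false false * G false false + c false true * G false true +
    (c true false * G true false + c true true * G true true)).
    rewrite -[RHS]I; apply: eq_Rintegral => w _.
    have pE (s : 'cV[R]_2) : (s *m s^T) i j = s i 0 * s j 0.
      by rewrite [LHS]mxE big_ord1 [X in _ * X]mxE.
    have vE k : ((p T false w * pr false z) *: evec false +
      (p T true w * pr true z) *: evec true) k 0 =
      p T false w * pr false z * evec false k 0 + p T true w * pr true z * evec true k 0.
      by rewrite mxE [X in X + _]mxE [X in _ + X]mxE.
    rewrite pE plug_in_error !vE /c /p.
    move: (evec false i 0) (evec true i 0) (evec false j 0) (evec true j 0)
      (pr false z) (pr true z) (perr theta h chat T false w)
      (perr theta h chat T true w) => *; ring.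
  rewrite /K /c; move: (G false false) (G false true) (G true false) (G true true).
  move: (evec false i 0) (evec true i 0) (evec false j 0) (evec true j 0)
      (pr false z) (pr true z) => *; ring.
rewrite [LHS]mxE; under eq_Rintegral do rewrite inner.
rewrite (mu_quadratic Th cX SX K) /K !evec_mul.
by [].
Qed.

(** On each eigenprojection the factor 2a of the limiting mean square error cancels against the
    variance 1/(2a) of the coordinate of z. *)
Lemma plug_in_risk_cvg :
  T *: mxintegral (mu_ theta) setT (fun z => mxintegral P setT (fun w =>
    (r h (col2 z) (thetahat T w) - r h (col2 z) theta) *m
    (r h (col2 z) (thetahat T w) - r h (col2 z) theta)^T)) @[T --> +oo] -->
  h ^+ 2 *: expmx (- (2 * h) *: Q theta).
Proof.
apply: cvg_mx22 => i j; rewrite expmx_Q.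
have L e := @perr_sqr_cvg _ _ _ _ _ _ Th cX SX _ _ h0 mchat chat_root e.
have LE : T * \int[P]_w (p T false w ^+ 2) * (eproj false i j * (2 * a false)^-1) +
    T * \int[P]_w (p T true w ^+ 2) * (eproj true i j * (2 * a true)^-1) @[T --> +oo] -->
    2 * a false * h ^+ 2 * expR (- (2 * h) * a false) * (eproj false i j * (2 * a false)^-1) +
    2 * a true * h ^+ 2 * expR (- (2 * h) * a true) * (eproj true i j * (2 * a true)^-1).
  by apply: cvgD; apply: cvgMr_tmp; exact: L.
have -> : (h ^+ 2 *: spec_exp (- (2 * h)) theta) i j =
    2 * a false * h ^+ 2 * expR (- (2 * h) * a false) * (eproj false i j * (2 * a false)^-1) +
    2 * a true * h ^+ 2 * expR (- (2 * h) * a true) * (eproj true i j * (2 * a true)^-1).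
  have E M N : (h ^+ 2 *: (M + N : 'M[R]_2)) i j = h ^+ 2 * (M i j + N i j) by rewrite !mxE.
  have E2 c (M : 'M[R]_2) : (c *: M) i j = c * M i j by rewrite mxE.
  rewrite /spec_exp E !E2 -/(a _) -/(a _).
  have := a0 false; have := a0 true.
  move: (a false) (a true) (eproj false i j) (eproj true i j) => u v m n v0 u0.
  move: (expR _) (expR _) => x y; field.
  by rewrite !gt_eqF.
apply: cvg_trans LE; apply: near_eq_cvg; near=> T.
have T0 : 0 < T by near: T; apply: nbhs_pinfty_gt; rewrite num_real.
have E2 c (M : 'M[R]_2) : (c *: M) i j = c * M i j by rewrite mxE.
rewrite E2 (plug_in_risk_entry _ _ T0).
move: (\int[P]_w (p T false w ^+ 2)) (\int[P]_w (p T true w ^+ 2)) => x y; ring.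
Unshelve. all: by end_near. Qed.

End plug_in_risk.

(** * The efficiency bound and the theorem *)

Lemma efficiency_bound {R : realType} {d} {Omega : measurableType d} (P : probability Omega R)
    (theta : 'cV[R]_2) (X : R -> Omega -> 'cV[R]_2) (h : R) :
  Theta theta -> continuous_process X -> stationary_OU P theta X ->
  mxintegral (mu_ theta) setT (fun z =>
    jacobianmx (r h (col2 z)) theta *m invmx (asymptotic_information P X theta) *m
    (jacobianmx (r h (col2 z)) theta)^T) = h ^+ 2 *: expmx (- (2 * h) *: Q theta).
Proof.
move=> Th cX SX; rewrite (asymptotic_informationE Th cX SX) invmxK expmx_Q.
pose a e : R := lam theta e.
pose k e i : R := - h * expR (- h * a e) * evec e i 0.
apply/matrixP => i j; rewrite [LHS]mxE.
(* The rows of J are combinations of the vectors (1, sg e), which are orthogonal eigenvectors of Q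
   of squared length 2; hence J Q J' has no mixed term and its diagonal ones carry 2a. *)
pose K e e' := if e == e' then 2 * a e * (k e i * k e' j) else 0.
transitivity (\int[mu_ theta]_z (K false false * (pr false (col2 z) * pr false (col2 z)) +
    K false true * (pr false (col2 z) * pr true (col2 z)) +
    (K true false * (pr true (col2 z) * pr false (col2 z)) +
     K true true * (pr true (col2 z) * pr true (col2 z))))).
  apply: eq_Rintegral => z _.
  have JE (J : 'M[R]_2) : (J *m Q theta *m J^T) i j =
      (J i 0 * theta 0 0 + J i 1 * theta 1 0) * J j 0 +
      (J i 0 * theta 1 0 + J i 1 * theta 0 0) * J j 1.
    by rewrite [LHS]mxE sum2E [J^T 0 j]mxE [J^T 1 j]mxE [(J *m _) i 0]mxE [(J *m _) i 1]mxE
      !sum2E !mxE.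
  rewrite JE !jacobian_r /crd /K /k /a /=.
  rewrite /lam /sg.
  move: (expR _) (expR _).
  move: (evec false i 0) (evec true i 0) (evec false j 0) (evec true j 0)
      (pr false (col2 z)) (pr true (col2 z)) (theta 0 0) (theta 1 0) => *; ring.
rewrite (mu_quadratic Th cX SX K) /K /=.
have l0 := Theta_lam false Th; have l1 := Theta_lam true Th.
have E M N : (h ^+ 2 *: (M + N : 'M[R]_2)) i j = h ^+ 2 * (M i j + N i j) by rewrite !mxE.
have E2 c (M : 'M[R]_2) : (c *: M) i j = c * M i j by rewrite mxE.
rewrite /spec_exp E !E2 -!evec_mul /k /a.
have X2 e : expR (- (2 * h) * lam theta e) = expR (- h * lam theta e) ^+ 2.
  by rewrite expr2 -expRD; congr expR; ring.
rewrite !X2; move: (expR _) (expR _).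
move: (evec false i 0) (evec true i 0) (evec false j 0) (evec true j 0) => *.
by field; rewrite !gt_eqF.
Qed.

Theorem mainTheorem8 (R : realType) (d : measure_display)
    (Omega : measurableType d) (P : 'cV[R]_2 -> probability Omega R)
    (X thetahat : R -> Omega -> 'cV[R]_2) (h : R) :
  0 < h ->
  continuous_process X ->
  (forall theta, Theta theta -> stationary_OU (P theta) theta X) ->
  maximum_likelihood_estimator P X thetahat ->
  forall theta, Theta theta ->
    [/\ regression_function (P theta) X h (r h ^~ theta),
        T^-1 *: fisher_information (P theta) X theta T @[T --> +oo]
          --> asymptotic_information (P theta) X theta,
        asymptotic_information (P theta) X theta = invmx (Q theta),
        T *: mxintegral (mu_ theta) setT (fun z =>
               mxintegral (P theta) setT (fun w =>
                 (r h (col2 z) (thetahat T w) - r h (col2 z) theta) *m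
                 (r h (col2 z) (thetahat T w) - r h (col2 z) theta)^T))
          @[T --> +oo]
          --> mxintegral (mu_ theta) setT (fun z =>
                jacobianmx (r h (col2 z)) theta *m
                invmx (asymptotic_information (P theta) X theta) *m
                (jacobianmx (r h (col2 z)) theta)^T) &
        mxintegral (mu_ theta) setT (fun z =>
          jacobianmx (r h (col2 z)) theta *m
          invmx (asymptotic_information (P theta) X theta) *m
          (jacobianmx (r h (col2 z)) theta)^T) =
        h ^+ 2 *: expmx (- (2 * h) *: Q theta)].
Proof.
move=> h0 cX SXall mleX theta Th.
have SX := SXall theta Th.
have mhat T : 0 < T -> measurable_fun setT (fun w => coords (thetahat T w)).
  by move=> T0; have [] := mleX T T0.
have mle T : 0 < T -> {ae P theta, forall w, Theta (thetahat T w) /\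
    forall eta, Theta eta ->
      likelihood T (X ^~ w) eta <= likelihood T (X ^~ w) (thetahat T w)}.
  by move=> T0; have [_] := mleX T T0; exact.
have B := efficiency_bound h Th cX SX.
split.
- exact: (regression_OU Th cX SX h0).
(* The information is defined by [lim], which has a value even without convergence; here the
   convergence itself is established. *)
- by rewrite (asymptotic_informationE Th cX SX); exact: (fisher_information_cvg Th cX SX).
- exact: (asymptotic_informationE Th cX SX).
- by rewrite B; exact: (plug_in_risk_cvg h0 Th cX SX mhat mle).
- exact: B.
Qed.
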